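(* Let $A\in\mathcal M_3^s(\mathbb R)$. The variational formulation in strain $$\text{find } e\in\mathbb T^\perp\ \text{ such that }\ \frac1{|Y|}\int_Y\langle C e,\mu\rangle\,dy=-\Bigl\langle A,\frac1{|Y|}\int_Y C\mu\,dy\Bigr\rangle\quad\forall\mu\in\mathbb T^\perp \tag{a}$$ is equivalent to $$\text{find }\varphi_A\in H^1_{\#0}\ \text{ such that }\ \int_Y\langle C\,\nabla_s\varphi_A,\nabla_s v\rangle\,dy=-\Bigl\langle A,\int_Y C\,\nabla_s v\,dy\Bigr\rangle\quad\forall v\in H^1_{\#0}, \tag{b}$$ under the correspondence $e=\nabla_s\varphi_A$: if $\varphi_A$ solves (b) then $e=\nabla_s\varphi_A$ belongs to $\mathbb T^\perp$ and solves (a); conversely, if $e$ solves (a) then there is a unique $\varphi_A\in H^1_{\#0}$ with $\nabla_s\varphi_A=e$, and it solves (b).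
   Context: Let $\mathcal G\subset\mathbb R^3$ be the lattice (additive group) generated by three linearly independent vectors $g_1,g_2,g_3$, and let $Y=\{s_1g_1+s_2g_2+s_3g_3: s_1,s_2,s_3\in[0,1]\}$. A function on $\mathbb R^3$ is $\mathcal G$-periodic if it is invariant under translations by vectors of $\mathcal G$. $\mathcal M_3^s(\mathbb R)$ is the space of real symmetric $3\times3$ matrices, $\langle\cdot,\cdot\rangle$ is the Frobenius inner product of matrices, $\nabla_s v$ is the symmetric part of the gradient of $v$ (the strain), and $(\operatorname{div}\mu)_i=\sum_j\partial_j\mu_{ij}$ in the sense of distributions on $\mathbb R^3$. $H^1_\#$ is the space of $\mathcal G$-periodic vector fields in $H^1_{\rm loc}(\mathbb R^3,\mathbb R^3)$, with the $H^1(Y)$ norm; $H^1_{\#0}=\{v\in H^1_\#\mid\int_Y v\,dy=0\}$. $\mathbb L^2_{\#s}$ is the space of $\mathcal G$-periodic symmetric $3\times 3$ matrix fields in $L^2_{\rm loc}(\mathbb R^3)$, with the $L^2(Y)$ norm. $\mathbb T=\{\mu\in\mathbb L^2_{\#s}\mid\operatorname{div}\mu=0\}$ and $\mathbb T^\perp=\{e\in\mathbb L^2_{\#s}\mid\int_Y\langle e,\mu\rangle\,dy=0\ \forall\mu\in\mathbb T\}$. The rigidity tensor $C$ is a $\mathcal G$-periodic, measurable, essentially bounded field of fourth-order tensors on $\mathbb R^3$, with the usual symmetries of elasticity (for a.e. $y$, $C(y)$ is a self-adjoint linear map of $\mathcal M_3^s(\mathbb R)$ into itself), and uniformly positive definite: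 there is $\alpha>0$ with $\langle C(y)\xi,\xi\rangle\ge\alpha|\xi|^2$ for all $\xi\in\mathcal M_3^s(\mathbb R)$ and a.e. $y$. *)

(* Defs.v *)
From HB Require Import structures.
From mathcomp Require Import all_boot all_order all_algebra.
From mathcomp Require Import all_classical all_reals all_analysis.

Set Implicit Arguments.
Unset Strict Implicit.
Unset Printing Implicit Defensive.

Import Order.TTheory GRing.Theory Num.Theory.
Import numFieldNormedType.Exports.

Local Open Scope classical_set_scope.
Local Open Scope ring_scope.

(* The library attaches Lebesgue measure to [measurableTypeR R], an alias of R
   carrying the same (Borel) sigma-algebra under another display.  [R3 R] and
   [mR3 R] are therefore convertible: the former is used for the algebraic and
   topological structure, the latter for measurability. *)
Notation R3 R := (R * R * R)%type.
Notation mR3 R :=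
  (measurableTypeR R * measurableTypeR R * measurableTypeR R)%type.

Section Defs.
Context {R : realType}.

Definition leb3 : {measure set (mR3 R) -> \bar R} :=
  (@lebesgue_measure R \x @lebesgue_measure R \x @lebesgue_measure R)%E.

Definition lattice (g : 'I_3 -> R3 R) : set (R3 R) :=
  [set \sum_i g i *~ n i | n in [set: 'I_3 -> int]].

Definition cell (g : 'I_3 -> R3 R) : set (R3 R) :=
  [set \sum_i s i *: g i | s in [set s : 'I_3 -> R | forall i, 0 <= s i <= 1]].

Definition cell_volume (g : 'I_3 -> R3 R) : R := fine (leb3 (cell g)).

(* Fields are functions standing for their classes modulo a.e. equality, so
   periodicity and all pointwise conditions are required almost everywhere. *)
Definition ae_eq3 (T : Type) (f h : R3 R -> T) : Prop :=
  {ae leb3, forall y, f y = h y}.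

Definition periodic (g : 'I_3 -> R3 R) (T : Type) (f : R3 R -> T) : Prop :=
  forall a, lattice g a -> ae_eq3 (fun y => f (y + a)) f.

Definition sym_mx (xi : 'M[R]_3) : Prop := xi^T = xi.

Definition frob (xi eta : 'M[R]_3) : R := \sum_i \sum_j xi i j * eta i j.

Definition mx_integral (D : set (R3 R)) (F : R3 R -> 'M[R]_3) : 'M[R]_3 :=
  \matrix_(i, j) \int[leb3]_(y in D) F y i j.

Definition basis_vec (j : 'I_3) : R3 R :=
  ((j == 0%N :> nat)%:R, (j == 1%N :> nat)%:R, (j == 2%N :> nat)%:R).

Definition partial (j : 'I_3) (f : R3 R -> R) : R3 R -> R :=
  fun y => 'D_(basis_vec j) f y.

Definition partials (s : seq 'I_3) (f : R3 R -> R) : R3 R -> R :=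
  foldr partial f s.

Definition smooth (f : R3 R -> R) : Prop := forall s : seq 'I_3,
  continuous (partials s f) /\
  forall j y, derivable (partials s f) y (basis_vec j).

Definition test_fun (f : R3 R -> R) : Prop :=
  smooth f /\ compact (closure [set y | f y != 0]).

Definition L2loc (f : R3 R -> R) : Prop :=
  measurable_fun [set: mR3 R] f /\
  forall K : set (R3 R), compact K ->
    leb3.-integrable K (fun y => ((f y) ^+ 2)%:E).

(* [G y i j] is the weak derivative of [v_i] with respect to [y_j]. *)
Definition is_weak_grad (v : R3 R -> 'rV[R]_3) (G : R3 R -> 'M[R]_3) : Prop :=
  (forall i j, L2loc (fun y => G y i j)) /\
  forall i j phi, test_fun phi ->
    \int[leb3]_y (v y 0 i * partial j phi y) =
    - \int[leb3]_y (G y i j * phi y).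

Definition H1loc (v : R3 R -> 'rV[R]_3) : Prop :=
  (forall i, L2loc (fun y => v y 0 i)) /\ exists G, is_weak_grad v G.

(* A choice among the a.e. equal weak gradients (0 when there is none). *)
Definition weak_grad (v : R3 R -> 'rV[R]_3) : R3 R -> 'M[R]_3 :=
  xget (fun=> 0) [set G | is_weak_grad v G].

Definition strain (v : R3 R -> 'rV[R]_3) : R3 R -> 'M[R]_3 :=
  fun y => 2^-1 *: (weak_grad v y + (weak_grad v y)^T).

Definition H1per (g : 'I_3 -> R3 R) (v : R3 R -> 'rV[R]_3) : Prop :=
  H1loc v /\ periodic g v.

Definition H1per0 (g : 'I_3 -> R3 R) (v : R3 R -> 'rV[R]_3) : Prop :=
  H1per g v /\ forall i, \int[leb3]_(y in cell g) v y 0 i = 0.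

Definition L2pers (g : 'I_3 -> R3 R) (mu : R3 R -> 'M[R]_3) : Prop :=
  [/\ forall i j, L2loc (fun y => mu y i j),
      {ae leb3, forall y, sym_mx (mu y)} &
      periodic g mu].

(* The pairing of the i-th component of the distribution div mu with phi. *)
Definition distr_div (mu : R3 R -> 'M[R]_3) (i : 'I_3) (phi : R3 R -> R) : R :=
  - \sum_j \int[leb3]_y (mu y i j * partial j phi y).

Definition Tspace (g : 'I_3 -> R3 R) (mu : R3 R -> 'M[R]_3) : Prop :=
  L2pers g mu /\ forall i phi, test_fun phi -> distr_div mu i phi = 0.

Definition Tperp (g : 'I_3 -> R3 R) (e : R3 R -> 'M[R]_3) : Prop :=
  L2pers g e /\ forall mu, Tspace g mu ->
    \int[leb3]_(y in cell g) frob (e y) (mu y) = 0.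

Definition tensor4 : Type := 'I_3 -> 'I_3 -> 'I_3 -> 'I_3 -> R.

Definition tapp (c : tensor4) (xi : 'M[R]_3) : 'M[R]_3 :=
  \matrix_(i, j) \sum_k \sum_l c i j k l * xi k l.

(* [c] need not have the index symmetries: only its action on symmetric
   matrices matters. *)
Definition self_adjoint_sym (c : tensor4) : Prop :=
  (forall xi, sym_mx xi -> sym_mx (tapp c xi)) /\
  forall xi eta, sym_mx xi -> sym_mx eta ->
    frob (tapp c xi) eta = frob xi (tapp c eta).

Definition rigidity_tensor (g : 'I_3 -> R3 R) (C : R3 R -> tensor4) : Prop :=
  [/\ periodic g C,
      forall i j k l, measurable_fun [set: mR3 R] (fun y => C y i j k l),
      exists M : R, {ae leb3, forall y, forall i j k l, `|C y i j k l| <= M},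
      {ae leb3, forall y, self_adjoint_sym (C y)} &
      exists2 alpha : R, 0 < alpha & {ae leb3, forall y, forall xi,
        sym_mx xi -> alpha * frob xi xi <= frob (tapp (C y) xi) xi}].

Definition solves_strain (g : 'I_3 -> R3 R) (C : R3 R -> tensor4)
    (A : 'M[R]_3) (e : R3 R -> 'M[R]_3) : Prop :=
  Tperp g e /\ forall mu, Tperp g mu ->
    (cell_volume g)^-1 *
      \int[leb3]_(y in cell g) frob (tapp (C y) (e y)) (mu y) =
    - frob A ((cell_volume g)^-1 *:
        mx_integral (cell g) (fun y => tapp (C y) (mu y))).

Definition solves_displacement (g : 'I_3 -> R3 R) (C : R3 R -> tensor4)
    (A : 'M[R]_3) (phi : R3 R -> 'rV[R]_3) : Prop :=
  H1per0 g phi /\ forall v, H1per0 g v ->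
    \int[leb3]_(y in cell g) frob (tapp (C y) (strain phi y)) (strain v y) =
    - frob A (mx_integral (cell g) (fun y => tapp (C y) (strain v y))).

End Defs.

(* Main.v *)
From Pilot Require Import Defs.
From HB Require Import structures.
From mathcomp Require Import all_boot all_order all_algebra.
From mathcomp Require Import all_classical all_reals all_analysis.
From mathcomp Require Import measurable_realfun.
From mathcomp Require Import ring lra zify.

Set Implicit Arguments.
Unset Strict Implicit.
Unset Printing Implicit Defensive.

Import Order.TTheory GRing.Theory Num.Theory.
Import numFieldNormedType.Exports.

Local Open Scope classical_set_scope.
Local Open Scope ring_scope.

(* Periodic fields are expanded in the real orthonormal basis of L^2(Y) made of
   the normalised functions [bas k = cos + sin] of the phases [2 pi k . sg y], which
   differentiation permutes: [d_j (bas k) = freq k j * bas (- k)].  The fields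
   [bas k *: M], with [M] symmetric and [M *m freq k = 0], are divergence free;
   orthogonality to them forces the coefficient [E_k] of an element of T^perp to
   be a symmetric product of [freq k] with some vector [a_k], and
   [|freq k| |a_k|] is bounded by [|E_k|], so that [- a_k] are the coefficients of
   a displacement in H^1 with the given strain.  Conversely strains are orthogonal
   to T by Parseval's identity.  Hence T^perp is exactly the set of strains of
   H^1_#0, on which the strain is injective, and the two formulations differ by
   the factor |Y| only. *)

(** * Square-integrable functions *)

(** Distributional conditions are tested on all of R^3 by compactly supported functions, whereas
    Fourier modes are periodic. The bridge is a smooth [chi] whose lattice translates sum to 1:
    testing with [chi * bas k] and folding space onto a half-open cell turns a distributional
    identity into a relation between Fourier coefficients, without boundary terms. Completeness of
    the basis comes from approximating indicators of half-spaces in lattice coordinates by bounded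
    trigonometric polynomials, followed by a Dynkin argument. The bound on [a_k] is Korn's
    inequality read mode by mode, combined with a positive lower bound on nonzero frequencies. At
    [k = 0] every symmetric matrix meets the divergence condition, so the elements of T^perp have
    mean zero, and the mean of the displacement is fixed by giving it a zero coefficient there.
    Since [weak_grad] is a choice among a.e. equal fields and periodicity holds only a.e., the du
    Bois-Reymond lemma is what makes the chosen gradient essentially unique and periodic. *)

Section square_integrable.
Context d (T : measurableType d) (R : realType) (mu : {measure set T -> \bar R}).
Context (D : set T) (mD : measurable D).
Implicit Types f h : T -> R.

(** Measurability is global and only the integral is local, so that one function can be followed
    through changes of [D] and translations. *)
Definition Lsq f : Prop :=
  measurable_fun [set: T] f /\ mu.-integrable D (EFin \o (fun x => f x ^+ 2)).

Definition dotp f h : R := \int[mu]_(x in D) (f x * h x).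

Lemma integrable_le f h : measurable_fun D f ->
  (forall x, D x -> `|f x| <= h x) -> mu.-integrable D (EFin \o h) ->
  mu.-integrable D (EFin \o f).
Proof.
move=> mf fh; apply: le_integrable => //; first exact/measurable_EFinP.
move=> x Dx; rewrite /= lee_fin; apply: (le_trans (fh x Dx)).
exact: ler_norm.
Qed.

Lemma integrable_sum_fun (I : Type) (s : seq I) (F : I -> T -> R) :
  (forall i, mu.-integrable D (EFin \o F i)) ->
  mu.-integrable D (EFin \o (fun x => \sum_(i <- s) F i x)).
Proof.
move=> iF; have := @integrable_sum _ _ _ mu D mD _ s predT _ (fun i _ => iF i).
by apply: eq_integrable => // x _ /=; rewrite sumEFin.
Qed.

Lemma Rintegral_sum (I : Type) (s : seq I) (F : I -> T -> R) :
  (forall i, mu.-integrable D (EFin \o F i)) ->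
  \int[mu]_(x in D) (\sum_(i <- s) F i x) = \sum_(i <- s) \int[mu]_(x in D) F i x.
Proof.
move=> iF; elim: s => [|i s IH].
  under eq_Rintegral do rewrite big_nil.
  by rewrite big_nil Rintegral_cst// mul0r.
under eq_Rintegral do rewrite big_cons.
by rewrite big_cons RintegralD// ?IH//; exact: integrable_sum_fun.
Qed.

Lemma integrableD_fun f h : mu.-integrable D (EFin \o f) ->
  mu.-integrable D (EFin \o h) -> mu.-integrable D (EFin \o (f \+ h)).
Proof. by move=> i1 i2; have := integrableD mD i1 i2. Qed.

Lemma integrableZ_fun c f : mu.-integrable D (EFin \o f) ->
  mu.-integrable D (EFin \o (fun x => c * f x)).
Proof. by move=> i1; have := integrableZl mD c i1. Qed.

Lemma L2_mul f h : Lsq f -> Lsq h -> mu.-integrable D (EFin \o (f \* h)).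
Proof.
move=> [mf f2] [mh h2].
apply: (@integrable_le _ (fun x => f x ^+ 2 + h x ^+ 2)).
- by apply: measurable_funTS; exact: measurable_funM.
- move=> x _ /=; rewrite ler_norml; have := sqr_ge0 (f x + h x).
  by have := sqr_ge0 (f x - h x); nra.
- exact: (integrableD_fun f2 h2).
Qed.

Lemma L2D f h : Lsq f -> Lsq h -> Lsq (f \+ h).
Proof.
move=> [mf f2] [mh h2]; split; first exact: measurable_funD.
apply: (@integrable_le _ (fun x => 2 * (f x ^+ 2 + h x ^+ 2))).
- by apply/measurable_funTS/measurable_funX/measurable_funD.
- move=> x _ /=; rewrite ger0_norm ?sqr_ge0//.
  by have := sqr_ge0 (f x - h x); nra.
- exact/integrableZ_fun/(integrableD_fun f2 h2).
Qed.

Lemma L2Z c f : Lsq f -> Lsq (fun x => c * f x).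
Proof.
move=> [mf f2]; split; first exact: measurable_funM.
by have := integrableZ_fun (c ^+ 2) f2; apply: eq_integrable => // x _ /=; rewrite exprMn.
Qed.

Lemma L2_cst0 : Lsq (fun=> 0).
Proof.
split=> //; have := integrable0 mu D.
by apply: eq_integrable => // x _ /=; rewrite expr0n.
Qed.

Lemma L2_sum (I : Type) (s : seq I) (F : I -> T -> R) :
  (forall i, Lsq (F i)) -> Lsq (fun x => \sum_(i <- s) F i x).
Proof.
move=> LF; elim: s => [|i s IH].
  by under eq_fun do rewrite big_nil; exact: L2_cst0.
by under eq_fun do rewrite big_cons; exact: L2D.
Qed.

Lemma L2B f h : Lsq f -> Lsq h -> Lsq (fun x => f x - h x).
Proof.
move=> Lf Lh; have := L2D Lf (L2Z (-1) Lh).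
by congr Lsq; apply/funext => x /=; rewrite mulN1r.
Qed.

Lemma L2_bounded f M : (mu D < +oo)%E -> measurable_fun [set: T] f ->
  (forall x, `|f x| <= M) -> Lsq f.
Proof.
move=> Doo mf fM; split=> //; apply: measurable_bounded_integrable => //.
  exact/measurable_funTS/measurable_funX.
exists (M ^+ 2); split; first by rewrite num_real.
move=> y My x _ /=; apply: le_trans (ltW My).
by rewrite normrX lerXn2r// nnegrE// (le_trans _ (fM x)).
Qed.

Lemma ipC f h : dotp f h = dotp h f.
Proof. by apply: eq_Rintegral => x _; rewrite mulrC. Qed.

Lemma ipDl f1 f2 h : Lsq f1 -> Lsq f2 -> Lsq h ->
  dotp (fun x => f1 x + f2 x) h = dotp f1 h + dotp f2 h.
Proof.
move=> L1 L2h Lh; rewrite /dotp; under eq_Rintegral do rewrite mulrDl.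
by rewrite RintegralD//; exact: L2_mul.
Qed.

Lemma ipZl c f h : Lsq f -> Lsq h -> dotp (fun x => c * f x) h = c * dotp f h.
Proof.
move=> Lf Lh; rewrite /dotp; under eq_Rintegral do rewrite -mulrA.
by rewrite RintegralZl//; exact: L2_mul.
Qed.

Lemma ipBl f1 f2 h : Lsq f1 -> Lsq f2 -> Lsq h ->
  dotp (fun x => f1 x - f2 x) h = dotp f1 h - dotp f2 h.
Proof.
move=> L1 L2h Lh; rewrite /dotp; under eq_Rintegral do rewrite mulrBl.
by rewrite RintegralB//; exact: L2_mul.
Qed.

Lemma ip_suml (I : Type) (s : seq I) (F : I -> T -> R) h :
  (forall i, Lsq (F i)) -> Lsq h ->
  dotp (fun x => \sum_(i <- s) F i x) h = \sum_(i <- s) dotp (F i) h.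
Proof.
move=> LF Lh; rewrite /dotp; under eq_Rintegral do rewrite mulr_suml.
by rewrite Rintegral_sum// => i; exact: L2_mul.
Qed.

Lemma ip_ge0 f : 0 <= dotp f f.
Proof. by apply: Rintegral_ge0 => x _; rewrite -expr2 sqr_ge0. Qed.

Lemma ip_CS f h : Lsq f -> Lsq h -> dotp f h ^+ 2 <= dotp f f * dotp h h.
Proof.
move=> Lf Lh.
have key t : 0 <= dotp f f - t * dotp f h *+ 2 + t ^+ 2 * dotp h h.
  have := ip_ge0 (fun x => f x - t * h x).
  have Lt := L2Z t Lh.
  rewrite (ipBl Lf Lt (L2B Lf Lt)) (ipZl t Lh (L2B Lf Lt)).
  rewrite (ipC f (fun x => _)) (ipC h (fun x => _)).
  rewrite !(ipBl Lf Lt)// !(ipZl t Lh)// (ipC h f).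
  by congr (_ <= _); ring.
have [hh0|hh0] := eqVneq (dotp h h) 0; last first.
  have := key (dotp f h / dotp h h); set a := dotp f h; set b := dotp h h.
  have bp : 0 < b by rewrite lt0r hh0 ip_ge0.
  rewrite -(pmulr_rge0 _ bp) => h0; rewrite -subr_ge0; apply: le_trans h0 _.
  by rewrite le_eqVlt; apply/orP; left; apply/eqP; field; rewrite -/b.
rewrite hh0 mulr0; have [-> //|fh0] := eqVneq (dotp f h) 0; first by rewrite expr0n.
(* With [dotp h h = 0] the quadratic in [t] is affine; this [t] gives it the value [- dotp f f - 2],
   which is negative. *)
have := key ((dotp f f + 1) / dotp f h); rewrite hh0 mulr0 addr0 divfK//.
by have := ip_ge0 f; lra.
Qed.

Definition L2cvg (F : nat -> T -> R) f : Prop :=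
  (fun n => dotp (fun x => F n x - f x) (fun x => F n x - f x)) @ \oo --> (0 : R).

Lemma L2cvg_ip F f h : (forall n, Lsq (F n)) -> Lsq f -> Lsq h -> L2cvg F f ->
  (fun n => dotp (F n) h) @ \oo --> dotp f h.
Proof.
move=> LF Lf Lh Ff; apply/cvgrPdist_lt => e e0.
have hp : 0 < dotp h h + 1 by rewrite ltr_wpDl// ip_ge0.
have e1 : 0 < e ^+ 2 / (dotp h h + 1) by rewrite divr_gt0 ?exprn_gt0.
move/cvgrPdist_lt : Ff => /(_ _ e1); apply: filterS => n.
rewrite sub0r normrN ger0_norm ?ip_ge0// ltr_pdivlMr// => ze.
rewrite distrC -(ipBl (LF n) Lf Lh).
rewrite -(@ltr_pXn2r _ 2)// ?nnegrE// ?(ltW e0)// real_normK ?num_real//.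
apply: le_lt_trans (ip_CS _ Lh) _; first exact: L2B.
by apply: le_lt_trans ze; rewrite ler_wpM2l ?ip_ge0// lerDl.
Qed.

End square_integrable.

(** * Almost everywhere convergence of fast Cauchy sequences in L^2 *)

Section riesz_fischer.
Context d (T : measurableType d) (R : realType) (mu : {measure set T -> \bar R}).
Context (D : set T) (mD : measurable D) (Doo : (mu D < +oo)%E).
Implicit Types f : T -> R.
Local Notation L2 := (Lsq mu D).
Local Notation ip := (dotp mu D).

Lemma ip_EFin f : L2 f ->
  (ip f f)%:E = (\int[mu]_(x in D) (f x ^+ 2)%:E)%E.
Proof.
move=> [_ f2]; rewrite /dotp /Rintegral.
under eq_integral do rewrite -expr2.
by rewrite fineK//; exact: integrable_fin_num.
Qed.

(** Fatou's lemma: the squared norm is lower semicontinuous along a.e. convergence, which both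
    places the limit in L^2 and bounds it. *)
Lemma L2_fatou (v : nat -> T -> R) (w : T -> R) (b : nat -> R) (B : R) :
  (forall j, L2 (v j)) -> measurable_fun [set: T] w ->
  {ae mu, forall x, D x -> v ^~ x @ \oo --> w x} ->
  (forall j, ip (v j) (v j) <= b j) -> b @ \oo --> B ->
  L2 w /\ ip w w <= B.
Proof.
move=> Lv mw vw vb bB.
have mv2 j : measurable_fun D (fun x => (v j x ^+ 2)%:E).
  by apply/measurable_EFinP/measurable_funTS/measurable_funX; case: (Lv j).
have mw2 : measurable_fun D (fun x => (w x ^+ 2)%:E).
  exact/measurable_EFinP/measurable_funTS/measurable_funX.
have wB : (\int[mu]_(x in D) (w x ^+ 2)%:E <= B%:E)%E.
  apply: (@le_trans _ _
      (\int[mu]_(x in D) limn_einf (fun j => (v j x ^+ 2)%:E))%E).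
  - apply: ae_ge0_le_integral => //.
    + by move=> x _; rewrite lee_fin sqr_ge0.
    + move=> x _; rewrite limn_einf_lim; apply: lime_ge.
        exact: is_cvg_einfs.
      apply: nearW => n; apply/ereal_infP => _ [k _ <-].
      by rewrite lee_fin sqr_ge0.
    + apply: measurableT_comp => //; apply: measurable_fun_limn_esup => n.
      exact: measurableT_comp.
    + apply: filterS vw => x vx Dx.
      rewrite (cvg_limn_einf_sup (l := (w x ^+ 2)%:E))//.
      by apply: cvg_EFin; [exact: nearW|exact: cvgM (vx Dx) (vx Dx)].
  - apply: le_trans (fatou _ _ _ _) _ => //.
      by move=> n x _; rewrite lee_fin sqr_ge0.
    rewrite limn_einf_lim.
    have -> : B%:E = limn (EFin \o b).
      by apply/esym/cvg_lim => //; apply: cvg_EFin; first exact: nearW.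
    apply: lee_lim; first exact: is_cvg_einfs.
      by apply/cvg_ex; exists B%:E; apply: cvg_EFin; first exact: nearW.
    apply: nearW => n; apply: (@le_trans _ _ (ip (v n) (v n))%:E).
      by rewrite ip_EFin//; apply: ereal_inf_lbound; exists n => /=.
    by rewrite lee_fin.
have Lw : L2 w.
  split=> //; apply/integrableP; split=> //; apply: le_lt_trans (ltry B).
  apply: le_trans wB; rewrite le_eqVlt; apply/orP; left; apply/eqP.
  by apply: eq_integral => x _ /=; rewrite ger0_norm ?sqr_ge0.
by split=> //; rewrite -lee_fin ip_EFin.
Qed.

(** An everywhere defined, measurable candidate for the limit. Its value at [x] depends only on the
    values [u j x], so symmetries common to all [u j] pass to it pointwise, not merely a.e. *)
Definition fine_limsup (u : nat -> T -> R) : T -> R :=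
  fun x => fine (limn_esup (fun j => (u j x)%:E)).

Lemma measurable_fine_limsup u : (forall j, measurable_fun [set: T] (u j)) ->
  measurable_fun [set: T] (fine_limsup u).
Proof.
move=> mu_; apply: (measurableT_comp (fine_measurable measurableT)).
by apply: measurable_fun_limn_esup => j; exact/measurable_EFinP.
Qed.

Lemma cvg_fine_limsup u x l : u ^~ x @ \oo --> l -> fine_limsup u x = l.
Proof.
move=> ul; rewrite /fine_limsup (cvg_limn_einf_sup (l := l%:E))//.
by apply: cvg_EFin; first exact: nearW.
Qed.

(** On a set of finite measure, geometric decay of the squared norms makes the sum of the absolute
    increments integrable, hence finite a.e.; the telescoping series then converges absolutely. *)
Lemma L2_fast_cvg (u : nat -> T -> R) (B : R) : (forall j, L2 (u j)) ->
  (forall j, ip (fun x => u j.+1 x - u j x) (fun x => u j.+1 x - u j x)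
     <= B / 4 ^+ j) ->
  {ae mu, forall x, D x -> u ^~ x @ \oo --> fine_limsup u x}.
Proof.
move=> Lu uB; pose z j x := u j.+1 x - u j x.
have Lz j : L2 (z j) by exact: L2B.
have mz j : measurable_fun [set: T] (z j) by case: (Lz j).
have mzE j : measurable_fun D (fun x => `|z j x|%:E).
  exact/measurable_EFinP/measurable_funTS/measurableT_comp.
(* From [|z| <= 2^-j + 2^j z^2], whose weights balance the decay [4^-j]: the integral of [|z|] is at
   most [(mu D + B) / 2^j]. *)
pose K := B + fine (mu D).
have z1 j : (\int[mu]_(x in D) `|z j x|%:E <= (K / 2 ^+ j)%:E)%E.
  have Dfin : mu D \is a fin_num by rewrite ge0_fin_numE.
  have i1 : mu.-integrable D (EFin \o (fun=> (2^-1) ^+ j : R)).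
    apply: measurable_bounded_integrable => //.
    by exists ((2^-1) ^+ j); split=> [|y /ltW ? ? _]; rewrite ?num_real//= ger0_norm// exprn_ge0.
  have i2 : mu.-integrable D (EFin \o (fun x => 2 ^+ j * (z j x ^+ 2))).
    by apply: integrableZ_fun => //; case: (Lz j).
  have i3 : mu.-integrable D (EFin \o (fun x => `|z j x|)).
    apply: (integrable_le mD _ _ (integrableD_fun mD i1 i2)).
      exact/measurable_funTS/measurableT_comp.
    move=> x _ /=; rewrite normr_id.
    have p0 : 0 < (2 : R) ^+ j by rewrite exprn_gt0.
    rewrite exprVn -(ler_pM2l p0) mulrDr divff ?gt_eqF//.
    rewrite -(real_normK (num_real (z j x))).
    have := sqr_ge0 (2 ^+ j * `|z j x| - 1); nra.
  have -> : (\int[mu]_(x in D) `|z j x|%:E)%E = (\int[mu]_(x in D) `|z j x|)%:E.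
    by rewrite /Rintegral fineK//; exact: integrable_fin_num.
  rewrite lee_fin.
  apply: (@le_trans _ _ (\int[mu]_(x in D) ((2^-1) ^+ j + 2 ^+ j * (z j x ^+ 2)))).
    apply: le_Rintegral => //; first exact: (integrableD_fun mD i1 i2).
    move=> x _ /=.
    have p0 : 0 < (2 : R) ^+ j by rewrite exprn_gt0.
    rewrite exprVn -(ler_pM2l p0) mulrDr divff ?gt_eqF//.
    rewrite -(real_normK (num_real (z j x))).
    have := sqr_ge0 (2 ^+ j * `|z j x| - 1); nra.
  rewrite RintegralD// Rintegral_cst//.
  rewrite RintegralZl//; last by case: (Lz j).
  have -> : \int[mu]_(x in D) (z j x ^+ 2) = ip (z j) (z j).
    by apply: eq_Rintegral => x _; rewrite expr2.
  have -> : K / 2 ^+ j = 2^-1 ^+ j * fine (mu D) + 2 ^+ j * (B / 4 ^+ j).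
    have -> : (4 : R) = 2 * 2 by rewrite -natrM.
    rewrite exprMn /K exprVn; field.
    by rewrite expf_neq0.
  by rewrite lerD2l ler_wpM2l ?exprn_ge0//; exact: uB.
have K0 : 0 <= K.
  rewrite addr_ge0 ?fine_ge0//; have := le_trans (ip_ge0 _ _ _) (uB 0%N).
  by rewrite expr0 divr1.
pose g x := (\sum_(0 <= j <oo) `|z j x|%:E)%E.
have g0 x : (0 <= g x)%E by apply: nneseries_ge0 => *; rewrite lee_fin.
have gint : mu.-integrable D g.
  apply/integrableP; split.
    by apply: ge0_emeasurable_sum => // k x _ _; rewrite lee_fin.
  apply: (@le_lt_trans _ _ (2 * K)%:E); last exact: ltry.
  under eq_integral => x _ do rewrite gee0_abs//.
  rewrite integral_nneseries//.
  apply: (@le_trans _ _ (\sum_(0 <= j <oo) (2 * K / (2 ^ (j + 0.+1))%:R)%:E)%E).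
    apply: lee_nneseries => [i _ _|n _].
      by apply: integral_ge0 => x _; rewrite lee_fin.
    apply: le_trans (z1 n) _; rewrite lee_fin le_eqVlt; apply/orP; left.
    rewrite addn1 natrX exprS; apply/eqP; field.
    by rewrite expf_neq0.
  have := @cvg_geometric_eseries_half R (2 * K) 0; rewrite expr0 divr1.
  by move/cvg_lim => <-.
have := integrable_ae mD gint; apply: filterS => x gx Dx.
have {Dx}gx := gx Dx.
have zc : cvgn (series (fun j => z j x)).
  apply: normed_cvg; apply: nondecreasing_is_cvgn.
    by apply: nondecreasing_series => n _ _ /=.
  exists (fine (g x)) => _ [n _ <-].
  rewrite -lee_fin fineK// /series /= -sumEFin.
  by apply: nneseries_lim_ge => m _ _; rewrite lee_fin.
have uc : cvgn (u ^~ x).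
  have -> : u ^~ x = (fun n => series (fun j => z j x) n + u 0%N x).
    by apply/funext => n; rewrite /series /= telescope_sumr// subrK.
  exact: is_cvgD (is_cvg_cst _).
by rewrite (cvg_fine_limsup uc).
Qed.

End riesz_fischer.

(** * Orthogonal series, Bessel's inequality and Parseval's identity *)

Section orthogonal_series.
Context d (T : measurableType d) (R : realType) (mu : {measure set T -> \bar R}).
Context (D : set T) (mD : measurable D) (Doo : (mu D < +oo)%E).
Local Notation L2 := (Lsq mu D).
Local Notation ip := (dotp mu D).
Context (e : nat -> T -> R) (Le : forall n, L2 (e n)).
Context (e_orth : forall n m, n != m -> ip (e n) (e m) = 0).
Context (e_norm : forall n, ip (e n) (e n) = 1 \/ forall x, e n x = 0).

Definition psum (c : nat -> R) n : T -> R :=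
  fun x => \sum_(0 <= i < n) c i * e i x.

Lemma L2_psum c n : L2 (psum c n).
Proof. by apply: L2_sum => // i; exact: L2Z. Qed.

Lemma e_norm01 n : 0 <= ip (e n) (e n) <= 1.
Proof.
case: (e_norm n) => [->|e0]; first by rewrite ler01 lexx.
rewrite ip_ge0 /= (_ : ip _ _ = 0) ?ler01// /dotp.
by under eq_Rintegral do rewrite e0 mulr0; rewrite Rintegral_cst// mul0r.
Qed.

Lemma ip_e_norm f n : ip f (e n) * ip (e n) (e n) = ip f (e n).
Proof.
case: (e_norm n) => [->|e0]; first by rewrite mulr1.
rewrite (_ : ip f (e n) = 0) ?mul0r// /dotp.
by under eq_Rintegral do rewrite e0 mulr0; rewrite Rintegral_cst// mul0r.
Qed.

Lemma ip_psum_e c s m : uniq s ->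
  ip (fun x => \sum_(i <- s) c i * e i x) (e m) =
  if m \in s then c m * ip (e m) (e m) else 0.
Proof.
move=> us; rewrite ip_suml//; last by move=> i; exact: L2Z.
under eq_bigr do rewrite ipZl//.
case: ifPn => ms.
  rewrite (bigD1_seq m)//= big1 ?addr0// => i im.
  by rewrite e_orth ?mulr0.
rewrite big_seq big1// => i is_; rewrite e_orth ?mulr0//.
by apply: contra ms => /eqP <-.
Qed.

Lemma ip_psum_psum c s : uniq s ->
  ip (fun x => \sum_(i <- s) c i * e i x) (fun x => \sum_(i <- s) c i * e i x)
  = \sum_(i <- s) c i ^+ 2 * ip (e i) (e i).
Proof.
move=> us; have Ls : L2 (fun x => \sum_(i <- s) c i * e i x).
  by apply: L2_sum => // i; exact: L2Z.
rewrite {1}ip_suml//; last by move=> i; exact: L2Z.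
rewrite [LHS]big_seq [RHS]big_seq; apply: eq_bigr => i is_.
by rewrite ipZl// ipC ip_psum_e// is_ expr2 mulrA.
Qed.

Lemma ip_psum c n h : L2 h ->
  ip (psum c n) h = \sum_(0 <= i < n) c i * ip (e i) h.
Proof.
move=> Lh; rewrite /psum ip_suml//; last by move=> i; exact: L2Z.
by apply: eq_bigr => i _; rewrite ipZl.
Qed.

Lemma psumB c m n x : (m <= n)%N ->
  psum c n x - psum c m x = \sum_(m <= i < n) c i * e i x.
Proof.
by move=> mn; rewrite /psum (big_cat_nat (leq0n m) mn)//= addrAC subrr add0r.
Qed.

(** Tails of the coefficient series control the distances between partial sums. A subsequence with
    fast decaying tails converges a.e., and Fatou's lemma brings the estimate back to the whole
    sequence. The last clause later yields exact, rather than a.e., lattice periodicity of the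
    sum. *)
Lemma riesz_fischer (c : nat -> R) (B : R) :
  (forall n, \sum_(0 <= i < n) c i ^+ 2 <= B) ->
  exists f, [/\ L2 f, L2cvg mu D (psum c) f,
    forall n, ip f (e n) = c n * ip (e n) (e n) &
    forall x y, (forall n, e n x = e n y) -> f x = f y].
Proof.
move=> cB; pose q n := \sum_(0 <= i < n) c i ^+ 2.
have ndq : {homo q : n m / (n <= m)%N >-> n <= m}.
  by apply: nondecreasing_series => n _ _; exact: sqr_ge0.
have qc : cvgn q.
  by apply: nondecreasing_is_cvgn => //; exists B => _ [n _ <-]; exact: cB.
pose Q := limn q; pose t n := Q - q n.
have qQ n : q n <= Q by exact: nondecreasing_cvgn_le.
have t0 n : 0 <= t n by rewrite subr_ge0.
have tc : t @ \oo --> (0 : R).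
  by rewrite -(subrr Q); apply: cvgB => //; exact: cvg_cst.
have dist_le m n : (m <= n)%N ->
    ip (fun x => psum c n x - psum c m x) (fun x => psum c n x - psum c m x)
    <= t m.
  move=> mn; under eq_fun do rewrite psumB//.
  rewrite ip_psum_psum ?iota_uniq//.
  apply: (@le_trans _ _ (q n - q m)); last by rewrite lerD2r.
  rewrite /q (big_cat_nat (leq0n m) mn)//= addrAC subrr add0r.
  apply: ler_sum => i _; rewrite ler_piMr ?sqr_ge0//.
  by case/andP: (e_norm01 i).
have dist_lem m n :
    ip (fun x => psum c n x - psum c m x) (fun x => psum c n x - psum c m x)
    <= t m + t n.
  case: (leqP m n) => mn; first by rewrite ler_wpDr// dist_le.
  rewrite (_ : ip _ _ = ip (fun x => psum c m x - psum c n x)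
                           (fun x => psum c m x - psum c n x)).
    by rewrite ler_wpDl// dist_le// ltnW.
  by apply: eq_Rintegral => x _; rewrite -[in RHS]opprB mulrNN.
have /choice[N NP] j : exists k, t k <= 1 / 4 ^+ j.
  have p : (0 : R) < 1 / 4 ^+ j by rewrite divr_gt0// exprn_gt0.
  move/cvgrPdist_lt : tc => /(_ _ p) [k _ /(_ k (leqnn k))].
  by rewrite sub0r normrN ger0_norm// => /ltW; exists k.
pose u j := psum c (N j).
have Lu j : L2 (u j) by exact: L2_psum.
(* The constant 2 adds the tails at [N j] and [N j.+1], each at most [4^-j]. *)
have ae_u := @L2_fast_cvg _ _ _ mu D mD Doo u 2 Lu.
have {}ae_u : {ae mu, forall x, D x -> u ^~ x @ \oo --> fine_limsup u x}.
  apply: ae_u => j; apply: le_trans (dist_lem _ _) _.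
  apply: (@le_trans _ _ (1 / 4 ^+ j + 1 / 4 ^+ j)); last by lra.
  rewrite lerD// (le_trans (NP j.+1))// !div1r lef_pV2 ?posrE ?exprn_gt0//.
  by rewrite exprS ler_peMl ?exprn_ge0//; lra.
pose f := fine_limsup u.
have mf : measurable_fun [set: T] f.
  by apply: measurable_fine_limsup => j; case: (Lu j).
have main m : L2 (fun x => f x - psum c m x) /\
    ip (fun x => f x - psum c m x) (fun x => f x - psum c m x) <= t m.
  apply: (@L2_fatou _ _ _ mu D mD (fun j x => u j x - psum c m x) _
           (fun j => t m + 1 / 4 ^+ j)).
  - by move=> j; apply: L2B => //; exact: L2_psum.
  - by apply: measurable_funB => //; case: (L2_psum c m).
  - apply: filterS ae_u => x ux Dx; apply: cvgB; first exact: ux.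
    exact: cvg_cst.
  - by move=> j; apply: le_trans (dist_lem _ _) _; rewrite lerD2l.
  - rewrite -[X in _ --> X]addr0; apply: cvgD; first exact: cvg_cst.
    under eq_fun do rewrite div1r -exprVn.
    by apply: cvg_expr; rewrite ger0_norm ?invr_ge0// invf_lt1//; lra.
have Lf : L2 f.
  have [L0 _] := main 0%N; congr (L2 _) : L0; apply/funext => x.
  by rewrite /psum big_geq// subr0.
have fc : L2cvg mu D (psum c) f.
  rewrite /L2cvg; apply: (@squeeze_cvgr _ _ _ _ (cst 0) t) => //; last exact: cvg_cst.
  apply: nearW => n; rewrite ip_ge0 /=; have [_] := main n.
  congr (_ <= _); apply: eq_Rintegral => x _.
  by rewrite -[in RHS]opprB mulrNN.
exists f; split => //.
- move=> n; have Le_c := L2cvg_ip mD (L2_psum c) Lf (Le n) fc.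
  apply: (cvg_unique _ Le_c) => //; apply: cvg_near_cst.
  exists n.+1 => // m /= nm; rewrite ip_psum_e ?iota_uniq//.
  by rewrite mem_index_iota nm.
- move=> x y exy; rewrite /f /fine_limsup; congr (fine (limn_esup _)).
  apply/funext => j; congr (_%:E); rewrite /u /psum.
  by apply: eq_bigr => i _; rewrite exy.
Qed.

Lemma bessel f n : L2 f ->
  \sum_(0 <= i < n) ip f (e i) ^+ 2 <= ip f f.
Proof.
move=> Lf; pose p := psum (fun i => ip f (e i)) n.
have Lp : L2 p by exact: L2_psum.
have pp : ip p p = \sum_(0 <= i < n) ip f (e i) ^+ 2.
  rewrite ip_psum_psum ?iota_uniq//; apply: eq_bigr => i _.
  by rewrite expr2 -mulrA ip_e_norm.
have pf : ip p f = ip p p.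
  rewrite pp ip_suml//; last by move=> i; exact: L2Z.
  by apply: eq_bigr => i _; rewrite ipZl// (ipC _ _ (e i)) expr2.
have Lfp := L2B mD Lf Lp.
have := ip_ge0 mu D (fun x => f x - p x); rewrite ipBl//.
rewrite (ipC _ _ f) (ipC _ _ p) !ipBl// (ipC _ _ f p) pf -pp.
by move=> ?; lra.
Qed.

(** The Riesz-Fischer sum of the coefficients of [f] has the same coefficients as [f], so
    completeness identifies the two a.e. *)
Lemma parseval f :
  (forall h, L2 h -> (forall n, ip h (e n) = 0) -> ae_eq mu D h (cst 0)) ->
  L2 f -> L2cvg mu D (psum (fun n => ip f (e n))) f.
Proof.
move=> complete Lf; have [f' [Lf' cf' cof _]] := riesz_fischer (fun n => bessel n Lf).
have ff' : ae_eq mu D (fun x => f x - f' x) (cst 0).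
  apply: complete; first exact: L2B.
  by move=> n; rewrite ipBl// cof ip_e_norm subrr.
rewrite /L2cvg (_ : (fun n => _) = fun n => ip
    (fun x => psum (fun i => ip f (e i)) n x - f' x)
    (fun x => psum (fun i => ip f (e i)) n x - f' x))//.
apply/funext => n.
have Lp := L2_psum (fun n => ip f (e n)) n.
rewrite /dotp /Rintegral; congr fine; apply: ae_eq_integral => //.
- have [m1 _] := L2B mD Lp Lf.
  by apply/measurable_EFinP/measurable_funTS/measurable_funM; exact: m1.
- have [m1 _] := L2B mD Lp Lf'.
  by apply/measurable_EFinP/measurable_funTS/measurable_funM; exact: m1.
- apply: filterS ff' => x /[apply] /= /eqP.
  by rewrite subr_eq0 => /eqP ->.
Qed.

End orthogonal_series.

(** * Functions with vanishing integrals over generating sets *)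

Section vanishing_integrals.
Context d (T : measurableType d) (R : realType) (mu : {measure set T -> \bar R}).
Implicit Types (D : set T) (f : T -> \bar R).

(** The sets whose preimage carries zero integral form a Dynkin system, so vanishing on a pi-system
    of generators extends to the whole sigma-algebra. *)
Lemma integral0_preimage D f d' (T' : measurableType d') (s : T -> T')
    (G : set (set T')) :
  measurable D -> mu.-integrable D f -> measurable_fun [set: T] s ->
  d'.-measurable = <<s G>> -> setI_closed G ->
  (\int[mu]_(x in D) f x = 0)%E ->
  (forall A, G A -> (\int[mu]_(x in D `&` s @^-1` A) f x = 0)%E) ->
  forall A, measurable A -> (\int[mu]_(x in D `&` s @^-1` A) f x = 0)%E.
Proof.
move=> mD fi ms mG IG D0 G0 A mA.
have mpre B : measurable B -> measurable (D `&` s @^-1` B).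
  by move=> mB; apply: measurableI => //; rewrite -[_ @^-1` _]setTI; exact: ms.
have iS B : measurable B -> mu.-integrable (D `&` s @^-1` B) f.
  by move=> mB; apply: (integrableS mD) => //; exact: mpre.
pose P := [set B : set T' | (\int[mu]_(x in D `&` s @^-1` B) f x = 0)%E].
suff : P A by [].
apply: (dynkin_induction mG IG) => //.
- by rewrite /P /= preimage_setT setIT.
- move=> B mB; rewrite /P /= => B0; have mBc := measurableC mB.
  have := D0; rewrite -{1}(setIT D) -(setUv (s @^-1` B)) setIUr.
  rewrite integral_setU//; first by rewrite B0 add0e preimage_setC.
  + exact: mpre.
  + exact: (mpre _ mBc).
  + by apply: measurable_funS (measurable_int _ fi) => //; rewrite -setIUr; exact: subIsetl.
  + by apply/disj_setPS => x [[_ ?] [_]].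
- move=> F mF tF PF; rewrite /P /= preimage_bigcup setI_bigcupr.
  rewrite integral_bigcup//; first by apply: eseries0 => i _ _; exact: PF.
  + by move=> i j _ _ [x [[_ xi] [_ xj]]]; apply: (tF i j I I); exists (s x); split.
  + by move=> k; exact: mpre.
  + rewrite -setI_bigcupr -preimage_bigcup; apply: iS.
    exact: bigcup_measurable.
- by rewrite -mG.
Qed.

Let ray (x : R) : set (measurableTypeR R) := [set y | x < y].

Lemma ray_generate :
  @measurable _ (measurableTypeR R) = <<s [set ray x | x in [set: R]] >>.
Proof.
rewrite [LHS]RGenOInfty.measurableE; congr (<<s _ >>).
apply/seteqP; split=> [_ [x ->]|_ [x _ <-]]; exists x => //.
  by apply/seteqP; split=> y /=; rewrite in_itv/= andbT.
by apply/seteqP; split=> y /=; rewrite in_itv/= andbT.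
Qed.

Lemma ray_setI_closed : setI_closed [set ray x | x in [set: R]].
Proof.
move=> _ _ [x _ <-] [y _ <-]; exists (Num.max x y) => //.
by apply/seteqP; split=> z /=; rewrite /ray /= gt_max => /andP.
Qed.

(** The lower bound [x0] makes [D] itself one of the ray slices, so that the total integral vanishes
    as well. *)
Lemma integral0_rays D f (s : T -> measurableTypeR R) x0 :
  measurable D -> mu.-integrable D f -> measurable_fun [set: T] s ->
  (forall x, D x -> x0 < s x) ->
  (forall x, (\int[mu]_(y in D `&` [set y | (x < s y)%R]) f y = 0)%E) ->
  forall A, measurable A -> (\int[mu]_(x in D `&` s @^-1` A) f x = 0)%E.
Proof.
move=> mD fi ms Ds f0; apply: (integral0_preimage mD fi ms ray_generate ray_setI_closed).
- rewrite -[RHS](f0 x0); congr (integral _ _ _); apply/seteqP; split=> x /=.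
    by move=> Dx; split=> //; exact: Ds.
  by case.
- by move=> _ [x _ <-]; exact: f0.
Qed.

Lemma integral0_prod D f d1 d2 (T1 : measurableType d1) (T2 : measurableType d2)
    (s1 : T -> T1) (s2 : T -> T2) :
  measurable D -> mu.-integrable D f ->
  measurable_fun [set: T] s1 -> measurable_fun [set: T] s2 ->
  (forall A1 A2, measurable A1 -> measurable A2 ->
    (\int[mu]_(x in D `&` (s1 @^-1` A1 `&` s2 @^-1` A2)) f x = 0)%E) ->
  forall A, measurable A ->
  (\int[mu]_(x in D `&` (fun x => (s1 x, s2 x)) @^-1` A) f x = 0)%E.
Proof.
move=> mD fi ms1 ms2 f0.
apply: (integral0_preimage mD fi _ (measurable_prod_measurableType _ _)).
- exact: measurable_fun_pair.
- move=> _ _ [A1 mA1 [A2 mA2 <-]] [B1 mB1 [B2 mB2 <-]].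
  exists (A1 `&` B1); first exact: measurableI.
  by exists (A2 `&` B2); [exact: measurableI|rewrite setXI].
- by have := f0 setT setT measurableT measurableT; rewrite !preimage_setT !setIT.
- move=> _ [A1 mA1 [A2 mA2 <-]]; exact: f0.
Qed.

(** Rays are replaced by Borel sets one coordinate at a time. The left inverse [L] of [(s1, s2, s3)]
    exhibits every measurable set as a preimage under the three coordinates, which may be Cartesian
    or lattice coordinates. *)
Lemma ae_eq0_rays3 D f (s1 s2 s3 : T -> measurableTypeR R)
    (L : mR3 R -> T) x0 :
  measurable D -> mu.-integrable D f ->
  measurable_fun [set: T] s1 -> measurable_fun [set: T] s2 ->
  measurable_fun [set: T] s3 -> measurable_fun [set: mR3 R] L ->
  (forall x, L (s1 x, s2 x, s3 x) = x) ->
  (forall x, D x -> [/\ x0 < s1 x, x0 < s2 x & x0 < s3 x]) ->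
  (forall x1 x2 x3, (\int[mu]_(y in D `&` [set y |
     [/\ (x1 < s1 y)%R, (x2 < s2 y)%R & (x3 < s3 y)%R]]) f y = 0)%E) ->
  ae_eq mu D f (cst 0%E).
Proof.
move=> mD fi m1 m2 m3 mL LK Dx0 f0.
have mpre d' (T' : measurableType d') (s : T -> T') E B : measurable_fun setT s ->
    measurable E -> measurable B -> measurable (E `&` s @^-1` B).
  move=> ms mE mB; apply: measurableI => //; rewrite -[_ @^-1` _]setTI.
  exact: ms.
have iS E : measurable E -> E `<=` D -> mu.-integrable E f.
  by move=> mE ED; exact: (integrableS mD).
have mray x : measurable (ray x).
  by rewrite ray_generate; apply: sub_sigma_algebra; exists x.
have H1 x2 x3 A1 : measurable A1 ->
    (\int[mu]_(y in D `&` (s1 @^-1` A1 `&` (s2 @^-1` ray x2 `&` s3 @^-1` ray x3)))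
      f y = 0)%E.
  move=> mA1; rewrite (setIC (s1 @^-1` A1)) setIA.
  have mE : measurable (D `&` (s2 @^-1` ray x2 `&` s3 @^-1` ray x3)).
    by rewrite setIA; do 2 apply: (mpre _ (measurableTypeR R)) => //.
  apply: (integral0_rays (f := f) (s := s1) (x0 := x0) mE) => //.
  - by apply: iS => //; exact: subIsetl.
  - by move=> x [/Dx0[]].
  - move=> x1; rewrite -[RHS](f0 x1 x2 x3); congr (integral _ _ _).
    by apply/seteqP; split=> x [] => [[Dx [/= ? ?] ?]|Dx [? ? ?]]; do ?split.
have H2 x3 A1 A2 : measurable A1 -> measurable A2 ->
    (\int[mu]_(y in D `&` (s1 @^-1` A1 `&` (s2 @^-1` A2 `&` s3 @^-1` ray x3)))
      f y = 0)%E.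
  move=> mA1 mA2.
  have -> : D `&` (s1 @^-1` A1 `&` (s2 @^-1` A2 `&` s3 @^-1` ray x3)) =
      (D `&` s1 @^-1` A1 `&` s3 @^-1` ray x3) `&` s2 @^-1` A2.
    by apply/seteqP; split=> x [] => [Dx [? [? ?]]|[[Dx ?] ?] ?]; do ?split.
  have mE : measurable (D `&` s1 @^-1` A1 `&` s3 @^-1` ray x3).
    by do 2 apply: (mpre _ (measurableTypeR R)) => //.
  apply: (integral0_rays (f := f) (s := s2) (x0 := x0) mE) => //.
  - by apply: iS => //; rewrite -setIA; exact: subIsetl.
  - by move=> x [[/Dx0[]]].
  - move=> x2; rewrite -[RHS](H1 x2 x3 A1 mA1); congr (integral _ _ _).
    by apply/seteqP; split=> x [] => [[[Dx ?] ?] ?|Dx [? [? ?]]]; do ?split.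
have H3 A1 A2 A3 : measurable A1 -> measurable A2 -> measurable A3 ->
    (\int[mu]_(y in D `&` (s1 @^-1` A1 `&` (s2 @^-1` A2 `&` s3 @^-1` A3)))
      f y = 0)%E.
  move=> mA1 mA2 mA3; rewrite !setIA.
  have mE : measurable (D `&` s1 @^-1` A1 `&` s2 @^-1` A2).
    by do 2 apply: (mpre _ (measurableTypeR R)) => //.
  apply: (integral0_rays (f := f) (s := s3) (x0 := x0) mE) => //.
  - by apply: iS => //; rewrite -setIA; exact: subIsetl.
  - by move=> x [[/Dx0[]]].
  - move=> x3; rewrite -[RHS](H2 x3 A1 A2 mA1 mA2); congr (integral _ _ _).
    by rewrite !setIA.
have m12 : measurable_fun setT (fun x => (s1 x, s2 x)) by exact: measurable_fun_pair.
have H4 A3 A : measurable A3 -> measurable A ->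
    (\int[mu]_(y in D `&` ((fun x => (s1 x, s2 x)) @^-1` A `&` s3 @^-1` A3))
      f y = 0)%E.
  move=> mA3 mA; rewrite [_ `&` (s3 @^-1` _)]setIC setIA.
  have mE : measurable (D `&` s3 @^-1` A3) by exact: (mpre _ (measurableTypeR R)).
  apply: integral0_prod => //.
    by apply: iS => //; exact: subIsetl.
  move=> A1 A2 mA1 mA2; rewrite -[RHS](H3 A1 A2 A3 mA1 mA2 mA3).
  congr (integral _ _ _).
  by apply/seteqP; split=> x [] => [[Dx ?] [? ?]|Dx [? [? ?]]]; do ?split.
have H5 A : measurable A ->
    (\int[mu]_(y in D `&` (fun x => (s1 x, s2 x, s3 x)) @^-1` A) f y = 0)%E.
  by apply: integral0_prod => // A12 A3 m12' mA3; exact: H4.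
apply: integral_ae_eq => // E ED mE; rewrite integral0.
have mLE : measurable (L @^-1` E) by rewrite -[_ @^-1` _]setTI; exact: mL.
rewrite -[RHS](H5 _ mLE); congr (integral _ _ _).
by apply/seteqP; split=> [x Ex|x [Dx /=]]; [split; [exact: ED|rewrite /= LK]|rewrite LK].
Qed.

End vanishing_integrals.

(** * Lebesgue measure on R^3 *)

Section pushforward_measure.
Context d d' (T : measurableType d) (T' : measurableType d') (R : realType).
Context (m : {measure set T -> \bar R}) (f : T -> T').
Context (mf : measurable_fun [set: T] f).

Definition pushforward_measure : {measure set T' -> \bar R} :=
  measure_function_pushforward__canonical__measure_function_Measure m mf.

Lemma pushforward_measureE A : pushforward_measure A = pushforward m f A.
Proof. by []. Qed.

End pushforward_measure.

Section lebesgue3.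
Context {R : realType}.
Implicit Types (a y : R3 R) (N : R).
Local Notation lam := (@lebesgue_measure R).

Definition cube N : set (mR3 R) :=
  [set y | [/\ `|y.1.1| <= N, `|y.1.2| <= N & `|y.2| <= N]].

Let segm N : set R := [set x | `|x| <= N].

Lemma segmE N : segm N = `[- N, N]%classic.
Proof. by apply/seteqP; split=> x; rewrite /segm /= in_itv/= ler_norml. Qed.

Lemma cubeE N : cube N = segm N `*` segm N `*` segm N.
Proof. by apply/seteqP; split=> y [] => [? ? ?|[? ?] ?]; do ?split. Qed.

Lemma measurable_segm N : measurable (segm N).
Proof. by rewrite segmE; exact: measurable_itv. Qed.

Lemma measurable_cube N : measurable (cube N).
Proof. by rewrite cubeE; do 2?apply: measurableX => //; exact: measurable_segm. Qed.

Lemma leb3X (X : set (measurableTypeR R * measurableTypeR R))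
    (A : set (measurableTypeR R)) :
  measurable X -> measurable A -> leb3 (X `*` A) = ((lam \x lam) X * lam A)%E.
Proof. by move=> mX mA; exact: product_measure1E. Qed.

Lemma leb3_cube_lty N : (leb3 (cube N) < +oo)%E.
Proof.
have m := measurable_segm N.
have fin : (lam (segm N) < +oo)%E.
  by rewrite segmE lebesgue_measure_itv; case: ifP => // _; exact: ltry.
rewrite cubeE leb3X//; last exact: measurableX.
rewrite product_measure1E// ltey_eq.
have lf : lam (segm N) \is a fin_num by rewrite ge0_fin_numE.
by rewrite !fin_numM.
Qed.

Lemma leb3_cube1 : leb3 (cube 1) = 8%:E.
Proof.
have m := measurable_segm 1.
rewrite cubeE leb3X//; last exact: measurableX.
have seg2 : lam (segm 1) = 2%:E.
  rewrite segmE lebesgue_measure_itv/= lte_fin ifT; last by lra.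
  by rewrite -EFinD; congr EFin; lra.
rewrite product_measure1E//.
transitivity (lam (segm 1) * lam (segm 1) * lam (segm 1))%E => //.
by rewrite seg2 -!EFinM; congr EFin; lra.
Qed.

Let add1 (c : R) : measurableTypeR R -> measurableTypeR R := fun x => x + c.

Lemma measurable_addr1 (c : R) :
  measurable_fun [set: measurableTypeR R] (add1 c).
Proof. exact: measurable_funD. Qed.

Lemma lebesgue_measure_shift (c : R) A : measurable A ->
  pushforward lam (add1 c) A
  = lam A.
Proof.
move=> mA; apply/esym.
apply: (@lebesgue_measure_unique _
  (pushforward_measure lam (measurable_addr1 c))) => //= _ [[u v]] _ <-.
rewrite /pushforward /=.
have -> : (add1 c) @^-1` `]u, v]%classic
    = `](u - c), (v - c)]%classic.
  by apply/seteqP; split=> x /=; rewrite !in_itv/= ltrBlDr lerBrDr.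
rewrite !lebesgue_measure_itv/= !lte_fin ltrD2r -!EFinB.
by case: ifP => // _; congr (_%:E); ring.
Qed.

Definition shift3 a : mR3 R -> mR3 R := fun y => y + a : R3 R.

Lemma measurable_shift3 a : measurable_fun [set: mR3 R] (shift3 a).
Proof.
apply: measurable_fun_pair; first apply: measurable_fun_pair.
- apply: (measurableT_comp (measurable_addr1 a.1.1)).
  exact: (measurableT_comp measurable_fst measurable_fst).
- apply: (measurableT_comp (measurable_addr1 a.1.2)).
  exact: (measurableT_comp measurable_snd measurable_fst).
- apply: (measurableT_comp (measurable_addr1 a.2)); exact: measurable_snd.
Qed.

Let add2 (a : R * R) (y : measurableTypeR R * measurableTypeR R) :
  measurableTypeR R * measurableTypeR R := (y.1 + a.1, y.2 + a.2).

Lemma measurable_add2 (a : R * R) : measurable_fun setT (add2 a).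
Proof.
apply: measurable_fun_pair.
- by apply: (measurableT_comp (measurable_addr1 a.1)); exact: measurable_fst.
- by apply: (measurableT_comp (measurable_addr1 a.2)); exact: measurable_snd.
Qed.

Lemma leb2_shift (a : R * R) X : measurable X ->
  pushforward (lam \x lam)%E (add2 a) X = (lam \x lam)%E X.
Proof.
move=> mX; apply/esym; apply: (@product_measure_unique _ _ _ _ _ _ _
  (pushforward_measure (lam \x lam)%E (measurable_add2 a))) => // A B mA mB.
rewrite pushforward_measureE /pushforward.
have -> : add2 a @^-1` (A `*` B) =
    ((add1 a.1) @^-1` A) `*`
    ((add1 a.2) @^-1` B) by [].
transitivity (pushforward lam (add1 a.1) A *
    pushforward lam (add1 a.2) B)%E;
  last by rewrite !lebesgue_measure_shift.
apply: product_measure1E.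
- by rewrite -[X in measurable X]setTI; exact: measurable_addr1.
- by rewrite -[X in measurable X]setTI; exact: measurable_addr1.
Qed.

(** Both measures agree on measurable rectangles, a generating pi-system, and the cubes exhaust
    space with finite measure. *)
Lemma leb3_shift a X : measurable X ->
  leb3 (shift3 a @^-1` X) = leb3 X.
Proof.
move=> mX; pose m' := pushforward_measure leb3 (measurable_shift3 a).
have -> : leb3 (shift3 a @^-1` X) = m' X.
  by rewrite /m' pushforward_measureE.
apply/esym; apply: (@measure_unique _ _ _ _ (fun n => cube n%:R) (measurable_prod_measurableType _ _)) => //.
- move=> _ _ [A1 mA1 [A2 mA2 <-]] [B1 mB1 [B2 mB2 <-]].
  exists (A1 `&` B1); first exact: measurableI.
  by exists (A2 `&` B2); [exact: measurableI|rewrite setXI].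
- move=> n; rewrite cubeE; exists (segm n%:R `*` segm n%:R).
    by apply: measurableX; exact: measurable_segm.
  by exists (segm n%:R) => //; exact: measurable_segm.
- apply/seteqP; split=> // y _.
  pose M := `|y.1.1| + `|y.1.2| + `|y.2|; exists (Num.truncn M).+1 => //.
  have := truncnS_gt M; rewrite /M /cube /= => h.
  have := normr_ge0 y.1.1; have := normr_ge0 y.1.2; have := normr_ge0 y.2.
  by split; lra.
- move=> _ [A mA [B mB <-]]; rewrite pushforward_measureE /pushforward leb3X//.
  have -> : shift3 a @^-1` (A `*` B) = (add2 a.1 @^-1` A) `*`
    ((add1 a.2) @^-1` B) by [].
  rewrite leb3X.
  + by rewrite -(lebesgue_measure_shift a.2 mB) -(leb2_shift a.1 mA).
  + by rewrite -[X in measurable X]setTI; exact: measurable_add2.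
  + by rewrite -[X in measurable X]setTI; exact: measurable_addr1.
- by move=> k; exact: leb3_cube_lty.
Qed.

Lemma integral3_shift a (f : mR3 R -> \bar R) :
  measurable_fun [set: mR3 R] f -> (forall y, 0 <= f y)%E ->
  (\int[leb3]_y f (shift3 a y) = \int[leb3]_y f y)%E.
Proof.
move=> mf f0.
have f0' : {in [set: mR3 R], forall y, 0 <= f y}%E by move=> y _.
have := ge0_integral_pushforward (measurable_shift3 a) leb3 measurableT mf f0'.
rewrite preimage_setT => <-.
by apply: eq_measure_integral => [|m3 A mA _]; [exact: measurable_shift3|exact: leb3_shift].
Qed.

(** An open set is a countable union of boxes with rational centres and radii; this links the
    topology to the product sigma-algebra. *)
Lemma open_measurable3 (U : set (R3 R)) : open U -> @measurable _ (mR3 R) U.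
Proof.
move=> oU.
pose B (q : rat * rat * rat * rat) : set (mR3 R) :=
  (ball (ratr q.1.1.1 : R) (ratr q.2) `*` ball (ratr q.1.1.2 : R) (ratr q.2))
  `*` ball (ratr q.1.2 : R) (ratr q.2).
have mB q : measurable (B q).
  by do 2?apply: measurableX => //; exact: measurable_ball.
pose F q := if `[< B q `<=` U >] then B q else set0.
have -> : U = \bigcup_q F q.
  apply/seteqP; split=> [y Uy|y [q _]]; last first.
    by rewrite /F; case: asboolP => // BU /BU.
  have /nbhs_ballP[e /= e0 eU] : nbhs y U by exact: open_nbhs_nbhs.
  (* A radius below [e / 2] keeps a rational box that contains [y] inside the ball of radius [e]. *)
  have [|r] := @rat_in_itvoo R 0 (e / 2); first by rewrite divr_gt0.
  rewrite in_itv/= => /andP[r0 re].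
  have ap (x : R) : exists q : rat, `|ratr q - x| < ratr r :> R.
    have [|q] := @rat_in_itvoo _ (x - ratr r) (x + ratr r); first lra.
    by rewrite in_itv/= => qP; exists q; rewrite ltr_norml; lra.
  have [q1 h1] := ap y.1.1; have [q2 h2] := ap y.1.2; have [q3 h3] := ap y.2.
  exists (q1, q2, q3, r) => //; rewrite /F; case: asboolP => [_|]; last first.
    case=> z [[]]; rewrite /B -!ball_normE/= => b1 b2 b3; apply: eU.
    have tri (u v w : R) : `|u - v| < ratr r -> `|u - w| < ratr r -> `|v - w| < e.
      by rewrite !ltr_norml => ? ?; lra.
    by do 2?split; rewrite -ball_normE/=; [apply: (tri _ _ _ h1)|apply: (tri _ _ _ h2)|apply: (tri _ _ _ h3)].
  by do 2?split; rewrite /= -ball_normE.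
apply: countable_bigcupT_measurable => // q.
by rewrite /F; case: ifP.
Qed.

Lemma closed_measurable3 (U : set (R3 R)) : closed U -> @measurable _ (mR3 R) U.
Proof.
move=> cU; rewrite -[U]setCK; apply: measurableC.
by apply: open_measurable3; rewrite openC.
Qed.

Lemma continuous_measurable3 (f : R3 R -> R) : continuous f ->
  measurable_fun [set: mR3 R] f.
Proof.
move=> /continuousP cf; apply: (measurability _ (RGenOpens.measurableE R)) => //.
move=> _ [_ [x [y ->]] <-]; rewrite setTI.
by apply: open_measurable3; apply: cf; exact: interval_open.
Qed.

End lebesgue3.

(** * The lattice and its cell *)

Section dot3.
Context {R : realType}.
Implicit Types (d y : R3 R).

Definition dot3 d y : R := d.1.1 * y.1.1 + d.1.2 * y.1.2 + d.2 * y.2.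

Lemma dot3_continuous d : continuous (dot3 d).
Proof.
have fstc (U V : topologicalType) : continuous (@fst U V).
  by case=> u v; exact: cvg_fst.
have sndc (U V : topologicalType) : continuous (@snd U V).
  by case=> u v; exact: cvg_snd.
move=> y; apply: cvgD; first apply: cvgD.
- apply: cvgM; first exact: cvg_cst.
  exact: (cvg_comp _ _ (fstc _ _ y) (fstc _ _ y.1)).
- apply: cvgM; first exact: cvg_cst.
  exact: (cvg_comp _ _ (fstc _ _ y) (sndc _ _ y.1)).
- by apply: cvgM; [exact: cvg_cst|exact: (sndc _ _ y)].
Qed.

End dot3.

Section lattice_coordinates.
Context {R : realType} (g : 'I_3 -> R3 R).
Context (g_free : free [tuple g i | i < 3]).
Implicit Types (y z : R3 R) (n : 'I_3 -> int).

Definition sg (i : 'I_3) (y : R3 R) : R := coord [tuple g i | i < 3] i y.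

Lemma sgD i y z : sg i (y + z) = sg i y + sg i z.
Proof. exact: linearD. Qed.

Lemma sgZ i c y : sg i (c *: y) = c * sg i y.
Proof. exact: linearZ. Qed.

Lemma sgN i y : sg i (- y) = - sg i y.
Proof. exact: linearN. Qed.

Lemma sg_sum (I : Type) (r : seq I) (F : I -> R3 R) i :
  sg i (\sum_(j <- r) F j) = \sum_(j <- r) sg i (F j).
Proof. exact: linear_sum. Qed.

Lemma sg_g i j : sg i (g j) = (i == j)%:R.
Proof.
have gE : [tuple g i | i < 3]`_j = g j by rewrite -tnth_nth tnth_mktuple.
by rewrite -{1}gE /sg coord_free// eq_sym.
Qed.

Lemma sgK y : \sum_i sg i y *: g i = y.
Proof.
have fullY : y \in <<[tuple g i | i < 3]>>%VS.
  rewrite (_ : <<_>>%VS = fullv) ?memvf//; apply/eqP.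
  rewrite eqEdim subvf dimvf /=; move: g_free; rewrite /free => /eqP ->.
  by rewrite size_tuple.
rewrite [RHS](coord_span fullY); apply: eq_bigr => i _.
by rewrite -tnth_nth tnth_mktuple.
Qed.

Lemma sg_toY (s : 'I_3 -> R) i : sg i (\sum_j s j *: g j) = s i.
Proof.
rewrite sg_sum (bigD1 i)//= big1 ?addr0 ?sgZ ?sg_g ?eqxx ?mulr1// => j ji.
by rewrite sgZ sg_g eq_sym (negbTE ji) mulr0.
Qed.

Definition lat n : R3 R := \sum_i g i *~ n i.

Lemma lattice_lat n : lattice g (lat n). Proof. by exists n. Qed.

Lemma sg_lat i n : sg i (lat n) = (n i)%:~R.
Proof.
rewrite -[RHS](sg_toY (fun i => (n i)%:~R)); congr (sg i _).
by apply: eq_bigr => j _; rewrite scaler_int.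
Qed.

Lemma basis_decomp y : y = y.1.1 *: basis_vec ord0 + y.1.2 *: basis_vec 1
  + y.2 *: basis_vec ord_max.
Proof.
by case: y => [[y1 y2] y3]; congr (_, _, _) => /=; rewrite /GRing.scale /=; lra.
Qed.

(** The dual basis of [g], obtained by evaluating the linear form [sg i] on the canonical basis. *)
Definition dual (i : 'I_3) : R3 R :=
  (sg i (basis_vec ord0), sg i (basis_vec 1), sg i (basis_vec ord_max)).

Lemma sgE i y : sg i y = dot3 (dual i) y.
Proof.
rewrite {1}(basis_decomp y) !sgD !sgZ /dot3 /=.
by congr (_ + _ + _); rewrite mulrC.
Qed.

Lemma sg_continuous i : continuous (sg i).
Proof.
have -> : sg i = dot3 (dual i) by apply/funext => y; exact: sgE.
exact: dot3_continuous.
Qed.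

Lemma measurable_sg i : measurable_fun [set: mR3 R] (sg i).
Proof. exact: (continuous_measurable3 (@sg_continuous i)). Qed.

Lemma sg_bounded N : exists M : nat, forall y i, cube N y -> `|sg i y| < M%:R.
Proof.
pose b i := N * (`|sg i (basis_vec ord0)| + `|sg i (basis_vec 1)| +
  `|sg i (basis_vec ord_max)|).
exists (\sum_i Num.truncn (b i)).+1%N => y i [h1 h2 h3].
have : `|sg i y| <= b i.
  rewrite sgE /b /dot3 /= !mulrDr.
  apply: le_trans (ler_normD _ _) _; apply: lerD; last by rewrite normrM mulrC ler_wpM2r.
  apply: le_trans (ler_normD _ _) _.
  by apply: lerD; rewrite normrM mulrC ler_wpM2r.
move/le_lt_trans; apply; apply: lt_le_trans (truncnS_gt _) _.
by rewrite ler_nat ltnS (bigD1 i)//= leq_addr.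
Qed.

Lemma cube_sg (M : R) : exists N, forall y, (forall i, `|sg i y| <= M) -> cube N y.
Proof.
pose c (p : R3 R -> R) := \sum_i M * `|p (g i)|.
have key (p : R3 R -> R) y : {morph p : u v / u + v} -> (forall k u, p (k *: u) = k * p u) ->
    (forall i, `|sg i y| <= M) -> `|p y| <= c p.
  move=> pD pZ yM; rewrite -{1}(sgK y).
  have -> : p (\sum_i sg i y *: g i) = \sum_i sg i y * p (g i).
    have p0 : p 0 = 0 by rewrite -(scale0r 0) pZ mul0r.
    rewrite (big_morph p pD p0); apply: eq_bigr => i _; exact: pZ.
  apply: le_trans (ler_norm_sum _ _ _) _; apply: ler_sum => i _.
  by rewrite normrM ler_wpM2r.
exists (`|c (fun y => y.1.1)| + `|c (fun y => y.1.2)| + `|c (fun y => y.2)|).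
move=> y yM.
have := key (fun y => y.1.1) y (fun _ _ => erefl) (fun _ _ => erefl) yM.
have := key (fun y => y.1.2) y (fun _ _ => erefl) (fun _ _ => erefl) yM.
have := key (fun y => y.2) y (fun _ _ => erefl) (fun _ _ => erefl) yM.
have := ler_norm (c (fun y => y.1.1)); have := ler_norm (c (fun y => y.1.2)).
have := ler_norm (c (fun y => y.2)).
have := normr_ge0 (c (fun y => y.1.1)); have := normr_ge0 (c (fun y => y.1.2)).
have := normr_ge0 (c (fun y => y.2)).
by move: (`|c _|) (`|c _|) (`|c _|) => *; split; lra.
Qed.

(** Half-open, so that its lattice translates tile space without overlap; it differs from the closed
    cell by a null set. *)
Definition hcell : set (mR3 R) := [set y | forall i, 0 <= sg i y < 1].

Lemma measurable_hcell : measurable hcell.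
Proof.
have -> : hcell = \bigcap_(i in [set: 'I_3]) (sg i @^-1` `[0, 1[%classic).
  apply/seteqP; split=> y yh i; first by move=> _; rewrite /= in_itv /=; exact: yh.
  by have := yh i I; rewrite /= in_itv.
apply: fin_bigcap_measurable => // i _.
by rewrite -[X in measurable X]setTI; apply: measurable_sg => //; exact: measurable_itv.
Qed.

Lemma hcell_cube : exists N, hcell `<=` cube N.
Proof.
have [N NP] := cube_sg 1; exists N => y yh; apply: NP => i.
by have /andP[y0 /ltW] := yh i; rewrite ger0_norm.
Qed.

Lemma leb3_hcell_lty : (leb3 hcell < +oo)%E.
Proof.
have [N NP] := hcell_cube; apply: le_lt_trans (leb3_cube_lty N).
by apply: le_measure => //; rewrite inE; [exact: measurable_hcell|exact: measurable_cube].
Qed.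

(** Lattice indices with coordinates from [- M] to [M - 1], parametrised by a finite type so that
    lattice sums are finite sums. *)
Definition window (M : nat) (f : {ffun 'I_3 -> 'I_(M + M)}) : 'I_3 -> int :=
  fun i => (f i)%:Z - M%:Z.

Lemma sum_unit_intervals (M : nat) (x : R) : - M%:R <= x < M%:R ->
  \sum_(j < M + M) ((0 <= x - ((j%:Z - M%:Z)%:~R) < 1)%R%:R : R) = 1.
Proof.
move=> /andP[x1 x2].
(* The only index that contributes is [floor x + M]. *)
have k0 : 0 <= Num.floor x + M%:Z.
  by rewrite -lerBlDr sub0r floor_ge_int mulrNz.
have [k kE] : exists k : nat, k%:Z = Num.floor x + M%:Z.
  by case: (Num.floor x + M%:Z) k0 => // k _; exists k.
have kM : (k < M + M)%N.
  rewrite -ltz_nat kE PoszD ltrD2r -(ltr_int R).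
  by apply: le_lt_trans x2; exact: floor_le.
rewrite (bigD1 (Ordinal kM))//= big1 ?addr0 => [|j jk].
  rewrite kE addrK; have := floor_le x; have /andP[_] := floor_itv x.
  rewrite intrD rmorph1 => h1 h2.
  by rewrite subr_ge0 h2 /= ltrBlDl h1.
case: (boolP (_ <= _ < _)) => // /andP[h1 h2]; case/eqP: jk; apply/val_inj => /=.
suff : (j%:Z - M%:Z) = Num.floor x by move=> h; apply/eqP; rewrite -eqz_nat kE -h subrK.
apply/esym/floor_def; rewrite -subr_ge0 h1 /=.
by rewrite intrD rmorph1 -ltrBlDl.
Qed.

Lemma hcell_tiling (M : nat) y : (forall i, - M%:R <= sg i y < M%:R) ->
  \sum_(f : {ffun 'I_3 -> 'I_(M + M)}) \1_hcell (y - lat (window f)) = 1 :> R.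
Proof.
move=> yM.
have E (f : {ffun 'I_3 -> 'I_(M + M)}) : \1_hcell (y - lat (window f)) =
    \prod_i ((0 <= sg i y - ((f i)%:Z - M%:Z)%:~R < 1)%R%:R) :> R.
  have e i : sg i (y - lat (window f)) = sg i y - ((f i)%:Z - M%:Z)%:~R.
    by rewrite sgD sgN sg_lat /window. 
  rewrite indicE; case: (boolP (_ \in _)) => [|h].
    by move=> /set_mem h; rewrite big1// => i _; have := h i; rewrite e => ->.
  case: (boolP [exists i, ~~ (0 <= sg i y - ((f i)%:Z - M%:Z)%:~R < 1)]).
    by move=> /existsP[i ni]; rewrite (bigD1 i)//= (negbTE ni) mul0r.
  rewrite negb_exists => /forallP hh; case/negP: h; rewrite inE => i.
  by rewrite e; have := hh i; rewrite negbK.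
under eq_bigr do rewrite E.
rewrite -(bigA_distr_bigA (fun i (j : 'I_(M + M)) => (0 <= sg i y - (j%:Z - M%:Z)%:~R < 1)%R%:R : R)) /=.
by rewrite big1// => i _; exact: sum_unit_intervals.
Qed.

End lattice_coordinates.

(** * Translations, null sets and compact sets in R^3 *)

Section shift_lebesgue3.
Context {R : realType}.
Implicit Types (a y : R3 R) (f : mR3 R -> R).

Lemma ae3_shift a (P : R3 R -> Prop) :
  {ae leb3, forall y, P y} -> {ae leb3, forall y, P (y + a)}.
Proof.
move=> [N [mN N0 PN]]; exists (shift3 a @^-1` N); split.
- by rewrite -[X in measurable X]setTI; exact: measurable_shift3.
- by rewrite leb3_shift.
- by move=> y /= nP; exact: PN.
Qed.

Lemma ae3_impl (P Q : R3 R -> Prop) : (forall y, P y -> Q y) ->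
  {ae leb3, forall y, P y} -> {ae leb3, forall y, Q y}.
Proof.
move=> PQ [N [mN N0 NP]]; exists N; split=> // y nQ; apply: NP => /= Py.
exact/nQ/PQ.
Qed.

Lemma ae3_and (P Q : R3 R -> Prop) :
  {ae leb3, forall y, P y} -> {ae leb3, forall y, Q y} ->
  {ae leb3, forall y, P y /\ Q y}.
Proof.
move=> [N [mN N0 NP]] [M [mM M0 MQ]]; exists (N `|` M); split.
- exact: measurableU.
- by rewrite null_set_setU.
- move=> y /= h; apply: contrapT => /not_orP[nN nM]; apply: h; split.
    by apply: contrapT => nP; exact/nN/NP.
  by apply: contrapT => nQ; exact/nM/MQ.
Qed.

Lemma Rintegral3_shift a f : measurable_fun [set: mR3 R] f ->
  \int[leb3]_y f (shift3 a y) = \int[leb3]_y f y.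
Proof.
move=> mf; have mE : measurable_fun [set: mR3 R] (EFin \o f) by exact/measurable_EFinP.
rewrite /Rintegral; congr fine.
rewrite -[X in integral _ _ X]/((EFin \o f) \o shift3 a).
rewrite integralE [RHS]integralE funepos_comp funeneg_comp; congr (_ - _)%E.
- by apply: (integral3_shift a (measurable_funepos mE)) => y; exact: funepos_ge0.
- by apply: (integral3_shift a (measurable_funeneg mE)) => y; exact: funeneg_ge0.
Qed.

Lemma integrable3_shift a f : leb3.-integrable [set: mR3 R] (EFin \o f) ->
  leb3.-integrable [set: mR3 R] (EFin \o (f \o shift3 a)).
Proof.
move=> /integrableP[mf fi]; apply/integrableP; split.
  exact: (measurableT_comp mf (measurable_shift3 a)).
apply: le_lt_trans fi; rewrite -(integral3_shift a (f := fun y => `|(f y)%:E|%E))//.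
exact: measurableT_comp.
Qed.

Lemma integrable_indicP d (T : measurableType d) (mu : {measure set T -> \bar R})
    (D : set T) (f : T -> R) : measurable D ->
  mu.-integrable D (EFin \o f) <->
  mu.-integrable [set: T] (EFin \o (fun x => f x * \1_D x)).
Proof.
move=> mD; rewrite integrable_mkcond//.
suff -> : EFin \o (fun x => f x * \1_D x) = (EFin \o f) \_ D by [].
apply/funext => x; rewrite /= patchE indicE.
by case: (x \in D); rewrite ?mulr1 ?mulr0.
Qed.

Lemma Rintegral_indic_cond d (T : measurableType d) (mu : {measure set T -> \bar R})
    (D : set T) (f : T -> R) :
  \int[mu]_(x in D) f x = \int[mu]_x (f x * \1_D x).
Proof.
rewrite Rintegral_mkcond; apply: eq_Rintegral => x _; rewrite patchE indicE.
by case: (x \in D); rewrite ?mulr1 ?mulr0.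
Qed.

Lemma integrable_ae_eq d (T : measurableType d) (mu : {measure set T -> \bar R})
    (D : set T) (f h : T -> R) : measurable D ->
  measurable_fun D h -> {ae mu, forall x, f x = h x} ->
  mu.-integrable D (EFin \o f) -> mu.-integrable D (EFin \o h).
Proof.
move=> mD mh fh fi; apply/integrableP; split; first exact/measurable_EFinP.
have /integrableP[mf] := fi; apply: le_lt_trans.
rewrite le_eqVlt; apply/orP; left; apply/eqP; apply: ae_eq_integral => //.
- by apply: measurableT_comp => //; exact/measurable_EFinP.
- exact: measurableT_comp.
- by apply: filterS fh => x /= ->.
Qed.

Lemma Rintegral_ae_eq d (T : measurableType d) (mu : {measure set T -> \bar R})
    (D : set T) (f h : T -> R) : measurable D ->
  measurable_fun D f -> measurable_fun D h -> {ae mu, forall x, f x = h x} ->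
  \int[mu]_(x in D) f x = \int[mu]_(x in D) h x.
Proof.
move=> mD mf mh fh; rewrite /Rintegral; congr fine; apply: ae_eq_integral => //.
- exact/measurable_EFinP.
- exact/measurable_EFinP.
- by apply: filterS fh => x /= ->.
Qed.

Lemma compact_cube (N : R) : compact (cube N : set (R3 R)).
Proof.
have -> : (cube N : set (R3 R)) = `[- N, N] `*` `[- N, N] `*` `[- N, N].
  apply/seteqP; split=> y; rewrite /cube /= !in_itv/= -!ler_norml.
    by case.
  by case=> [[]].
by apply: compact_setX; [apply: compact_setX|]; exact: segment_compact.
Qed.

Lemma compact_sub_cube (K : set (R3 R)) : compact K -> exists N, K `<=` cube N.
Proof.
move=> /compact_bounded[M [_ MK]]; exists (M + 1) => y Ky.
have M1 : M < M + 1 by rewrite ltrDl.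
by have := MK (M + 1) M1 y Ky; rewrite /= !prod_normE !ge_max => /andP[/andP[]].
Qed.

Lemma compact_measurable3 (K : set (R3 R)) : compact K -> @measurable _ (mR3 R) K.
Proof.
by move=> cK; apply: closed_measurable3; apply: compact_closed => //; exact: norm_hausdorff.
Qed.

End shift_lebesgue3.

(** * Folding integrals over space onto the cell *)

Section unfolding.
Context {R : realType} (g : 'I_3 -> R3 R).
Context (g_free : free [tuple g i | i < 3]).
Implicit Types (y a : R3 R) (n : 'I_3 -> int) (F : mR3 R -> R).
Local Notation per := (Pilot.Defs.periodic g).
Local Notation sg := (sg g).
Local Notation lat := (lat g).
Local Notation hcell := (hcell g).
Let mh := measurable_hcell g.

Lemma measurable_indic_shift a :
  measurable_fun [set: mR3 R] (fun y => \1_hcell (y - a) : R).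
Proof.
have m1 : measurable_fun [set: mR3 R] (\1_hcell : mR3 R -> R) by exact: measurable_indic.
exact: (measurableT_comp m1 (measurable_shift3 (- a))).
Qed.

Lemma integrable_translate F n : measurable_fun [set: mR3 R] F -> per F ->
  leb3.-integrable hcell (EFin \o F) ->
  leb3.-integrable [set: mR3 R] (EFin \o (fun y : R3 R => F y * \1_hcell (y - lat n))).
Proof.
move=> mF pF /(integrable_indicP leb3 F mh) Fi.
have := integrable3_shift (- lat n) Fi.
apply: integrable_ae_eq => //.
- by apply: measurable_funM => //; exact: measurable_indic_shift.
- have [|N [mN N0 NP]] := pF (lat (fun i => - n i)); first exact: lattice_lat.
  exists N; split=> // y nFy; apply: NP => /= h; apply: nFy => /=.
  rewrite /shift3; congr (_ * _); rewrite -h; congr F; congr (_ + _).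
  by rewrite /lat -sumrN; apply: eq_bigr => i _; rewrite mulrNz.
Qed.

(** A factor [psi] supported in finitely many translates of the cell is cut along the tiling, and
    each piece is translated back, [F] being unchanged a.e. *)
Lemma unfold F (psi : mR3 R -> R) (B : R) (M : nat) :
  measurable_fun [set: mR3 R] F -> per F -> leb3.-integrable hcell (EFin \o F) ->
  measurable_fun [set: mR3 R] psi -> (forall y, `|psi y| <= B) ->
  (forall y, psi y != 0 -> forall i, - M%:R <= sg i y < M%:R) ->
  leb3.-integrable [set: mR3 R] (EFin \o (fun y => F y * psi y)) /\
  \int[leb3]_y (F y * psi y) = \int[leb3]_(y in hcell)
    (F y * \sum_(f : {ffun 'I_3 -> 'I_(M + M)}) psi (y + lat (window f) : R3 R)).
Proof.
move=> mF pF iF mpsi psiB psiM.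
pose G (f : {ffun 'I_3 -> 'I_(M + M)}) (y : R3 R) := psi y * (F y * \1_hcell (y - lat (window f))).
have mG f : measurable_fun [set: mR3 R] (G f).
  apply: measurable_funM => //; apply: measurable_funM => //.
  exact: measurable_indic_shift.
have iG f : leb3.-integrable [set: mR3 R] (EFin \o G f).
  apply: (@integrable_le _ _ R leb3 _ measurableT (G f)
    (fun y : R3 R => B * `|F y * \1_hcell (y - lat (window f))|)) => //.
    by move=> y _; rewrite normrM ler_wpM2r.
  by apply: integrableZ_fun => //; exact/integrable_norm/integrable_translate.
have GE : (fun y => F y * psi y) = (fun y => \sum_f G f y).
  apply/funext => y; rewrite /G -mulr_sumr -mulr_sumr.
  have [->|p0] := eqVneq (psi y) 0; first by rewrite mulr0 mul0r.
  by rewrite hcell_tiling ?mulr1 1?mulrC// => i; exact: psiM.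
have sh f : \int[leb3]_y G f y =
    \int[leb3]_(y in hcell) (F y * psi (y + lat (window f) : R3 R)).
  rewrite -(Rintegral3_shift (lat (window f)) (mG f)) [RHS]Rintegral_indic_cond.
  apply: Rintegral_ae_eq => //.
  - exact: (measurableT_comp (mG f) (measurable_shift3 _)).
  - apply: measurable_funM; last exact: measurable_indic.
    apply: measurable_funM => //.
    exact: (measurableT_comp mpsi (measurable_shift3 _)).
  - have [|N [mN N0 NP]] := pF (lat (window f)); first exact: lattice_lat.
    exists N; split=> // y nFy; apply: NP => /= h; apply: nFy => /=.
    by rewrite /G /shift3 h addrK mulrCA mulrA.
split; first by rewrite GE; exact: integrable_sum_fun.
rewrite GE Rintegral_sum//; under eq_bigr do rewrite sh.
rewrite -Rintegral_sum//; first by apply: eq_Rintegral => y _; rewrite -mulr_sumr.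
move=> f; apply: (@integrable_le _ _ R leb3 _ mh
  (fun y : R3 R => F y * psi (y + lat (window f))) (fun y => B * `|F y|)).
- apply: measurable_funTS; apply: measurable_funM => //.
  exact: (measurableT_comp mpsi (measurable_shift3 _)).
- by move=> y _; rewrite normrM mulrC ler_wpM2r.
- by apply: integrableZ_fun => //; exact: integrable_norm.
Qed.

Lemma Lsq_of_L2loc F : L2loc F -> Lsq leb3 hcell F.
Proof.
move=> [mF FK]; split=> //; have [N NP] := hcell_cube g_free.
apply: (integrableS (measurable_cube N)) => //.
by apply: FK; exact: compact_cube.
Qed.

Lemma periodic_comp (T : Type) (f : R3 R -> T) (U : Type) (h : T -> U) : per f ->
  per (fun y => h (f y)).
Proof. by move=> pf a La; apply: ae3_impl (pf a La) => y ->. Qed.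

(** A compact set meets only finitely many translates of the cell: [unfold] is applied to the square
    of [F] and the indicator of a cube. *)
Lemma L2loc_of_Lsq F : per F -> Lsq leb3 hcell F -> L2loc F.
Proof.
move=> pF [mF F2]; split=> // K cK; have [N KN] := compact_sub_cube cK.
have [M MP] := sg_bounded g N.
have mK := compact_measurable3 cK.
apply: (integrableS (measurable_cube N)) => //.
apply/(integrable_indicP _ _ (measurable_cube N)).
apply: (proj1 (@unfold _ _ 1 M _ _ _ _ _ _)) => //.
- exact: measurable_funX.
- exact: (periodic_comp (fun x => x ^+ 2)).
- exact: measurable_indic (measurable_cube N).
- by move=> y; rewrite indicE; case: (_ \in _); rewrite ?normr1 ?normr0.
- move=> y; rewrite indicE; case: (boolP (y \in cube N)); last by rewrite eqxx.
  move=> /set_mem yN _ i; have := MP y i yN; rewrite ltr_norml => /andP[/ltW -> ->].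
  by [].
Qed.

End unfolding.

(** * The closed cell and its volume *)

Section closed_cell.
Context {R : realType} (g : 'I_3 -> R3 R).
Context (g_free : free [tuple g i | i < 3]).
Implicit Types (y a : R3 R).
Local Notation sg := (sg g).
Local Notation hcell := (hcell g).

Lemma cellE : cell g = [set y | forall i, 0 <= sg i y <= 1].
Proof.
apply/seteqP; split=> [_ [s s01 <-] i|y y01]; first by rewrite sg_toY.
by exists (fun i => sg i y) => //; exact: sgK.
Qed.

Lemma hcell_sub : hcell `<=` cell g.
Proof.
by rewrite cellE => y yh i; have /andP[-> /ltW ->] := yh i.
Qed.

Lemma measurable_sg_itv (i : 'I_3) (I : interval R) :
  @measurable _ (mR3 R) [set y | sg i y \in I].
Proof.
have -> : [set y | sg i y \in I] = sg i @^-1` [set` I] by [].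
rewrite -[X in measurable X]setTI; apply: measurable_sg => //.
Qed.

Lemma measurable_cell : @measurable _ (mR3 R) (cell g).
Proof.
have -> : cell g = \bigcap_(i in [set: 'I_3]) [set y | sg i y \in `[0, 1] ].
  rewrite cellE; apply/seteqP; split=> y yh i; first by move=> _; rewrite /= in_itv /=; exact: yh.
  by have := yh i I; rewrite /= in_itv.
by apply: fin_bigcap_measurable => // i _; exact: measurable_sg_itv.
Qed.

(* The translates of a face of the cell by [g i / (m + 1)] are disjoint, have
   the same measure, and lie in a common bounded set. *)
Lemma face_null (i : 'I_3) : leb3 (cell g `&` [set y | sg i y \in `[1, 1] ]) = 0%E.
Proof.
set N := (X in leb3 X).
have mN : measurable N.
  by apply: measurableI; [exact: measurable_cell|exact: measurable_sg_itv].
pose t (m : nat) : R := (m.+1%:R)^-1.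
pose F m : set (mR3 R) := shift3 (- (t m *: g i)) @^-1` N.
have mF m : measurable (F m).
  by rewrite -[X in measurable X]setTI; exact: measurable_shift3.
have FN m : leb3 (F m) = leb3 N by exact: leb3_shift.
have sgF m j y : F m y -> sg j y = sg j (shift3 (- (t m *: g i)) y) + t m * (j == i)%:R.
  by move=> _; rewrite /shift3 sgD sgN sgZ sg_g// subrK.
have tF : trivIset [set: nat] F.
  move=> m k _ _ [y [Fm Fk]].
  have h1 := sgF m i y Fm; have h2 := sgF k i y Fk.
  have [_] := Fm; rewrite /= in_itv/= -eq_le => /eqP e1.
  have [_] := Fk; rewrite /= in_itv/= -eq_le => /eqP e2.
  move: h1 h2; rewrite -e1 -e2 eqxx !mulr1 => -> /addrI/invr_inj/eqP.
  by rewrite eqr_nat => /eqP[].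
have [C CP] := cube_sg g_free 2.
have FC : \bigcup_n F n `<=` cube C.
  move=> y [m _ Fm]; apply: CP => j; rewrite (sgF m j y Fm).
  have [] := Fm; rewrite cellE => /(_ j) /andP[h0 h1] _.
  have t0 : 0 <= t m <= 1.
    by rewrite /t invr_ge0 ler0n invf_le1 ?ltr0n// ler1n.
  by case: (j == i); rewrite ler_norml ?mulr1 ?mulr0; lra.
have mU : measurable (\bigcup_n F n) by exact: bigcup_measurable.
have Ufin : (leb3 (\bigcup_n F n) < +oo)%E.
  apply: le_lt_trans (leb3_cube_lty C).
  by apply: le_measure => //; rewrite inE//; exact: measurable_cube.
have : leb3 N \is a fin_num.
  rewrite ge0_fin_numE//; apply: le_lt_trans (leb3_cube_lty C).
  apply: le_measure; rewrite ?inE//; first exact: measurable_cube.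
  move=> y [yc _]; apply: CP => j; move: yc; rewrite cellE => /(_ j) ?.
  by rewrite ler_norml; lra.
case E : (leb3 N) => [r| |]// _.
have : leb3 (\bigcup_n F n) \is a fin_num by rewrite ge0_fin_numE.
case E2 : (leb3 (\bigcup_n F n)) => [c| |]// _.
have r0 : 0 <= r by rewrite -lee_fin -E measure_ge0.
have nr n : r *+ n <= c.
  rewrite -lee_fin -E2 measure_bigcup//.
  rewrite (eq_eseriesl (Q := xpredT)); last by move=> k; rewrite in_setT.
  apply: (@le_trans _ _ (\sum_(0 <= i < n) leb3 (F i))%E).
    by under eq_bigr do rewrite FN E; rewrite sumEFin lee_fin sumr_const_nat subn0.
  by apply: nneseries_lim_ge => k _ _; exact: measure_ge0.
congr (_%:E); apply/eqP; rewrite eq_le r0 andbT leNgt; apply/negP => rp.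
have c0 : 0 <= c / r by rewrite divr_ge0//; exact: le_trans (nr 0%N).
have := nr (Num.truncn (c / r)).+1; rewrite -mulr_natr mulrC -ler_pdivlMr//.
by rewrite leNgt truncnS_gt.
Qed.

Lemma cell_hcell_null : leb3 (cell g `\` hcell) = 0%E.
Proof.
have mD : measurable (cell g `\` hcell).
  by apply: measurableD; [exact: measurable_cell|exact: measurable_hcell].
pose A (i : 'I_3) : set (mR3 R) := cell g `&` [set y | sg i y \in `[1, 1] ].
(* [insub] lists the three faces [sg i = 1] as a sequence, padded with empty sets. *)
pose U := \bigcup_k (if insub k is Some i then A i else set0).
have mU : measurable U.
  apply: bigcup_measurable => k _; case: insub => // i.
  by apply: measurableI; [exact: measurable_cell|exact: measurable_sg_itv].
have U0 : leb3 U = 0%E.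
  apply/negligibleP => //; apply: negligible_bigcup => k.
  case: insub => [i|]; last exact: negligible_set0.
  apply/negligibleP; last exact: face_null.
  by apply: measurableI; [exact: measurable_cell|exact: measurable_sg_itv].
apply/eqP; rewrite eq_le measure_ge0 andbT -U0; apply: le_measure; rewrite ?inE//.
move=> y [yc yh]; move: (yc); rewrite cellE => y01.
apply: contrapT => nU; apply: yh => i; have /andP[-> h1] := y01 i.
rewrite lt_neqAle h1 andbT; apply/eqP => e; apply: nU.
by exists i => //; rewrite valK; split=> //=; rewrite in_itv/= e lexx.
Qed.

Lemma Rintegral_cell (F : mR3 R -> R) : leb3.-integrable (cell g) (EFin \o F) ->
  \int[leb3]_(y in cell g) F y = \int[leb3]_(y in hcell) F y.
Proof.
move=> iF; rewrite /Rintegral; congr fine.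
rewrite (negligible_integral _ _ iF cell_hcell_null).
- by rewrite setDD setIidr//; exact: hcell_sub.
- by apply: measurableD; [exact: measurable_cell|exact: measurable_hcell].
- exact: measurable_cell.
Qed.

Lemma leb3_cell : leb3 (cell g) = leb3 hcell.
Proof.
have mD : @measurable _ (mR3 R) (cell g `\` hcell).
  by apply: measurableD; [exact: measurable_cell|exact: measurable_hcell].
have := @measureU _ _ _ leb3 _ _ (measurable_hcell g) mD (setDIK _ _).
rewrite setDUK; last exact: hcell_sub.
by move=> ->; rewrite [X in (_ + X)%E]cell_hcell_null adde0.
Qed.

(** A null cell would make [cube 1] null, since unfolding its indicator expresses its volume as an
    integral over the cell. *)
Lemma leb3_hcell_gt0 : (0 < leb3 hcell)%E.
Proof.
rewrite lt0e measure_ge0 andbT; apply/eqP => h0.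
have [M MP] := sg_bounded g 1.
have m1 : measurable_fun [set: mR3 R] (\1_(cube 1) : mR3 R -> R).
  by apply: measurable_indic; exact: measurable_cube.
have mh := measurable_hcell g.
have hfin := leb3_hcell_lty g_free.
have := @unfold _ g g_free (cst 1) (\1_(cube 1)) 1 M; case=> //.
- by move=> a _; exact/aeW.
- apply: measurable_bounded_integrable => //.
  by exists 1; split=> // x x1 y _ /=; rewrite normr1 ltW.
- by move=> y; rewrite indicE; case: (_ \in _); rewrite ?normr1 ?normr0.
- move=> y; rewrite indicE; case: (boolP (y \in cube 1)); last by rewrite eqxx.
  move=> /set_mem yN _ i; have := MP y i yN; rewrite ltr_norml => /andP[/ltW -> ->].
  by [].
move=> _; rewrite /Rintegral [in RHS]null_set_integral//; last first.
  apply/measurable_EFinP/measurable_funTS; apply: measurable_funM => //.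
  apply: measurable_sum => f.
  exact: (measurableT_comp m1 (measurable_shift3 _)).
rewrite (_ : (\int[leb3]_x _)%E = leb3 (cube 1)); last first.
  under eq_integral do rewrite mul1r.
  by rewrite integral_indic// ?setIT//; exact: measurable_cube.
rewrite leb3_cube1; rewrite /= => /eqP; rewrite gt_eqF//.
Qed.

Lemma cell_volume_gt0 : 0 < cell_volume g.
Proof.
by rewrite /cell_volume leb3_cell fine_gt0// leb3_hcell_gt0 leb3_hcell_lty.
Qed.

End closed_cell.

(** * Smooth functions and test functions *)

Section flat_function.
Context {R : realType}.
Implicit Types (x : R).

(** The parameter [n] makes the family stable under differentiation, up to linear combinations. *)
Definition flat (n : nat) x : R := if 0 < x then x^-1 ^+ n * expR (- x^-1) else 0.

Lemma flat_le0 n x : x <= 0 -> flat n x = 0.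
Proof. by rewrite /flat leNgt => /negbTE ->. Qed.

Lemma flat_gt0 n x : 0 < x -> 0 < flat n x.
Proof.
by move=> x0; rewrite /flat x0 mulr_gt0 ?expR_gt0// exprn_gt0// invr_gt0.
Qed.

Lemma flat_ge0 n x : 0 <= flat n x.
Proof. by case: (ltP 0 x) => [/flat_gt0/ltW//|/flat_le0 ->]. Qed.

(** From [t^(n+2) <= (n+2)! * exp t] at [t = 1 / x]. A quadratic bound is what makes the difference
    quotient at 0 tend to 0. *)
Lemma flat_bound n x : `|flat n x| <= (n.+2)`!%:R * x ^+ 2.
Proof.
rewrite ger0_norm ?flat_ge0//; case: (ltP 0 x) => [x0|x0]; last first.
  by rewrite flat_le0// mulr_ge0 ?sqr_ge0.
rewrite /flat x0; set t := x^-1; have t0 : 0 < t by rewrite invr_gt0.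
have f0 : 0 < (n.+2)`!%:R :> R by rewrite ltr0n fact_gt0.
have h : t ^+ n.+2 <= (n.+2)`!%:R * expR t.
  rewrite mulrC -ler_pdivrMr//; apply: le_trans (expR_ge1Dxn n.+1 (ltW t0)).
  by rewrite lerDr.
rewrite expRN ler_pdivrMr ?expR_gt0//.
have -> : x ^+ 2 = t ^- 2 by rewrite /t exprVn invrK.
by rewrite mulrAC ler_pdivlMr ?exprn_gt0// -exprD addn2.
Qed.

Lemma is_derive_flat n x :
  is_derive x 1 (flat n) (flat n.+2 x - n%:R * flat n.+1 x).
Proof.
have [x0|x0|->] := ltgtP x 0.
- rewrite !flat_le0 ?(ltW x0)// mulr0 subrr.
  apply: (@near_eq_is_derive _ _ _ (cst 0)).
    by apply: filterS (lt_nbhsl x0) => y /ltW y0; rewrite flat_le0.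
- apply: (@near_eq_is_derive _ _ _ ((fun y : R => y^-1) ^+ n * (fun y => expR (- y^-1)))).
    by apply: filterS (lt_nbhsr x0) => y y0; rewrite /flat y0 !fctE.
  have xn0 : x != 0 by rewrite gt_eqF.
  have dV : is_derive x 1 (fun y : R => y^-1) (- x^-1 ^+ 2).
    apply: (is_derive_eq (@is_deriveV R id x 1 1 xn0 (is_derive_id _ _))).
    by rewrite /GRing.scale /= mulr1 exprVn.
  have dN := is_deriveN dV.
  have dE := @is_derive1_comp _ expR (fun y : R => - y^-1) x _ _ (is_derive_expR _) dN.
  have dX := is_deriveX n dV.
  apply: (is_derive_eq (is_deriveM dX dE)); rewrite /flat x0 /GRing.scale /= !fctE opprK.
  by case: n {dX} => [|n] /=; rewrite ?exprS; ring.
- rewrite !flat_le0// mulr0 subrr.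
  have H : h^-1 *: ((flat n \o shift 0) (h *: 1) - flat n 0) @[h --> (0 : R)^'] --> (0 : R).
    pose K : R := (n.+2)`!%:R; have K0 : 0 < K by rewrite ltr0n fact_gt0.
    apply/cvgr0Pnorm_lt => e e0.
    have eK : 0 < e / K by rewrite divr_gt0.
    apply: filterS (dnbhs0_lt eK) => h hK.
    rewrite /= addr0 (flat_le0 n (lexx 0)) subr0 /GRing.scale /= mulr1 normrM.
    have [->|h0] := eqVneq h 0; first by rewrite invr0 normr0 mul0r.
    rewrite normfV mulrC ltr_pdivrMr ?normr_gt0//.
    apply: le_lt_trans (flat_bound n h) _; rewrite -(real_normK (num_real h)).
    rewrite expr2 mulrA ltr_pM2r ?normr_gt0//.
    by rewrite mulrC -ltr_pdivlMr.
  by apply: DeriveDef; [apply/cvg_ex; exists 0|exact: cvg_lim].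
Qed.

End flat_function.

(** * A class of smooth functions closed under differentiation *)

Section smooth_class.
Context {R : realType}.
Implicit Types (y : R3 R) (f h : R3 R -> R).

Definition coord3 (d : R3 R) (j : 'I_3) : R := dot3 d (basis_vec j).

(** A syntactic class that holds the waves, bumps and partitions of unity used below and is stable
    under partial derivatives, so that derivatives of all orders are handled by one induction. *)
Inductive sm : (R3 R -> R) -> Prop :=
| sm_cst c : sm (fun=> c)
| sm_cos d c : sm (fun y => cos (dot3 d y + c))
| sm_flat n d c : sm (fun y => flat n (dot3 d y + c))
| sm_add f h : sm f -> sm h -> sm (f + h)
| sm_mul f h : sm f -> sm h -> sm (f * h)
| sm_inv f : (forall y, f y != 0) -> sm f -> sm (fun y => (f y)^-1).

Lemma sm_addf f h : sm f -> sm h -> sm (fun y => f y + h y).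
Proof. exact: sm_add. Qed.

Lemma sm_mulf f h : sm f -> sm h -> sm (fun y => f y * h y).
Proof. exact: sm_mul. Qed.

Lemma is_derive_line f y v df :
  is_derive (0 : R) 1 (fun r : R => f (r *: v + y)) df -> is_derive y v f df.
Proof.
have E : (fun h : R => h^-1 *: (((fun r : R => f (r *: v + y)) \o shift 0) (h *: 1) - f (0 *: v + y)))
  = (fun h : R => h^-1 *: ((f \o shift y) (h *: v) - f y)).
  by apply/funext => h /=; rewrite addr0 scale0r add0r /GRing.scale /= mulr1.
by case; rewrite /derivable /derive E => ? ?; apply: DeriveDef.
Qed.

Lemma is_derive_affine (u : R -> R) (du : R) (d : R3 R) c y j :
  is_derive (dot3 d y + c) 1 u du ->
  is_derive y (basis_vec j) (fun z => u (dot3 d z + c)) (coord3 d j * du).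
Proof.
move=> Du; apply: is_derive_line.
have E : (fun r : R => u (dot3 d (r *: basis_vec j + y) + c)) =
    u \o (fun r : R => r * coord3 d j + (dot3 d y + c)).
  apply/funext => r /=; congr (u _); rewrite /coord3 /dot3 /= /GRing.scale /=.
  by ring.
rewrite E mulrC; apply: is_derive1_comp; first by rewrite mul0r add0r.
apply: (is_derive_eq (@is_deriveD _ _ _ (fun r : R => r * coord3 d j) (cst (dot3 d y + c)) 0 1 _ _
  (@is_deriveM _ _ id (cst (coord3 d j)) 0 1 _ _ (is_derive_id _ _) (is_derive_cst _ _ _))
  (is_derive_cst _ _ _))).
by rewrite /GRing.scale /= mul0r add0r addr0 mulr1.
Qed.

Lemma flat_continuous n : continuous (@flat R n).
Proof.
move=> x; apply: differentiable_continuous; apply/derivable1_diffP.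
by case: (is_derive_flat n x).
Qed.

Lemma sm_continuous f : sm f -> continuous f.
Proof.
have aff d c : continuous (fun y : R3 R => dot3 d y + c).
  by move=> y; apply: cvgD; [exact: dot3_continuous|exact: cvg_cst].
elim=> {f} [c|d c|n d c|f h _ cf _ ch|f h _ cf _ ch|f f0 _ cf] y.
- exact: cvg_cst.
- exact: (cvg_comp _ _ (aff d c y) (@continuous_cos R _)).
- exact: (cvg_comp _ _ (aff d c y) (@flat_continuous n _)).
- by apply: cvgD; [exact: cf|exact: ch].
- by apply: cvgM; [exact: cf|exact: ch].
- by apply: cvgV; [exact: f0|exact: cf].
Qed.

Lemma sm_partial f : sm f ->
  (forall j y, derivable f y (basis_vec j)) /\ forall j, sm (partial j f).
Proof.
elim=> {f} [c|d c|n d c|f h sf [df pf] sh [dh ph]|f h sf [df pf] sh [dh ph]|f f0 sf [df pf]].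
- split=> [j y|j]; first exact: derivable_cst.
  rewrite (_ : partial j _ = fun=> 0); first exact: sm_cst.
  by apply/funext => y; rewrite /partial derive_cst.
- have D j y := is_derive_affine j (is_derive_cos (dot3 d y + c)).
  split=> [j y|j]; first by case: (D j y).
  rewrite (_ : partial j _ = (fun=> coord3 d j) * (fun y => cos (dot3 d y + (c + pi / 2)))).
    by apply: sm_mul; [exact: sm_cst|exact: sm_cos].
  apply/funext => y; rewrite /partial fctE addrA cosDpihalf.
  by case: (D j y) => _ ->.
- have D j y := is_derive_affine j (is_derive_flat n (dot3 d y + c)).
  split=> [j y|j]; first by case: (D j y).
  rewrite (_ : partial j _ = (fun=> coord3 d j) * ((fun y => flat n.+2 (dot3 d y + c)) +
    (fun=> - n%:R) * (fun y => flat n.+1 (dot3 d y + c)))).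
    by do ?[apply: sm_mul|apply: sm_add]; do ?[exact: sm_cst|exact: sm_flat].
  apply/funext => y; rewrite /partial !fctE mulNr.
  by case: (D j y) => _ ->.
- split=> [j y|j]; first exact: derivableD.
  rewrite (_ : partial j _ = partial j f + partial j h); first exact: sm_add.
  by apply/funext => y; rewrite /partial deriveD.
- split=> [j y|j]; first exact: derivableM.
  rewrite (_ : partial j _ = f * partial j h + h * partial j f).
    by apply: sm_add; apply: sm_mul.
  by apply/funext => y; rewrite /partial deriveM.
- split=> [j y|j]; first exact: derivableV.
  rewrite (_ : partial j _ = (fun=> -1) * ((fun y => (f y)^-1) * (fun y => (f y)^-1) * partial j f)).
    by do ?[apply: sm_mul|exact: sm_inv]; [exact: sm_cst|].
  apply/funext => y; rewrite /partial deriveV// !fctE /GRing.scale /=.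
  by rewrite mulN1r -mulNr -expr2 exprVn.
Qed.

Lemma sm_smooth f : sm f -> smooth f.
Proof.
move=> sf s; have : sm (partials s f).
  by elim: s => //= j s /sm_partial[_]; exact.
by move=> sp; split; [exact: sm_continuous|exact: (proj1 (sm_partial sp))].
Qed.

Lemma sm_test f N : sm f -> (forall y, f y != 0 -> cube N y) -> test_fun f.
Proof.
move=> sf fN; split; first exact: sm_smooth.
have cN := @compact_cube R N.
have clN : closed (cube N : set (R3 R)) by apply: compact_closed => //; exact: norm_hausdorff.
apply: (subclosed_compact _ cN); first exact: closed_closure.
rewrite [X in _ `<=` X](proj1 (closure_id _) clN).
by apply: closureS => y /fN.
Qed.

End smooth_class.

Lemma Rdominated_cvg d (T : measurableType d) (R : realType)
    (mu : {measure set T -> \bar R}) (D : set T) (F : nat -> T -> R) (f h : T -> R) :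
  measurable D -> (forall n, measurable_fun D (F n)) -> measurable_fun D f ->
  (forall x, D x -> F ^~ x @ \oo --> f x) ->
  mu.-integrable D (EFin \o h) -> (forall n x, D x -> `|F n x| <= h x) ->
  (fun n => \int[mu]_(x in D) F n x) @ \oo --> \int[mu]_(x in D) f x.
Proof.
move=> mD mF mf Ff ih Fh.
have iF n : mu.-integrable D (EFin \o F n).
  by apply: (integrable_le mD (mF n) _ ih) => x Dx; exact: Fh.
have mFE n : measurable_fun D (EFin \o F n) by exact/measurable_EFinP.
have mfE : measurable_fun D (EFin \o f) by exact/measurable_EFinP.
have cE : {ae mu, forall x, D x -> (fun n => (F n x)%:E) @ \oo --> (f x)%:E}.
  by apply: aeW => x Dx; apply: cvg_EFin; [exact: nearW|exact: Ff].
have bE : {ae mu, forall x, forall n, D x -> (`|(F n x)%:E| <= (h x)%:E)%E}.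
  by apply: aeW => x n Dx; rewrite lee_fin; exact: Fh.
have [if_ _] := dominated_convergence mD mFE mfE cE ih bE.
rewrite -[X in _ --> X -> _]fineK; last exact: integrable_fin_num.
by move=> /fine_cvgP[].
Qed.

(** * Integration by parts against test functions *)

Section test_functions.
Context {R : realType}.
Implicit Types (y : R3 R) (w f psi : R3 R -> R).

Lemma cube_bounded f N : continuous f -> (forall y, f y != 0 -> cube N y) ->
  exists B, forall y, `|f y| <= B.
Proof.
move=> cf fN.
have : compact (f @` (cube N : set (R3 R))).
  by apply: continuous_compact; [exact: continuous_subspaceT|exact: compact_cube].
move=> /compact_bounded[M [_ MP]]; exists (Num.max 0 (M + 1)) => y.
have [->|fy] := eqVneq (f y) 0; first by rewrite normr0 le_max lexx.
rewrite le_max; apply/orP; right; apply: (MP (M + 1)); first by rewrite ltrDl.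
by exists y => //; exact: fN.
Qed.

(** The complement of the closed support is open, so the partial derivatives vanish there together
    with [psi]. *)
Lemma test_fun_cube psi : test_fun psi -> exists N, 0 <= N /\
  forall y, ~ cube N y -> psi y = 0 /\ forall j, partial j psi y = 0.
Proof.
move=> [_ /compact_sub_cube[N NP]]; exists `|N|; split=> // y ny.
have ncl : ~ closure [set y | psi y != 0] y.
  move=> /NP[h1 h2 h3]; apply: ny.
  by split; apply: (le_trans _ (ler_norm N)).
have near0 : \forall z \near y, psi z = 0.
  have : open (~` closure [set y | psi y != 0]).
    by apply: closed_openC; exact: closed_closure.
  move=> h.
  apply: filterS (open_nbhs_nbhs (conj h ncl)) => z nz.
  by apply/eqP; apply: contrapT => /negP pz; apply: nz; exact: subset_closure.
split=> [|j]; first exact: nbhs_singleton near0.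
rewrite /partial (near_eq_derive _ (g := cst 0)) ?derive_cst//.
Qed.

Lemma is_derive_along w y v r : (forall z, derivable w z v) ->
  is_derive (r : R) 1 (fun t : R => w (t *: v + y)) ('D_v w (r *: v + y)).
Proof.
move=> dw.
have E : (fun h : R => h^-1 *: (((fun t : R => w (t *: v + y)) \o shift r) (h *: 1) - w (r *: v + y)))
  = (fun h : R => h^-1 *: ((w \o shift (r *: v + y)) (h *: v) - w (r *: v + y))).
  apply/funext => h /=; congr (_ *: (w _ - _)).
  by rewrite scalerDl /GRing.scale /= mulr1 addrA.
by apply: DeriveDef; rewrite /derivable /derive E//; exact: dw.
Qed.

Lemma cube_shift_basis N (r : R) y j : 0 <= r <= 1 ->
  cube N (r *: basis_vec j + y : R3 R) -> cube (N + 1) y.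
Proof.
move=> r01 [/= h1 h2 h3].
have key (b : bool) (u : R) : `|r * b%:R + u| <= N -> `|u| <= N + 1.
  by case: b; rewrite ?mulr1 ?mulr0 ?add0r !ler_norml; lra.
by split; [apply: key h1|apply: key h2|apply: key h3].
Qed.

(** By translation invariance the difference quotients integrate to 0. The mean value theorem
    dominates them by a multiple of the indicator of a larger cube, and dominated convergence passes
    to the derivative; no iterated integral is involved. *)
Lemma Rintegral_partial_eq0 w N j : continuous w -> 
  (forall y, derivable w y (basis_vec j)) -> continuous (partial j w) ->
  (forall y, ~ cube N y -> w y = 0 /\ partial j w y = 0) ->
  \int[leb3]_y partial j w y = 0.
Proof.
move=> cw dw cdw wN.
have wN' y : w y != 0 -> cube N y.
  by move=> h; apply: contrapT => /wN[/eqP]; rewrite (negbTE h).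
have dwN' y : partial j w y != 0 -> cube N y.
  by move=> h; apply: contrapT => /wN[_ /eqP]; rewrite (negbTE h).
have [M MP] := cube_bounded cdw dwN'; have [B BP] := cube_bounded cw wN'.
have M0 : 0 <= M by exact: le_trans (MP 0).
have mw := continuous_measurable3 cw; have mdw := continuous_measurable3 cdw.
pose t n : R := n.+1%:R^-1.
have t01 n : 0 <= t n <= 1 by rewrite invr_ge0 ler0n invf_le1 ?ltr0n// ler1n.
have t0 n : 0 < t n by rewrite invr_gt0 ltr0n.
pose F n y := (t n)^-1 * (w (t n *: basis_vec j + y) - w y).
have mws n : measurable_fun [set: mR3 R] (fun y : R3 R => w (t n *: basis_vec j + y)).
  under eq_fun do rewrite addrC.
  exact: (measurableT_comp mw (measurable_shift3 _)).
have mF n : measurable_fun [set: mR3 R] (F n).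
  by apply: measurable_funM => //; exact: measurable_funB.
have iw : leb3.-integrable [set: mR3 R] (EFin \o w).
  have := @measurable_bounded_integrable _ _ _ leb3 w (cube N) (measurable_cube N)
    (leb3_cube_lty N) (measurable_funTS mw).
  have bw : [bounded w x | x in cube N].
    by exists B; split; [rewrite num_real|move=> x /ltW Bx y _; exact: le_trans (BP y) Bx].
  move=> /(_ bw) /(integrable_indicP leb3 w (measurable_cube N)).
  congr (_.-integrable _ _); apply/funext => y /=; congr (_%:E).
  rewrite indicE; have [->|/wN' wy] := eqVneq (w y) 0; first by rewrite mul0r.
  by rewrite mem_set// mulr1.
have F0 n : \int[leb3]_y F n y = 0.
  have iws : leb3.-integrable [set: mR3 R] (EFin \o (fun y : R3 R => w (t n *: basis_vec j + y))).
    have := integrable3_shift (t n *: basis_vec j) iw.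
    by congr (_.-integrable _ _); apply/funext => y /=; rewrite /shift3 addrC.
  rewrite RintegralZl//; last first.
    by have := integrableB measurableT iws iw.
  rewrite RintegralB// [X in X - _](_ : _ = \int[leb3]_y w y) ?subrr ?mulr0//.
  rewrite -(Rintegral3_shift (t n *: basis_vec j) mw).
  by apply: eq_Rintegral => y _; rewrite /shift3 addrC.
(* Increments of length [t n <= 1] enlarge the support by at most 1, hence [cube (N + 1)]. *)
have Fbound n y : `|F n y| <= M * \1_(cube (N + 1)) y.
  have cl : {within `[0, t n], continuous (fun r : R => w (r *: basis_vec j + y))}.
    apply: continuous_subspaceT => r; apply: differentiable_continuous.
    by apply/derivable1_diffP; case: (is_derive_along y r dw).
  have [c cI] := @MVT R _ (fun r : R => partial j w (r *: basis_vec j + y)) 0 (t n)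
      (t0 n) (fun r _ => is_derive_along y r dw) cl.
  rewrite scale0r add0r subr0 /F => ->.
  rewrite mulrC mulfK ?gt_eqF//.
  have [->|cy] := eqVneq (partial j w (c *: basis_vec j + y)) 0.
    by rewrite normr0 mulr_ge0// indicE.
  rewrite indicE mem_set ?mulr1//; apply: (@cube_shift_basis _ c y j).
    move: cI; rewrite in_itv/= => /andP[/ltW -> /ltW /le_trans]; apply.
    by case/andP: (t01 n).
  exact: dwN'.
have tc : t @ \oo --> (0 : R)^'.
  move=> P /= [e /= e0 eP]; have := @cvg_harmonic R.
  move/cvgrPdist_lt => /(_ e e0); apply: filterS => n; rewrite sub0r normrN => ne.
  by apply: eP; [rewrite /= sub0r normrN|rewrite gt_eqF].
have Fcvg y : F ^~ y @ \oo --> partial j w y.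
  have : h^-1 *: ((w \o shift y) (h *: basis_vec j) - w y) @[h --> (0 : R)^'] --> partial j w y.
    exact: dw.
  by move=> /(cvg_comp _ _ tc).
have ig : leb3.-integrable [set: mR3 R] (EFin \o (fun y => M * \1_(cube (N + 1)) y)).
  apply: integrableZ_fun => //; apply/integrableP; split.
    by apply/measurable_EFinP; apply: measurable_indic; exact: measurable_cube.
  under eq_integral do rewrite gee0_abs ?lee_fin//.
  by rewrite integral_indic// ?setIT; [exact: leb3_cube_lty|exact: measurable_cube].
have := Rdominated_cvg measurableT mF mdw (fun y _ => Fcvg y) ig (fun n y _ => Fbound n y).
rewrite (_ : (fun n => _) = fun=> 0); last exact/funext.
by move=> /(cvg_unique _ (cvg_cst 0)) => <-.
Qed.

Lemma test_fun_bounded psi : test_fun psi -> exists B, forall y, `|psi y| <= B.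
Proof.
move=> tp; have [N [_ NP]] := test_fun_cube tp; have [sp _] := tp.
apply: (@cube_bounded _ N); first exact: (proj1 (sp [::])).
by move=> y py; apply: contrapT => /NP[p0]; rewrite p0 eqxx in py.
Qed.

Lemma test_fun_partial_bounded psi j : test_fun psi ->
  exists B, forall y, `|partial j psi y| <= B.
Proof.
move=> tp; have [N [_ NP]] := test_fun_cube tp; have [sp _] := tp.
apply: (@cube_bounded _ N); first exact: (proj1 (sp [:: j])).
by move=> y py; apply: contrapT => /NP[_ p0]; rewrite p0 eqxx in py.
Qed.

Lemma test_fun_measurable psi : test_fun psi -> measurable_fun [set: mR3 R] psi.
Proof. by move=> [sp _]; apply: continuous_measurable3; exact: (proj1 (sp [::])). Qed.

Lemma test_fun_partial_measurable psi j : test_fun psi ->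
  measurable_fun [set: mR3 R] (partial j psi).
Proof. by move=> [sp _]; apply: continuous_measurable3; exact: (proj1 (sp [:: j])). Qed.

Lemma integrable_cube f N B : measurable_fun [set: mR3 R] f ->
  (forall y, `|f y| <= B) -> (forall y, ~ cube N y -> f y = 0) ->
  leb3.-integrable [set: mR3 R] (EFin \o f).
Proof.
move=> mf fB f0.
have bf : [bounded f x | x in (cube N : set (mR3 R))].
  by exists B; split; [rewrite num_real|move=> x /ltW Bx y _; exact: le_trans (fB y) Bx].
have := @measurable_bounded_integrable _ _ _ leb3 f (cube N) (measurable_cube N)
  (leb3_cube_lty N) (measurable_funTS mf) bf.
move=> /(integrable_indicP leb3 f (measurable_cube N)).
congr (_.-integrable _ _); apply/funext => y /=; congr (_%:E).
rewrite indicE; case: (pselect (cube N y)) => [cy|/f0 ->]; last by rewrite mul0r.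
by rewrite mem_set// mulr1.
Qed.

Lemma integration_by_parts_test psi u j : test_fun psi -> sm u ->
  \int[leb3]_y (partial j psi y * u y) = - \int[leb3]_y (psi y * partial j u y).
Proof.
move=> tp su; have [N [_ NP]] := test_fun_cube tp; have [sp _] := tp.
have [cp dp] := sp [::]; have [cdp _] := sp [:: j].
have cu := sm_continuous su; have [du sdu] := sm_partial su.
have cdu := sm_continuous (sdu j).
have E : partial j (psi * u) = partial j psi * u + psi * partial j u.
  apply/funext => y; rewrite /partial deriveM; [|exact: dp|exact: du].
  by rewrite addrC !fctE /GRing.scale /= mulrC.
have cE (f1 f2 : R3 R -> R) : continuous f1 -> continuous f2 -> continuous (f1 * f2).
  by move=> c1 c2 y; apply: cvgM; [exact: c1|exact: c2].
have c1 := cE _ _ cdp cu; have c2 := cE _ _ cp cdu.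
have int (f1 f2 : R3 R -> R) : continuous (f1 * f2) -> (forall y, ~ cube N y -> f1 y = 0) ->
    leb3.-integrable [set: mR3 R] (EFin \o (fun y => f1 y * f2 y)).
  move=> c12 f10; have z y : ~ cube N y -> f1 y * f2 y = 0 by move=> /f10 ->; rewrite mul0r.
  have [|B BP] := @cube_bounded (f1 * f2) N c12.
    by move=> y; apply: contra_neqP => /z.
  exact: integrable_cube (continuous_measurable3 c12) BP z.
have i1 := int _ _ c1 (fun y ny => (NP y ny).2 j).
have i2 := int _ _ c2 (fun y ny => (NP y ny).1).
apply/eqP; rewrite -addr_eq0 -RintegralD//; apply/eqP.
rewrite -[RHS](@Rintegral_partial_eq0 (psi * u) N j).
- by rewrite E.
- by apply: cE => //; exact: cp.
- by move=> y; apply: derivableM; [exact: dp|exact: du].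
- by rewrite E => y; apply: cvgD; [exact: c1|exact: c2].
- move=> y ny; have [p0 dp0] := NP y ny; rewrite E !fctE p0 dp0.
  by rewrite !mul0r addr0.
Qed.

End test_functions.

(** * The du Bois-Reymond lemma *)

Section du_bois_reymond.
Context {R : realType}.
Implicit Types (y : R3 R) (f : mR3 R -> R).

(** One upper bound [b] serves the three coordinates: the boxes to be reached are orthants truncated
    by a fixed cube. *)
Definition bump (a1 a2 a3 b : R) y : R :=
  flat 0 (y.1.1 - a1) * flat 0 (y.1.2 - a2) * flat 0 (y.2 - a3) *
  (flat 0 (b - y.1.1) * flat 0 (b - y.1.2) * flat 0 (b - y.2)).

Lemma sm_bump a1 a2 a3 b : sm (bump a1 a2 a3 b).
Proof.
have e (d : R3 R) (c : R) (u : R3 R -> R) : (forall y, u y = dot3 d y + c) ->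
    sm (fun y => flat 0 (u y)).
  move=> ue; rewrite (_ : (fun y => _) = fun y => flat 0 (dot3 d y + c)).
    exact: sm_flat.
  by apply/funext => y; rewrite ue.
apply: (@sm_mul _ (fun y => flat 0 (y.1.1 - a1) * flat 0 (y.1.2 - a2) * flat 0 (y.2 - a3))
  (fun y => flat 0 (b - y.1.1) * flat 0 (b - y.1.2) * flat 0 (b - y.2))).
- apply: (@sm_mul _ (fun y => flat 0 (y.1.1 - a1) * flat 0 (y.1.2 - a2)) (fun y => flat 0 (y.2 - a3))).
    apply: (@sm_mul _ (fun y => flat 0 (y.1.1 - a1)) (fun y => flat 0 (y.1.2 - a2))).
    + by apply: (e (1, 0, 0) (- a1)) => y; rewrite /dot3 /=; ring.
    + by apply: (e (0, 1, 0) (- a2)) => y; rewrite /dot3 /=; ring.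
  by apply: (e (0, 0, 1) (- a3)) => y; rewrite /dot3 /=; ring.
- apply: (@sm_mul _ (fun y => flat 0 (b - y.1.1) * flat 0 (b - y.1.2)) (fun y => flat 0 (b - y.2))).
    apply: (@sm_mul _ (fun y => flat 0 (b - y.1.1)) (fun y => flat 0 (b - y.1.2))).
    + by apply: (e (- 1, 0, 0) b) => y; rewrite /dot3 /=; ring.
    + by apply: (e (0, - 1, 0) b) => y; rewrite /dot3 /=; ring.
  by apply: (e (0, 0, - 1) b) => y; rewrite /dot3 /=; ring.
Qed.

Lemma flat0_le1 (x : R) : flat 0 x <= 1.
Proof.
case: (ltP 0 x) => [x0|/flat_le0 ->//]; rewrite /flat x0 expr0 mul1r.
by rewrite -(expR0 R) ler_expR oppr_le0 invr_ge0 ltW.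
Qed.

Lemma bump01 a1 a2 a3 b y : 0 <= bump a1 a2 a3 b y <= 1.
Proof.
have h (x : R) : 0 <= flat 0 x <= 1 by rewrite flat_ge0 flat0_le1.
have m (u v : R) : 0 <= u <= 1 -> 0 <= v <= 1 -> 0 <= u * v <= 1.
  by move=> /andP[? ?] /andP[? ?]; rewrite mulr_ge0// mulr_ile1.
by apply: (m _ _ (m _ _ (m _ _ (h _) (h _)) (h _)) (m _ _ (m _ _ (h _) (h _)) (h _))).
Qed.

Definition obox (a1 a2 a3 b : R) : set (mR3 R) :=
  [set y | [/\ a1 < y.1.1 < b, a2 < y.1.2 < b & a3 < y.2 < b]].

Lemma bump_gt0 a1 a2 a3 b y : obox a1 a2 a3 b y -> 0 < bump a1 a2 a3 b y.
Proof.
move=> [/andP[? ?] /andP[? ?] /andP[? ?]].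
by rewrite /bump; do ?apply: mulr_gt0; apply: flat_gt0; rewrite subr_gt0.
Qed.

Lemma bump_eq0 a1 a2 a3 b y : ~ obox a1 a2 a3 b y -> bump a1 a2 a3 b y = 0.
Proof.
move=> ny; apply/eqP/negPn/negP => b0; apply: ny.
have h (x : R) : flat 0 x != 0 -> 0 < x.
  by move=> f0; rewrite ltNge; apply: contra f0 => /flat_le0 ->.
move: b0; rewrite /bump !mulf_eq0 !negb_or.
move=> /andP[/andP[/andP[h1 h2] h3] /andP[/andP[h4 h5] h6]].
by split; apply/andP; split; rewrite -subr_gt0; exact: h.
Qed.

Lemma measurable_obox a1 a2 a3 b : measurable (obox a1 a2 a3 b).
Proof.
have -> : obox a1 a2 a3 b = (`]a1, b[ `*` `]a2, b[ `*` `]a3, b[)%classic.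
  by apply/seteqP; split=> y; rewrite /obox /= !in_itv/=; [case|case=> [[]]].
by do 2?apply: measurableX => //; exact: measurable_itv.
Qed.

Lemma sm_exp (u : R3 R -> R) n : sm u -> sm (fun y => u y ^+ n).
Proof.
move=> su; elim: n => [|n IH]; first exact: sm_cst.
rewrite (_ : (fun y => _) = u * (fun y => u y ^+ n)); first exact: sm_mul.
by apply/funext => y; rewrite exprS.
Qed.

(** With [b] a bump in [0, 1] positive exactly on a box, the test functions [1 - (1 - b)^n] increase
    to the indicator of the box. So [f] has zero integral over all truncated orthants, which
    generate the Borel sets. *)
Lemma du_bois_reymond f : L2loc f ->
  (forall psi, test_fun psi -> \int[leb3]_y (f y * psi y) = 0) ->
  {ae leb3, forall y, f y = 0}.
Proof.
move=> [mf f2] ft.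
have icube N : leb3.-integrable (cube N) (EFin \o f).
  have mc := measurable_cube N.
  apply: (@integrable_le _ _ R leb3 _ mc f (fun y => 1 + f y ^+ 2)).
  - exact: measurable_funTS.
  - by move=> y _; rewrite ler_norml; have := sqr_ge0 (f y - 1); have := sqr_ge0 (f y + 1); nra.
  - apply: integrableD_fun => //; last by apply: f2; exact: compact_cube.
    apply: measurable_bounded_integrable => //; first exact: leb3_cube_lty.
    by exists 1; split=> // x x1 y _ /=; rewrite normr1 ltW.
have key a1 a2 a3 N : - N <= a1 -> - N <= a2 -> - N <= a3 ->
    (\int[leb3]_(y in obox a1 a2 a3 N) (f y)%:E = 0)%E.
  move=> h1 h2 h3; set B := obox a1 a2 a3 N.
  have mB : measurable B by exact: measurable_obox.
  have BN : B `<=` cube N.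
    move=> y [/andP[? ?] /andP[? ?] /andP[? ?]].
    by split; rewrite ler_norml; lra.
  pose b := bump a1 a2 a3 N.
  pose psi n y := 1 - (1 - b y) ^+ n.
  have psi0 n y : ~ B y -> psi n y = 0.
    by move=> /bump_eq0 b0; rewrite /psi /b b0 subr0 expr1n subrr.
  have psit n : test_fun (psi n).
    apply: (@sm_test _ _ N); last first.
      by move=> y; apply: contra_neqP => nB; apply: psi0 => By; exact/nB/BN.
    rewrite (_ : psi n = (fun=> 1) + (fun=> -1) * (fun y => (((fun=> 1) + (fun=> -1) * b) y) ^+ n)).
      apply: sm_add; first exact: sm_cst.
      apply: sm_mul; first exact: sm_cst.
      apply: sm_exp; apply: sm_add; first exact: sm_cst.
      by apply: sm_mul; [exact: sm_cst|exact: sm_bump].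
    by apply/funext => y; rewrite !fctE /psi !mulN1r.
  have iB : leb3.-integrable B (EFin \o f).
    exact: (integrableS (measurable_cube N)).
  have R0 : \int[leb3]_(y in B) f y = 0.
    have z n : \int[leb3]_(y in B) (f y * psi n y) = 0.
      rewrite -[RHS](ft _ (psit n)) Rintegral_indic_cond; apply: eq_Rintegral => y _.
      rewrite indicE; case: (pselect (B y)) => [By|nB]; first by rewrite mem_set ?mulr1.
      by rewrite psi0// mulr0 mul0r.
    suff : (fun n => \int[leb3]_(y in B) (f y * psi n y)) @ \oo --> \int[leb3]_(y in B) f y.
      by under eq_fun do rewrite z; move=> /(cvg_unique _ (cvg_cst 0)) => <-.
    apply: (@Rdominated_cvg _ _ R leb3 B (fun n y => f y * psi n y) f (fun y => `|f y|) mB).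
    - move=> n; apply: measurable_funTS; apply: measurable_funM => //.
      exact: test_fun_measurable.
    - exact: measurable_funTS.
    - move=> y By; rewrite -[X in _ --> X]mulr1; apply: cvgM; first exact: cvg_cst.
      rewrite -[X in _ --> X]subr0; apply: cvgB; first exact: cvg_cst.
      apply: cvg_expr; have /andP[_ b1] : 0 <= b y <= 1 := bump01 a1 a2 a3 N y.
      by have := bump_gt0 By; rewrite -/(b y) => b0; rewrite ger0_norm; lra.
    - exact: integrable_norm.
    - move=> n y _; rewrite normrM ler_piMr//.
      have /andP[b0 b1] : 0 <= b y <= 1 := bump01 a1 a2 a3 N y.
      have c0 : 0 <= 1 - b y by lra.
      have c1 : 1 - b y <= 1 by lra.
      have := exprn_ge0 n c0; have := exprn_ile1 n c0 c1.
      by rewrite ler_norml /psi; lra.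
  rewrite -[LHS]fineK; last exact: integrable_fin_num.
  by congr (_%:E).
have aeN n : ae_eq leb3 (obox (- n%:R) (- n%:R) (- n%:R) n%:R) (EFin \o f) (cst 0%E).
  apply: (@ae_eq0_rays3 _ _ R leb3 _ _ (fun y => y.1.1) (fun y => y.1.2) (fun y => y.2)
    id (- n%:R)).
  - exact: measurable_obox.
  - apply: (integrableS (measurable_cube n%:R)); [exact: measurable_obox| |exact: icube].
    move=> y [/andP[? ?] /andP[? ?] /andP[? ?]].
    by split; rewrite ler_norml; lra.
  - exact: (measurableT_comp measurable_fst measurable_fst).
  - exact: (measurableT_comp measurable_snd measurable_fst).
  - exact: measurable_snd.
  - by [].
  - by case=> [[]].
  - by move=> y [/andP[-> _] /andP[-> _] /andP[-> _]].
  - move=> x1 x2 x3.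
    (* Raising the corner to at least [- n] in each coordinate turns the truncated orthant into one
       of the boxes of [key]. *)
    rewrite -[RHS](key (Num.max x1 (- n%:R)) (Num.max x2 (- n%:R)) (Num.max x3 (- n%:R)) n%:R);
      last by rewrite !le_max !lexx !orbT.
    + congr (integral _ _ _); apply/seteqP; split=> y.
        move=> [[/andP[? ?] /andP[? ?] /andP[? ?]] [? ? ?]].
        by split; rewrite gt_max; do ?[apply/andP; split].
      case; rewrite !gt_max => /andP[/andP[? ?] ?] /andP[/andP[? ?] ?] /andP[/andP[? ?] ?].
      by do 2?split; do ?[apply/andP; split].
    + by rewrite !le_max !lexx !orbT.
    + by rewrite !le_max !lexx !orbT.
have : leb3.-negligible (\bigcup_n (~` [set y | obox (- n%:R) (- n%:R) (- n%:R) n%:R y -> f y = 0])).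
  apply: negligible_bigcup => n; have [M [mM M0 MP]] := aeN n; exists M; split=> //.
  by move=> y /= h; apply: MP => /= h2; apply: h => /h2 /= [].
move=> [M [mM M0 MP]]; exists M; split=> // y /= fy; apply: MP.
pose r := `|y.1.1| + `|y.1.2| + `|y.2|; exists (Num.truncn r).+1 => //= h; apply: fy; apply: h.
have := truncnS_gt r; rewrite /r => hr.
have := normr_ge0 y.1.1; have := normr_ge0 y.1.2; have := normr_ge0 y.2 => ? ? ?.
by split; rewrite -ltr_norml; lra.
Qed.

End du_bois_reymond.

(** * A lattice partition of unity *)

Section partition_of_unity.
Context {R : realType}.
Implicit Types (x : R).

Definition step x : R := flat 0 x / (flat 0 x + flat 0 (1 - x)).

Lemma step_den x : flat 0 x + flat 0 (1 - x) != 0.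
Proof.
rewrite gt_eqF//; case: (ltP 0 x) => x0.
  by rewrite ltr_pwDl ?flat_ge0 ?flat_gt0.
by rewrite ltr_wpDl ?flat_ge0 ?flat_gt0//; lra.
Qed.

Lemma step_le0 x : x <= 0 -> step x = 0.
Proof. by move=> x0; rewrite /step flat_le0// mul0r. Qed.

Lemma step_ge1 x : 1 <= x -> step x = 1.
Proof.
move=> x1; have := step_den x; rewrite /step (@flat_le0 _ 0 (1 - x)); last by lra.
by rewrite addr0 => h; rewrite divff.
Qed.

(** A difference of two steps one unit apart, so that sums over integer translates telescope to
    1. *)
Definition chi1 x : R := step (x + 1) - step x.

Lemma chi1_supp x : chi1 x != 0 -> - 1 < x < 1.
Proof.
move=> h; apply/andP; split; rewrite ltNge; apply: contra h => hx.
  by rewrite /chi1 !step_le0 ?subrr//; lra.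
by rewrite /chi1 !step_ge1 ?subrr//; lra.
Qed.

Lemma chi1_sum (M : nat) x : 1 - M%:R <= x <= M%:R ->
  \sum_(j < M + M) chi1 (x + (j%:Z - M%:Z)%:~R) = 1.
Proof.
move=> /andP[x1 x2]; pose F (j : nat) := step (x + (j%:Z - M%:Z)%:~R).
rewrite (eq_bigr (fun j : 'I_(M + M) => F j.+1 - F j)); last first.
  move=> j _; rewrite /chi1 /F -addrA; congr (step (_ + _) - _).
  by rewrite -[1 in LHS]/(1%:~R) -intrD; congr (_%:~R); lia.
rewrite -(big_mkord xpredT (fun j => F j.+1 - F j)) telescope_sumr// /F.
(* The sum has telescoped to [step (x + M) - step (x - M)]; the hypothesis puts the first argument
   at or above 1 and the second at or below 0. *)
rewrite step_ge1; last first.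
  by rewrite (_ : (M + M)%N%:Z - M%:Z = M%:Z); [rewrite -pmulrn; lra|lia].
rewrite step_le0 ?subr0//.
by rewrite (_ : 0%:Z - M%:Z = - M%:Z); [rewrite mulrNz -pmulrn; lra|lia].
Qed.

Lemma sm_step (d : R3 R) c : sm (fun y => step (dot3 d y + c)).
Proof.
have s1 := sm_flat 0 d c; have s2 := sm_flat 0 (- d) (1 - c).
have e y : dot3 (- d) y + (1 - c) = 1 - (dot3 d y + c) by rewrite /dot3 /=; ring.
have s3 := sm_addf s1 s2.
rewrite (_ : (fun y => _) = (fun y => flat 0 (dot3 d y + c) *
  (flat 0 (dot3 d y + c) + flat 0 (dot3 (- d) y + (1 - c)))^-1)).
  by apply: (sm_mulf s1); apply: (sm_inv _ s3) => y; rewrite e; exact: step_den.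
by apply/funext => y; rewrite e.
Qed.

Context (g : 'I_3 -> R3 R) (g_free : free [tuple g i | i < 3]).
Local Notation sg := (sg g).
Local Notation lat := (lat g).
Local Notation hcell := (hcell g).
Local Notation per := (Pilot.Defs.periodic g).

Definition chi (y : R3 R) : R := \prod_i chi1 (sg i y).

Lemma sm_prod (I : Type) (s : seq I) (F : I -> R3 R -> R) :
  (forall i, sm (F i)) -> sm (fun y => \prod_(i <- s) F i y).
Proof.
move=> sF; elim: s => [|i s IH].
  by rewrite (_ : (fun y => _) = fun=> 1); [exact: sm_cst|apply/funext => y; rewrite big_nil].
rewrite (_ : (fun y => _) = F i * (fun y => \prod_(i <- s) F i y)); first exact: sm_mul.
by apply/funext => y; rewrite big_cons.
Qed.

Lemma sm_chi : sm chi.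
Proof.
apply: sm_prod => i.
rewrite (_ : (fun y => _) = (fun y => step (dot3 (dual g i) y + 1)) +
   (fun=> -1) * (fun y => step (dot3 (dual g i) y + 0))).
  apply: sm_add; first exact: sm_step.
  by apply: sm_mul; [exact: sm_cst|exact: sm_step].
by apply/funext => y; rewrite !fctE -sgE// addr0 mulN1r.
Qed.

Lemma chi_supp y : chi y != 0 -> forall i, - 1 < sg i y < 1.
Proof. by move=> /prodf_neq0 h i; exact: chi1_supp (h i isT). Qed.

Lemma chi_sum (M : nat) y : (forall i, 1 - M%:R <= sg i y <= M%:R) ->
  \sum_(f : {ffun 'I_3 -> 'I_(M + M)}) chi (y + lat (window f)) = 1.
Proof.
move=> yM; under eq_bigr => f _.
  rewrite /chi; under eq_bigr do rewrite sgD sg_lat// /window. over.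
rewrite -(bigA_distr_bigA (fun i (j : 'I_(M + M)) => chi1 (sg i y + (j%:Z - M%:Z)%:~R))) /=.
by rewrite big1// => i _; exact: chi1_sum.
Qed.

Lemma test_chi_mul u : sm u -> test_fun (chi * u).
Proof.
move=> su; have [N NP] := cube_sg g_free 1.
apply: (@sm_test _ _ N); first by apply: sm_mul => //; exact: sm_chi.
move=> y; rewrite mulf_eq0 negb_or => /andP[/chi_supp h _]; apply: NP => i.
by have := h i; rewrite ler_norml => /andP[/ltW -> /ltW ->].
Qed.

(** Exact invariance at every point, unlike the a.e. notion [periodic]: pointwise differentiation
    preserves it. *)
Definition lat_periodic (u : R3 R -> R) := forall y n, u (y + lat n) = u y.

Lemma partial_shift j (u : R3 R -> R) a y :
  partial j (fun z => u (z + a)) y = partial j u (y + a).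
Proof.
rewrite /partial /derive.
have -> // : (fun z : R3 R => u (z + a)) \o shift y = u \o shift (y + a).
by apply/funext => z /=; rewrite addrA.
Qed.

Lemma lat_periodic_partial j u : lat_periodic u -> lat_periodic (partial j u).
Proof.
move=> pu y n; have E := partial_shift j u (lat n) y.
have uE : (fun z => u (z + lat n)) = u by apply/funext => z; exact: pu.
by rewrite uE in E.
Qed.

Lemma derivable_big_sum (I : Type) (s : seq I) (F : I -> R3 R -> R) j y :
  (forall i z, derivable (F i) z (basis_vec j)) ->
  derivable (fun z => \sum_(i <- s) F i z) y (basis_vec j).
Proof.
move=> dF; elim: s => [|i s IH].
  have -> : (fun z => \sum_(i <- [::]) F i z) = cst 0.
    by apply/funext => z; rewrite big_nil.
  exact: derivable_cst.
have -> : (fun z => \sum_(k <- i :: s) F k z) = F i + (fun z => \sum_(i <- s) F i z).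
  by apply/funext => z; rewrite big_cons.
exact: derivableD.
Qed.

Lemma partial_sum (I : Type) (s : seq I) (F : I -> R3 R -> R) j y :
  (forall i z, derivable (F i) z (basis_vec j)) ->
  partial j (fun z => \sum_(i <- s) F i z) y = \sum_(i <- s) partial j (F i) y.
Proof.
move=> dF; elim: s => [|i s IH].
  have -> : (fun z => \sum_(i <- [::]) F i z) = cst 0.
    by apply/funext => z; rewrite big_nil.
  by rewrite big_nil /partial derive_cst.
have -> : (fun z => \sum_(k <- i :: s) F k z) = F i + (fun z => \sum_(i <- s) F i z).
  by apply/funext => z; rewrite big_cons.
rewrite big_cons -IH /partial deriveD//; exact: derivable_big_sum.
Qed.

(** With [M = 2] the identity covers coordinates in [-1, 2], hence a neighbourhood of the cell and
    not the cell alone, so that it may be differentiated. *)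
Let window_sum u : lat_periodic u -> forall y,
  (forall i, - 1 <= sg i y <= 2) ->
  \sum_(f : {ffun 'I_3 -> 'I_(2 + 2)}) (chi * u) (y + lat (window f)) = u y.
Proof.
move=> pu y yM; under eq_bigr do rewrite fctE pu.
rewrite -mulr_suml chi_sum ?mul1r// => i; have := yM i.
by rewrite (_ : 1 - 2%:R = -1 :> R)//; lra.
Qed.

Let hcell_window y : hcell y -> forall i, - 1 <= sg i y <= 2.
Proof. by move=> hy i; have /andP[? ?] := hy i; lra. Qed.

(** The test function [chi * u] stands for the periodic [u], its lattice translates summing to
    [u]. *)
Lemma unfold_chi (F : mR3 R -> R) u : measurable_fun [set: mR3 R] F -> per F ->
  leb3.-integrable hcell (EFin \o F) -> sm u -> lat_periodic u ->
  \int[leb3]_y (F y * (chi * u) y) = \int[leb3]_(y in hcell) (F y * u y).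
Proof.
move=> mF pF iF su pu; have tu := test_chi_mul su.
have [B BP] := test_fun_bounded tu.
have supp y : (chi * u) y != 0 -> forall i, - 2%:R <= sg i y < 2%:R.
  rewrite mulf_eq0 negb_or => /andP[/chi_supp h _] i.
  by have := h i; lra.
rewrite (proj2 (unfold g_free mF pF iF (test_fun_measurable tu) BP supp)).
apply: eq_Rintegral => y /set_mem hy.
by rewrite window_sum//; exact: hcell_window.
Qed.

Lemma chi_partial_supp u j y : partial j (chi * u) y != 0 ->
  forall i, - 1 <= sg i y <= 1.
Proof.
move=> py i; apply/negPn/negP; rewrite negb_and -!ltNge => h.
case/negP: py; apply/eqP.
have : \forall z \near y, (chi * u) z = 0.
  have z0 z : (sg i z < -1) \/ (1 < sg i z) -> (chi * u) z = 0.
    move=> hz; rewrite fctE; have [->|/chi_supp /(_ i)] := eqVneq (chi z) 0; first by rewrite mul0r.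
    by case: hz; lra.
  have sc : sg i @ y --> sg i y := @sg_continuous R g i y.
  case/orP : h => h.
    have H : \forall z \near y, sg i z < - 1 := sc _ (lt_nbhsl h).
    by apply: filterS H => z hz; apply: z0; left.
  have H : \forall z \near y, 1 < sg i z := sc _ (lt_nbhsr h).
  by apply: filterS H => z hz; apply: z0; right.
by move=> n0; rewrite /partial (near_eq_derive _ (g := cst 0)) ?derive_cst.
Qed.

(** The lattice sum of [chi * u] agrees with [u] near each point of the cell, so the contributions
    of the derivatives of [chi] cancel. *)
Lemma unfold_partial (F : mR3 R -> R) u j : measurable_fun [set: mR3 R] F -> per F ->
  leb3.-integrable hcell (EFin \o F) -> sm u -> lat_periodic u ->
  \int[leb3]_y (F y * partial j (chi * u) y) =
  \int[leb3]_(y in hcell) (F y * partial j u y).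
Proof.
move=> mF pF iF su pu; have tu := test_chi_mul su.
have [B BP] := test_fun_partial_bounded j tu.
have supp y : partial j (chi * u) y != 0 -> forall i, - 2%:R <= sg i y < 2%:R.
  by move=> /chi_partial_supp h i; have := h i; lra.
rewrite (proj2 (unfold g_free mF pF iF (test_fun_partial_measurable j tu) BP supp)).
apply: eq_Rintegral => y /set_mem hy; congr (_ * _).
have [dcu _] := sm_partial (sm_mul sm_chi su).
pose T (z : R3 R) := \sum_(f : {ffun 'I_3 -> 'I_(2 + 2)}) (chi * u) (z + lat (window f)).
transitivity (partial j T y).
  rewrite /T partial_sum; first by apply: eq_bigr => f _; rewrite partial_shift.
  move=> f z; have := dcu j (z + lat (window f)); rewrite /derivable.
  have -> // : (chi * u) \o shift (z + lat (window f)) =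
      (fun x : R3 R => (chi * u) (x + lat (window f))) \o shift z.
  by apply/funext => x /=; rewrite addrA.
rewrite /partial; apply: near_eq_derive.
have near i : \forall z \near y, - 1 <= sg i z <= 2.
  have /andP[h1 h2] := hy i; have sc : sg i @ y --> sg i y := @sg_continuous R g i y.
  have hm : -1 < sg i y by lra.
  have hp : sg i y < 2 by lra.
  have n1 : \forall z \near y, - 1 < sg i z := sc _ (lt_nbhsr hm).
  have n2 : \forall z \near y, sg i z < 2 := sc _ (lt_nbhsl hp).
  by apply: filterS2 n1 n2 => z /= /ltW -> /ltW ->.
have : \forall z \near y, forall i, - 1 <= sg i z <= 2.
  exact: (@filter_forall _ _ (fun i z => - 1 <= sg i z <= 2) (nbhs y) _ near).
by apply: filterS => z hz; rewrite /T window_sum.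
Qed.

End partition_of_unity.

(** * Fourier series of periodic functions *)

Section waves.
Context {R : realType} (g : 'I_3 -> R3 R).
Context (g_free : free [tuple g i | i < 3]).
Local Notation K := {ffun 'I_3 -> int}.
Implicit Types (k l : K) (t : R) (y : R3 R).
Local Notation sg := (sg g).
Local Notation lat := (lat g).
Local Notation hcell := (hcell g).

(** The vector of the reciprocal lattice with coordinates [k]: lattice translations change its phase
    by multiples of [2 pi]. *)
Definition wavevec k : R3 R := \sum_i (2 * pi * (k i)%:~R) *: dual g i.

Definition freq k (j : 'I_3) : R := coord3 (wavevec k) j.

Definition wave k t y : R := cos (dot3 (wavevec k) y + t).

Lemma dot3_suml (I : Type) (s : seq I) (F : I -> R3 R) y :
  dot3 (\sum_(i <- s) F i) y = \sum_(i <- s) dot3 (F i) y.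
Proof.
apply: (big_morph (fun d => dot3 d y)) => [u v|]; rewrite /dot3 /=; first by ring.
by rewrite !mul0r !addr0.
Qed.

Lemma phaseE k y : dot3 (wavevec k) y = 2 * pi * \sum_i (k i)%:~R * sg i y.
Proof.
rewrite dot3_suml mulr_sumr; apply: eq_bigr => i _.
by rewrite sgE// /dot3 /= /GRing.scale /=; ring.
Qed.

Lemma dot3_coord3 (d : R3 R) y :
  dot3 d y = coord3 d ord0 * y.1.1 + coord3 d 1 * y.1.2 + coord3 d ord_max * y.2.
Proof. by rewrite /coord3 /dot3 /=; ring. Qed.

Lemma freqN k j : freq (- k) j = - freq k j.
Proof.
rewrite /freq /coord3 !phaseE -mulrN -sumrN; congr (_ * _); apply: eq_bigr => i _.
by rewrite ffunE mulrNz mulNr.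
Qed.

(** Evaluating the phase at [g i] recovers [2 pi k_i]. *)
Lemma freq_eq0 k : (forall j, freq k j = 0) -> k = 0.
Proof.
move=> k0; apply/ffunP => i; rewrite ffunE.
have := phaseE k (g i); rewrite dot3_coord3 -![coord3 _ _]/(freq _ _) !k0 !mul0r !addr0.
rewrite (bigD1 i)//= big1 ?addr0 => [|j ji]; last by rewrite sg_g// (negbTE ji) mulr0.
rewrite sg_g// eqxx mulr1 => /esym/eqP; rewrite mulf_eq0 mulf_eq0 pnatr_eq0/=.
by rewrite gt_eqF ?pi_gt0//= intr_eq0 => /eqP.
Qed.

Lemma sm_wave k t : sm (wave k t).
Proof. exact: sm_cos. Qed.

Lemma partial_wave k t j y : partial j (wave k t) y = freq k j * wave k (t + pi / 2) y.
Proof.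
rewrite /wave addrA cosDpihalf.
by case: (is_derive_affine j (is_derive_cos (dot3 (wavevec k) y + t))).
Qed.

Lemma cosD2pi_int (n : int) (x : R) : cos (x + 2 * pi * n%:~R) = cos x.
Proof.
have nat_case (m : nat) z : cos (z + 2 * pi * m%:R) = cos z :> R.
  elim: m z => [|m IH] z; first by rewrite mulr0 addr0.
  rewrite -[m.+1%:R]natr1 mulrDr mulr1 addrA -[RHS](IH z).
  by rewrite [X in _ + X](_ : 2 * pi = pi *+ 2) ?cosD2pi// mulr_natl.
case: n => m; first by rewrite -pmulrn nat_case.
rewrite NegzE mulrNz mulrN -pmulrn -[LHS](nat_case m.+1) addrNK//.
Qed.

Lemma wave_periodic k t : lat_periodic g (wave k t).
Proof.
move=> y n; rewrite /wave !phaseE.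
have -> : \sum_i (k i)%:~R * sg i (y + lat n) =
    \sum_i (k i)%:~R * sg i y + (\sum_i k i * n i)%:~R.
  rewrite (rmorph_sum intr) /= -big_split /=; apply: eq_bigr => i _.
  by rewrite sgD sg_lat// mulrDr rmorphM.
by rewrite mulrDr addrAC cosD2pi_int.
Qed.

Lemma wave_bound k t y : `|wave k t y| <= 1.
Proof. by rewrite ler_norml cos_geN1 cos_le1. Qed.

Lemma measurable_wave k t : measurable_fun [set: mR3 R] (wave k t).
Proof. exact: (continuous_measurable3 (sm_continuous (sm_wave k t))). Qed.

(** Some [freq k j] is nonzero, so a wave is a multiple of the derivative of another wave; the cell
    integral of that derivative unfolds to the integral over space of the derivative of a test
    function, which is 0. *)
Lemma integral_wave_eq0 k t : k != 0 -> \int[leb3]_(y in hcell) wave k t y = 0.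
Proof.
move=> k0; have [j fj] : exists j, freq k j != 0.
  apply: contrapT => /forallNP h; case/eqP: k0; apply: freq_eq0 => j.
  by apply/eqP; apply: contrapT => /negP; exact: h.
have mh := measurable_hcell g.
pose u := wave k (t - pi / 2).
have su : sm u by exact: sm_wave.
have i1 : leb3.-integrable hcell (EFin \o (fun=> 1)).
  apply: measurable_bounded_integrable => //; first exact: leb3_hcell_lty.
  by exists 1; split=> // x x1 y _ /=; rewrite normr1 ltW.
have p1 : Pilot.Defs.periodic g (fun _ : R3 R => 1 : R).
  by move=> a _; exact/aeW.
have m1 : measurable_fun [set: mR3 R] (fun=> 1 : R) by [].
have := unfold_partial g_free j m1 p1 i1 su (wave_periodic k _).
have [N [_ NP]] := test_fun_cube (test_chi_mul g_free su).
have [sp _] := test_chi_mul g_free su.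
have [cp dp] := sp [::]; have [cdp _] := sp [:: j].
under eq_Rintegral do rewrite mul1r.
rewrite (@Rintegral_partial_eq0 _ (chi g * u) N j cp (dp j) cdp); last first.
  by move=> y /NP[? ?].
under eq_Rintegral do rewrite mul1r partial_wave subrK.
rewrite RintegralZl//; last first.
  apply: measurable_bounded_integrable => //; first exact: leb3_hcell_lty.
    exact: measurable_funTS (measurable_wave k t).
  by exists 1; split=> // x x1 y _ /=; apply: le_trans (wave_bound _ _ _) (ltW x1).
by move=> /esym/eqP; rewrite mulf_eq0 (negbTE fj) => /eqP.
Qed.

(** Hartley's function [cos + sin]: one real function per frequency, instead of a cosine and a sine
    for each pair [k], [- k]. *)
Definition cas k y : R := wave k 0 y + wave k (- (pi / 2)) y.

Lemma casE k y : cas k y = cos (dot3 (wavevec k) y) + sin (dot3 (wavevec k) y).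
Proof. by rewrite /cas /wave addr0 cosBpihalf. Qed.

Lemma phaseN k y : dot3 (wavevec (- k)) y = - dot3 (wavevec k) y.
Proof.
rewrite !phaseE -mulrN -sumrN; congr (_ * _); apply: eq_bigr => i _.
by rewrite ffunE mulrNz mulNr.
Qed.

Lemma phaseD k l y :
  dot3 (wavevec (k + l)) y = dot3 (wavevec k) y + dot3 (wavevec l) y.
Proof.
rewrite !phaseE -mulrDr -big_split; congr (_ * _); apply: eq_bigr => i _.
by rewrite ffunE intrD mulrDl.
Qed.

Lemma casN k y : cas (- k) y = cos (dot3 (wavevec k) y) - sin (dot3 (wavevec k) y).
Proof. by rewrite casE phaseN cosN sinN. Qed.

Lemma wave_cas k t y : wave k t y =
  cos t * (2^-1 * (cas k y + cas (- k) y)) - sin t * (2^-1 * (cas k y - cas (- k) y)).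
Proof. by rewrite casN casE /wave cosD; lra. Qed.

Lemma sm_cas k : sm (cas k).
Proof. by apply: sm_addf; exact: sm_wave. Qed.

Lemma partial_cas k j y : partial j (cas k) y = freq k j * cas (- k) y.
Proof.
have d t := (sm_partial (sm_wave k t)).1 j y.
have -> : partial j (cas k) y = partial j (wave k 0) y + partial j (wave k (- (pi / 2))) y.
  exact: deriveD.
by rewrite !partial_wave -mulrDr casN /wave add0r addNr addr0 cosDpihalf addrC.
Qed.

Lemma cas_periodic k : lat_periodic g (cas k).
Proof. by move=> y n; rewrite /cas !wave_periodic. Qed.

Lemma cas_bound k y : `|cas k y| <= 2.
Proof.
apply: le_trans (ler_normD _ _) _.
by have := wave_bound k 0 y; have := wave_bound k (- (pi / 2)) y; lra.
Qed.

Lemma measurable_cas k : measurable_fun [set: mR3 R] (cas k).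
Proof. by apply: measurable_funD; exact: measurable_wave. Qed.

Lemma integrable_wave k t : leb3.-integrable hcell (EFin \o wave k t).
Proof.
apply: measurable_bounded_integrable.
- exact: measurable_hcell.
- exact: leb3_hcell_lty.
- exact: measurable_funTS (measurable_wave k t).
- by exists 1; split=> // x x1 y _ /=; apply: le_trans (wave_bound _ _ _) (ltW x1).
Qed.

Lemma cas_mul k l y : cas k y * cas l y = wave (k - l) 0 y + wave (k + l) (- (pi / 2)) y.
Proof.
rewrite !casE /wave addr0 cosBpihalf !phaseD phaseN cosB sinD.
by ring.
Qed.

Lemma wave0 t y : wave 0 t y = cos t.
Proof.
rewrite /wave phaseE big1 ?mulr0 ?add0r// => i _.
by rewrite ffunE mul0r.
Qed.

Lemma integral_cas_mul k l : \int[leb3]_(y in hcell) (cas k y * cas l y) =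
  (k == l)%:R * fine (leb3 hcell).
Proof.
have mh := measurable_hcell g.
under eq_Rintegral do rewrite cas_mul.
rewrite RintegralD//; [|exact: integrable_wave|exact: integrable_wave].
have -> : \int[leb3]_(y in hcell) wave (k + l) (- (pi / 2)) y = 0.
  (* For [l = - k] the second wave is the constant [cos (- pi / 2) = 0]: this choice of phase makes
     [cas k] and [cas (- k)] orthogonal when [k != 0]. *)
  have [->|kl] := eqVneq (k + l) 0; last exact: integral_wave_eq0.
  under eq_Rintegral do rewrite wave0 cosN cos_pihalf.
  by rewrite Rintegral_cst// mul0r.
rewrite addr0 -(subr_eq0 k l); have [->|kl] := eqVneq (k - l) 0; last first.
  by rewrite mul0r; exact: integral_wave_eq0.
under eq_Rintegral do rewrite wave0 cos0.
by rewrite Rintegral_cst// mul1r.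
Qed.

End waves.

(** * Polynomial approximation of a threshold *)

Section step_approximation.
Context {R : realType}.
Implicit Types (w r z : R).

Lemma bernoulli_ge z n : -1 <= z -> 1 + n%:R * z <= (1 + z) ^+ n.
Proof.
move=> z1; elim: n => [|n IH]; first by rewrite mul0r addr0 expr0.
rewrite exprS; have n0 : 0 <= n%:R :> R by [].
apply: le_trans (_ : (1 + z) * (1 + n%:R * z) <= _); last first.
  by rewrite ler_wpM2l// -lerBlDl sub0r.
rewrite -[n.+1%:R]natr1; have := mulr_ge0 n0 (sqr_ge0 z); nra.
Qed.

Lemma cvg_nXr r : 0 <= r < 1 -> (fun n => n%:R * r ^+ n) @ \oo --> (0 : R).
Proof.
(* Since [r <= s^2] with [s < 1], one power of [s] absorbs [n] by Bernoulli's inequality and the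
   other tends to 0. *)
move=> /andP[r0 r1]; pose s := Num.sqrt ((r + 1) / 2).
have s20 : 0 < (r + 1) / 2 by lra.
have s2 : s ^+ 2 = (r + 1) / 2 by rewrite sqr_sqrtr// ltW.
have s0 : 0 < s by rewrite sqrtr_gt0.
have s1 : s < 1 by rewrite -[ltRHS]sqrtr1 ltr_sqrt//; lra.
pose d := s^-1 - 1; have d0 : 0 < d by rewrite subr_gt0 invf_gt1.
apply: (@squeeze_cvgr _ _ _ _ (cst 0) (fun n => d^-1 * s ^+ n)); last 2 first.
- exact: cvg_cst.
- rewrite -[X in _ --> X](mulr0 d^-1); apply: cvgM; first exact: cvg_cst.
  by apply: cvg_expr; rewrite ger0_norm ?ltW.
apply: nearW => n; rewrite mulr_ge0 ?exprn_ge0//=.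
apply: (@le_trans _ _ (n%:R * (s ^+ n * s ^+ n))).
  rewrite ler_wpM2l// -exprMn -expr2 s2 lerXn2r// ?nnegrE//; lra.
rewrite mulrA; apply: ler_wpM2r; first by rewrite exprn_ge0// ltW.
have hn : n%:R * d <= (s ^+ n)^-1.
  rewrite -exprVn; have := @bernoulli_ge d n.
  rewrite (_ : 1 + d = s^-1); last by rewrite /d; ring.
  by move=> h; apply: le_trans (h _); lra.
by rewrite -[leRHS]mul1r ler_pdivlMr// mulrAC -ler_pdivlMr ?exprn_gt0// mul1r.
Qed.

(** The expression behaves like [exp (- n * (2 * w)^n)], whence the threshold 1/2; the extra factor
    [n] in the exponent settles [w = 1/2] on the side of 0. Such powers come from elementary proofs
    of the Stone-Weierstrass theorem. *)
Lemma cvg_step_approx w : 0 <= w <= 1 ->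
  (fun n => (1 - w ^+ n) ^+ (n * 2 ^ n)) @ \oo --> ((w < 2^-1)%R%:R : R).
Proof.
move=> /andP[w0 w1].
have wn0 n : 0 <= w ^+ n by exact: exprn_ge0.
have wn1 n : w ^+ n <= 1 by exact: exprn_ile1.
have p0 n : 0 <= 1 - w ^+ n by rewrite subr_ge0.
have e n : (n * 2 ^ n)%:R * w ^+ n = n%:R * (2 * w) ^+ n :> R.
  by rewrite natrM natrX exprMn mulrA.
case: ltP => [wh|wh].
- apply: (@squeeze_cvgr _ _ _ _ (fun n => 1 - n%:R * (2 * w) ^+ n) (cst 1)).
  + apply: nearW => n; apply/andP; split; last by rewrite exprn_ile1// lerBlDr lerDl.
    have := @bernoulli_ge (- w ^+ n) (n * 2 ^ n); rewrite mulrN e; apply.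
    by rewrite lerN2.
  + rewrite -[X in _ --> X]subr0; apply: cvgB; first exact: cvg_cst.
    by apply: cvg_nXr; lra.
  + exact: cvg_cst.
- apply: (@squeeze_cvgr _ _ _ _ (cst 0) (fun n => n.+1%:R^-1)).
  + apply: nearW => n; rewrite exprn_ge0//=.
    (* The powers of [1 - w^n] and [1 + w^n] have product at most 1, so Bernoulli's lower bound on
       the second bounds the first from above. *)
    have h1 : n.+1%:R <= (1 + w ^+ n) ^+ (n * 2 ^ n).
      apply: le_trans (bernoulli_ge _ _); last by apply: le_trans (wn0 n); lra.
      rewrite e -[n.+1%:R]natr1 addrC lerD2l ler_peMr//.
      by apply: exprn_ege1; lra.
    have h2 : (1 - w ^+ n) ^+ (n * 2 ^ n) * (1 + w ^+ n) ^+ (n * 2 ^ n) <= 1.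
      rewrite -exprMn; apply: exprn_ile1; have := sqr_ge0 (w ^+ n); have := wn0 n; have := wn1 n; nra.
    rewrite -[leRHS]mul1r ler_pdivlMr ?ltr0n//.
    by apply: le_trans h2; rewrite ler_wpM2l// exprn_ge0.
  + exact: cvg_cst.
  + exact: cvg_harmonic.
Qed.

End step_approximation.

(** * Completeness of the trigonometric system *)

Section completeness.
Context {R : realType} (g : 'I_3 -> R3 R).
Context (g_free : free [tuple g i | i < 3]).
Local Notation K := {ffun 'I_3 -> int}.
Implicit Types (k l : K) (t : R) (y : R3 R).
Local Notation sg := (sg g).
Local Notation hcell := (hcell g).

(** The span of the waves; arbitrary phases make it stable under products without treating sines
    separately. *)
Inductive trig : (R3 R -> R) -> Prop :=
| trig_wave c k t : trig (fun y => c * wave g k t y)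
| trig_add f h : trig f -> trig h -> trig (fun y => f y + h y).

Lemma trig_cst c : trig (fun=> c).
Proof.
have -> : (fun=> c) = (fun y : R3 R => c * wave g 0 0 y).
  by apply/funext => y; rewrite wave0 cos0 mulr1.
exact: trig_wave.
Qed.

Lemma trig_mul f h : trig f -> trig h -> trig (fun y => f y * h y).
Proof.
move=> tf th; elim: tf => [c k t|f1 f2 _ IH1 _ IH2]; last first.
  under eq_fun do rewrite mulrDl; exact: trig_add.
elim: th => [d l s|h1 h2 _ IH1 _ IH2]; last first.
  under eq_fun do rewrite mulrDr; exact: trig_add.
have -> : (fun y => c * wave g k t y * (d * wave g l s y)) =
  (fun y => (c * d / 2) * wave g (k - l) (t - s) y + (c * d / 2) * wave g (k + l) (t + s) y).
  apply/funext => y; rewrite /wave !phaseD phaseN.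
  set a := dot3 _ y; set b := dot3 _ y.
  have -> : a - b + (t - s) = (a + t) - (b + s) by ring.
  have -> : a + b + (t + s) = (a + t) + (b + s) by ring.
  move: (a + t) (b + s) => u v.
  by rewrite cosB cosD; field.
by apply: trig_add; exact: trig_wave.
Qed.

Lemma trig_exp f n : trig f -> trig (fun y => f y ^+ n).
Proof.
move=> tf; elim: n => [|n IH]; first exact: trig_cst.
by under eq_fun do rewrite exprS; exact: trig_mul.
Qed.

Lemma trig_measurable f : trig f -> measurable_fun [set: mR3 R] f.
Proof.
elim=> [c k t|f1 f2 _ IH1 _ IH2]; last exact: measurable_funD.
by apply: measurable_funM => //; exact: measurable_wave.
Qed.

Lemma trig_bounded f : trig f -> exists B, forall y, `|f y| <= B.
Proof.
elim=> [c k t|f1 f2 _ [B1 H1] _ [B2 H2]].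
  by exists `|c| => y; rewrite normrM ler_piMr// wave_bound.
by exists (B1 + B2) => y; apply: le_trans (ler_normD _ _) _; exact: lerD.
Qed.

Lemma integrable_bounded_mul (F u : R3 R -> R) B : leb3.-integrable hcell (EFin \o F) ->
  measurable_fun [set: mR3 R] u -> (forall y, `|u y| <= B) ->
  leb3.-integrable hcell (EFin \o (fun y => F y * u y)).
Proof.
move=> iF mu uB; have mh := measurable_hcell g.
apply: (@integrable_le _ _ R leb3 _ mh (fun y => F y * u y) (fun y => B * `|F y|)).
- apply: measurable_funM; last exact: measurable_funTS.
  by apply/measurable_EFinP; exact: measurable_int iF.
- by move=> y _; rewrite normrM mulrC ler_wpM2r.
- by apply: integrableZ_fun => //; exact: integrable_norm.
Qed.

Lemma trig_integral0 (F : R3 R -> R) f : leb3.-integrable hcell (EFin \o F) ->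
  (forall k, \int[leb3]_(y in hcell) (F y * cas g k y) = 0) -> trig f ->
  \int[leb3]_(y in hcell) (F y * f y) = 0.
Proof.
move=> iF F0; have mh := measurable_hcell g.
have iw k t : leb3.-integrable hcell (EFin \o (fun y => F y * wave g k t y)).
  exact: (integrable_bounded_mul iF (measurable_wave g k t) (wave_bound g k t)).
have ic k : leb3.-integrable hcell (EFin \o (fun y => F y * cas g k y)).
  exact: (integrable_bounded_mul iF (measurable_cas g k) (cas_bound g k)).
elim=> [c k t|f1 f2 t1 IH1 t2 IH2]; last first.
  have [B1 H1] := trig_bounded t1; have [B2 H2] := trig_bounded t2.
  under eq_Rintegral do rewrite mulrDr.
  rewrite RintegralD ?IH1 ?IH2 ?addr0//.
    exact: (integrable_bounded_mul iF (trig_measurable t1) H1).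
  exact: (integrable_bounded_mul iF (trig_measurable t2) H2).
pose a := c * (cos t * 2^-1 - sin t * 2^-1).
pose b := c * (cos t * 2^-1 + sin t * 2^-1).
transitivity (\int[leb3]_(y in hcell) (a * (F y * cas g k y) + b * (F y * cas g (- k) y))).
  by apply: eq_Rintegral => y _; rewrite wave_cas /a /b; ring.
rewrite RintegralD//; [|exact: integrableZ_fun|exact: integrableZ_fun].
by rewrite !RintegralZl// !F0 !mulr0 addr0.
Qed.

(* With [s = sg i y], the trigonometric polynomial
   [w = 1/2 + sin (pi s) sin (pi (x - s)) / 2] is below 1/2 on the cell exactly
   when [x < s]. *)
Lemma trig_halfspace (i : 'I_3) (x : R) : x < 1 -> exists q : nat -> R3 R -> R,
  [/\ forall n, trig (q n), forall n y, 0 <= q n y <= 1 &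
    forall y, hcell y -> q ^~ y @ \oo --> ((x < sg i y)%R%:R : R)].
Proof.
move=> x1; case: (ltP x 0) => [x0|x0].
  exists (fun _ _ => 1); split.
  - by move=> n; exact: trig_cst.
  - by move=> n y; rewrite ler01 lexx.
  - move=> y hy; rewrite (_ : (x < sg i y) = true); first exact: cvg_cst.
    by apply: lt_le_trans x0 _; case/andP: (hy i).
pose e : K := [ffun j => (j == i)%:Z].
pose w y := 2^-1 - cos (pi * x) / 4 + 4^-1 * wave g e (- (pi * x)) y.
have ph y : dot3 (wavevec g e) y = 2 * pi * sg i y.
  rewrite phaseE (bigD1 i)//= big1 ?addr0 => [|j ji]; rewrite ffunE ?eqxx ?mul1r//.
  by rewrite (negbTE ji) mul0r.
have wE y : w y = 2^-1 + sin (pi * sg i y) * sin (pi * (x - sg i y)) / 2.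
  rewrite /w /wave ph; set s := sg i y.
  have -> : 2 * pi * s - pi * x = pi * s - pi * (x - s) by ring.
  have -> : pi * x = pi * s + pi * (x - s) by ring.
  move: (pi * s) (pi * (x - s)) => u v.
  by rewrite cosB cosD; field.
have w01 y : 0 <= w y <= 1.
  rewrite wE; set a := sin _; set b := sin _.
  have a1 : -1 <= a <= 1 by rewrite sin_geN1 sin_le1.
  have b1 : -1 <= b <= 1 by rewrite sin_geN1 sin_le1.
  have : -1 <= a * b <= 1 by rewrite -ler_norml normrM mulr_ile1// ler_norml.
  lra.
have wlt y : hcell y -> (w y < 2^-1) = (x < sg i y).
  move=> hy; have /andP[s0 s1] := hy i; rewrite wE; set s := sg i y in s0 s1 *.
  have pi0 := pi_gt0 R.
  case: (ltP x s) => xs.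
    have h1 : 0 < sin (pi * s) by apply: sin_gt0_pi; apply/andP; split; nra.
    have h2 : 0 < sin (pi * (s - x)) by apply: sin_gt0_pi; apply/andP; split; nra.
    have -> : pi * (x - s) = - (pi * (s - x)) by ring.
    by rewrite sinN mulrN; have := mulr_gt0 h1 h2; lra.
  apply/negbTE; rewrite -leNgt.
  have h1 : 0 <= sin (pi * s) by apply: sin_ge0_pi; apply/andP; split; nra.
  have h2 : 0 <= sin (pi * (x - s)) by apply: sin_ge0_pi; apply/andP; split; nra.
  by have := mulr_ge0 h1 h2; lra.
have tw : trig w.
  by apply: trig_add; [exact: trig_cst|exact: trig_wave].
exists (fun n y => (1 - w y ^+ n) ^+ (n * 2 ^ n)); split.
- move=> n; apply: trig_exp.
  have -> : (fun y => 1 - w y ^+ n) = (fun y => 1 + (-1) * w y ^+ n).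
    by apply/funext => y; rewrite mulN1r.
  apply: trig_add; first exact: trig_cst.
  by apply: trig_mul; [exact: trig_cst|exact: trig_exp].
- move=> n y; have /andP[w0 w1] := w01 y.
  have h0 := exprn_ge0 n w0; have h1 := exprn_ile1 n w0 w1.
  by rewrite exprn_ge0 ?subr_ge0//= exprn_ile1// ?subr_ge0// lerBlDr lerDl.
- by move=> y hy; rewrite -wlt//; exact: cvg_step_approx.
Qed.

(** Orthogonality passes to trigonometric polynomials, then by dominated convergence to indicators
    of orthants in lattice coordinates, which generate the measurable sets. *)
Lemma cas_complete (F : R3 R -> R) : measurable_fun [set: mR3 R] F ->
  leb3.-integrable hcell (EFin \o F) ->
  (forall k, \int[leb3]_(y in hcell) (F y * cas g k y) = 0) ->
  ae_eq leb3 hcell (EFin \o F) (cst 0%E).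
Proof.
move=> mF iF F0; have mh := measurable_hcell g.
apply: (@ae_eq0_rays3 _ _ R leb3 hcell (EFin \o F) (sg ord0) (sg 1) (sg ord_max)
  (fun s => s.1.1 *: g ord0 + s.1.2 *: g 1 + s.2 *: g ord_max : R3 R) (-1)) => //.
- exact: measurable_sg.
- exact: measurable_sg.
- exact: measurable_sg.
- have mc (c : R) (p : mR3 R -> R) :
      measurable_fun [set: mR3 R] p -> measurable_fun [set: mR3 R] (fun s => p s * c).
    by move=> mp; exact: measurable_funM.
  have m1 : measurable_fun [set: mR3 R] (fun s : mR3 R => s.1.1 : R)
    by exact: (measurableT_comp measurable_fst measurable_fst).
  have m2 : measurable_fun [set: mR3 R] (fun s : mR3 R => s.1.2 : R)
    by exact: (measurableT_comp measurable_snd measurable_fst).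
  have m3 : measurable_fun [set: mR3 R] (fun s : mR3 R => s.2 : R) by exact: measurable_snd.
  by do 2?apply: measurable_fun_pair; (apply: measurable_funD; first apply: measurable_funD); exact: mc.
- move=> y; rewrite -[RHS](sgK g_free y).
  by rewrite !big_ord_recl big_ord0 addr0 addrA; congr (_ + sg _ _ *: g _ + sg _ _ *: g _); apply/val_inj.
- have h i y : hcell y -> -1 < sg i y.
    by move=> hy; have /andP[h0 _] := hy i; apply: lt_le_trans h0; rewrite ltrN10.
  by move=> y hy; split; exact: h.
move=> x1 x2 x3.
set B := hcell `&` _.
have mB : measurable B.
  have mr (i : 'I_3) (x : R) : @measurable _ (mR3 R) [set y | x < sg i y].
    have -> : [set y | x < sg i y] = [set y | sg i y \in `]x, +oo[].
      by apply/seteqP; split=> y /=; rewrite in_itv/= andbT.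
    exact: measurable_sg_itv.
  have -> : B = hcell `&`
      ([set y | x1 < sg ord0 y] `&` [set y | x2 < sg 1 y] `&` [set y | x3 < sg ord_max y]).
    by apply/seteqP; split=> y [hy] => [[? ? ?]|[[? ?] ?]]; do ?split.
  by do !apply: measurableI.
have iB : leb3.-integrable B (EFin \o F).
  by apply: (integrableS mh) => //; exact: subIsetl.
suff R0 : \int[leb3]_(y in B) F y = 0.
  by rewrite -[LHS]fineK; [congr (_%:E)|exact: integrable_fin_num].
(* Cell coordinates are below 1, so a threshold of at least 1 leaves [B] empty; [trig_halfspace]
   covers the other case. *)
have [bad|ok] := pselect (x1 < 1 /\ x2 < 1 /\ x3 < 1); last first.
  have -> : B = set0.
    apply/seteqP; split=> // y [hy [h1 h2 h3]]; apply: ok.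
    have h i : sg i y < 1 by have /andP[] := hy i.
    by split; [exact: lt_trans h1 (h _)|split; [exact: lt_trans h2 (h _)|exact: lt_trans h3 (h _)]].
  exact: Rintegral_set0.
have [l1 [l2 l3]] := bad.
have [q1 [t1 b1 c1]] := trig_halfspace ord0 l1.
have [q2 [t2 b2 c2]] := trig_halfspace 1 l2.
have [q3 [t3 b3 c3]] := trig_halfspace ord_max l3.
pose q n y := q1 n y * q2 n y * q3 n y.
have tq n : trig (q n) by apply: trig_mul => //; exact: trig_mul.
suff : (fun n => \int[leb3]_(y in hcell) (F y * q n y)) @ \oo -->
    \int[leb3]_(y in hcell) (F y * ((x1 < sg ord0 y)%R%:R * (x2 < sg 1 y)%R%:R * (x3 < sg ord_max y)%R%:R)).
  have z n := trig_integral0 iF F0 (tq n).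
  under eq_fun do rewrite z.
  move=> H; apply: etrans (esym (cvg_unique _ (cvg_cst 0) H)) => //.
  rewrite Rintegral_indic_cond [RHS]Rintegral_indic_cond.
  apply: eq_Rintegral => y _; rewrite -mulrA; congr (_ * _); rewrite !indicE.
  case: (boolP (y \in hcell)) => [/set_mem hy|hy]; last first.
    rewrite mulr0 (_ : y \in B = false)//; apply/negbTE; apply: contra hy.
    by move=> /set_mem[hy _]; exact/mem_set.
  rewrite mulr1; case: (boolP (y \in B)) => [/set_mem[_ [-> -> ->]]|nB]; first by rewrite !mulr1.
  case: (boolP (x1 < sg ord0 y)) => h1; last by rewrite !mul0r.
  case: (boolP (x2 < sg 1 y)) => h2; last by rewrite mulr0 mul0r.
  case: (boolP (x3 < sg ord_max y)) => h3; last by rewrite mulr0.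
  by case/negP: nB; apply/mem_set; split.
apply: (@Rdominated_cvg _ _ R leb3 hcell (fun n y => F y * q n y) _ (fun y => `|F y|) mh).
- move=> n; apply/measurable_funTS/measurable_funM => //; exact: trig_measurable.
- have mind (i : 'I_3) (x : R) : measurable_fun [set: mR3 R] (fun y => (x < sg i y)%R%:R : R).
    apply: (measurableT_comp (f := fun b : bool => b%:R : R)) => //.
    by apply: measurable_fun_ltr => //; exact: measurable_sg.
  apply/measurable_funTS/measurable_funM => //.
  by do 2?apply: measurable_funM => //; exact: mind.
- move=> y hy; apply: cvgM; first exact: cvg_cst.
  by apply: cvgM; [apply: cvgM; [exact: c1|exact: c2]|exact: c3].
- exact: integrable_norm.
- move=> n y _; rewrite normrM ler_piMr//.
  have /andP[? ?] := b1 n y; have /andP[? ?] := b2 n y; have /andP[? ?] := b3 n y.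
  by rewrite ger0_norm ?mulr_ge0// /q mulr_ile1 ?mulr_ge0// mulr_ile1.
Qed.

End completeness.

(** * Fourier coefficients of periodic functions *)

Section fourier_coefficients.
Context {R : realType} (g : 'I_3 -> R3 R).
Context (g_free : free [tuple g i | i < 3]).
Local Notation K := {ffun 'I_3 -> int}.
Implicit Types (k l : K) (y : R3 R) (F H : R3 R -> R).
Local Notation sg := (sg g).
Local Notation lat := (lat g).
Local Notation hcell := (hcell g).
Local Notation L2 := (Lsq leb3 hcell).
Local Notation ip := (dotp leb3 hcell).
Local Notation per := (Pilot.Defs.periodic g).
Let mh : measurable hcell := measurable_hcell g.
Let hoo : (leb3 hcell < +oo)%E := leb3_hcell_lty g_free.

Definition bas k y : R := (Num.sqrt (fine (leb3 hcell)))^-1 * cas g k y.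

Lemma sm_bas k : sm (bas k).
Proof. by apply: sm_mulf; [exact: sm_cst|exact: sm_cas]. Qed.

Lemma bas_periodic k : lat_periodic g (bas k).
Proof. by move=> y n; rewrite /bas cas_periodic. Qed.

Lemma measurable_bas k : measurable_fun [set: mR3 R] (bas k).
Proof. exact: (continuous_measurable3 (sm_continuous (sm_bas k))). Qed.

Lemma bas_bounded k : exists B, forall y, `|bas k y| <= B.
Proof.
exists (`|(Num.sqrt (fine (leb3 hcell)))^-1| * 2) => y.
by rewrite normrM ler_wpM2l// cas_bound.
Qed.

Lemma L2_bas k : L2 (bas k).
Proof. by have [B BP] := bas_bounded k; exact: (L2_bounded mh hoo (measurable_bas k) BP). Qed.

Lemma partial_bas k j y : partial j (bas k) y = freq g k j * bas (- k) y.
Proof.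
have [dc _] := sm_partial (sm_cas g k).
have -> : partial j (bas k) y = (Num.sqrt (fine (leb3 hcell)))^-1 * partial j (cas g k) y.
  rewrite /partial (_ : bas k = (cst (Num.sqrt (fine (leb3 hcell)))^-1) * cas g k)//.
  rewrite deriveM; [|exact: derivable_cst|exact: dc].
  by rewrite derive_cst scaler0 addr0.
by rewrite partial_cas mulrCA.
Qed.

Lemma ip_bas k l : ip (bas k) (bas l) = (k == l)%:R.
Proof.
have V0 : 0 < fine (leb3 hcell) by rewrite fine_gt0// leb3_hcell_gt0.
rewrite /dotp; pose c := (Num.sqrt (fine (leb3 hcell)))^-1.
transitivity (\int[leb3]_(y in hcell) (c ^+ 2 * (cas g k y * cas g l y))).
  by apply: eq_Rintegral => y _; rewrite /bas -/c; ring.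
rewrite RintegralZl//; last first.
  apply: (integrable_bounded_mul _ (measurable_cas g l) (cas_bound g l)).
  apply: measurable_bounded_integrable => //; first exact: measurable_funTS (measurable_cas g k).
  by exists 2; split=> // x x1 y _ /=; apply: le_trans (cas_bound _ _ _) (ltW x1).
rewrite integral_cas_mul// /c exprVn sqr_sqrtr ?ltW// mulrCA mulVf ?mulr1//.
by rewrite gt_eqF.
Qed.

Lemma bas0 y : bas 0 y = (Num.sqrt (fine (leb3 hcell)))^-1.
Proof. by rewrite /bas /cas !wave0 cos0 cosN cos_pihalf addr0 mulr1. Qed.

Definition co F k : R := ip F (bas k).

Lemma bas_complete F : L2 F -> (forall k, co F k = 0) -> ae_eq leb3 hcell F (cst 0).
Proof.
move=> LF F0; have [mF _] := LF.
have V0 : 0 < fine (leb3 hcell) by rewrite fine_gt0// leb3_hcell_gt0.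
have c0 : (Num.sqrt (fine (leb3 hcell)))^-1 != 0 by rewrite invr_eq0 gt_eqF// sqrtr_gt0.
have L1 : L2 (fun=> 1).
  by apply: (@L2_bounded _ _ _ _ _ mh _ 1) => // y; rewrite normr1.
have iF : leb3.-integrable hcell (EFin \o F).
  have := L2_mul mh LF L1; congr (_.-integrable _ _).
  by apply/funext => y /=; rewrite mulr1.
have [|N [mN N0 NP]] := cas_complete g_free mF iF.
  move=> k; have := F0 k; rewrite /co /dotp.
  under eq_Rintegral do rewrite /bas mulrCA.
  rewrite RintegralZl//; last exact: (integrable_bounded_mul iF (measurable_cas g k) (cas_bound g k)).
  by move=> /eqP; rewrite mulf_eq0 (negbTE c0) => /eqP.
exists N; split=> // y /= h; apply: NP => /= h2; apply: h => hy.
by have [] := h2 hy.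
Qed.

(* [bas \o s] listed along [pickle]; the unused indices carry [0], so [bseq] is
   orthogonal without being orthonormal. *)
Definition bseq (s : K -> K) (n : nat) : R3 R -> R :=
  if pickle_inv n is Some k then bas (s k) else fun=> 0.

Lemma L2_bseq s n : L2 (bseq s n).
Proof. by rewrite /bseq; case: pickle_inv => [k|]; [exact: L2_bas|exact: L2_cst0]. Qed.

Lemma bseq_orth s : injective s -> forall n m, n != m -> ip (bseq s n) (bseq s m) = 0.
Proof.
move=> injs n m nm; rewrite /bseq.
have z F : ip F (fun=> 0) = 0.
  rewrite /dotp; under eq_Rintegral do rewrite mulr0.
  by rewrite Rintegral_cst// mul0r.
case En : (pickle_inv n) => [k|]; last by rewrite ipC z.
case Em : (pickle_inv m) => [l|]; last by rewrite z.
rewrite ip_bas; case: eqP => // /injs kl; case/eqP: nm.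
have hn := pickle_invK (T := K) n; rewrite En /= in hn.
by have := pickle_invK (T := K) m; rewrite Em /= -kl hn.
Qed.

Lemma bseq_norm s n : ip (bseq s n) (bseq s n) = 1 \/ forall x, bseq s n x = 0.
Proof.
by rewrite /bseq; case: pickle_inv => [k|]; [left; rewrite ip_bas eqxx|right].
Qed.

Lemma bseq_pickle s k : bseq s (pickle k) = bas (s k).
Proof. by rewrite /bseq pickleK_inv. Qed.

Lemma bseq_complete F : L2 F -> (forall n, ip F (bseq id n) = 0) ->
  ae_eq leb3 hcell F (cst 0).
Proof.
by move=> LF F0; apply: bas_complete => // k; have := F0 (pickle k); rewrite bseq_pickle.
Qed.

(** The sum over [a] is kept together because, for matrix fields, only the total over all entries
    cancels at each frequency. *)
Lemma parseval_sum0 (I : finType) (F H : I -> R3 R -> R) :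
  (forall a, L2 (F a)) -> (forall a, L2 (H a)) ->
  (forall k, \sum_a co (F a) k * co (H a) k = 0) ->
  \sum_a ip (F a) (H a) = 0.
Proof.
move=> LF LH FH0.
pose p a n := psum (bseq id) (fun m => ip (F a) (bseq id m)) n.
have Lp a n : L2 (p a n) by apply: L2_psum => // m; exact: L2_bseq.
have c a : (fun n => ip (p a n) (H a)) @ \oo --> ip (F a) (H a).
  have P := parseval mh hoo (L2_bseq id) (bseq_orth (@inj_id K)) (bseq_norm id) bseq_complete (LF a).
  exact: (L2cvg_ip mh (Lp a) (LF a) (LH a) P).
have : (fun n => \sum_a ip (p a n) (H a)) @ \oo --> \sum_a ip (F a) (H a).
  by apply: cvg_big => [|a _]; [exact: add_continuous|exact: c].
have -> : (fun n => \sum_a ip (p a n) (H a)) = fun=> 0.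
  apply/funext => n.
  under eq_bigr => a _ do rewrite (ip_psum mh (L2_bseq id) _ _ (LH a)).
  rewrite exchange_big big1// => m _; rewrite /bseq.
  case: pickle_inv => [k|].
    rewrite -[RHS](FH0 k); apply: eq_bigr => a _; congr (_ * _).
    exact: ipC.
  rewrite big1// => a _; rewrite /dotp.
  under eq_Rintegral do rewrite mulr0.
  by rewrite Rintegral_cst// !mul0r.
by move=> H0; exact: esym (cvg_unique _ (cvg_cst 0) H0).
Qed.

Lemma L2_integrable F : L2 F -> leb3.-integrable hcell (EFin \o F).
Proof.
move=> LF; have L1 : L2 (fun=> 1).
  by apply: (@L2_bounded _ _ _ _ _ mh _ 1) => // y; rewrite normr1.
have := L2_mul mh LF L1; congr (_.-integrable _ _).
by apply/funext => y /=; rewrite mulr1.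
Qed.

Lemma coD F H k : L2 F -> L2 H -> co (fun y => F y + H y) k = co F k + co H k.
Proof. by move=> LF LH; rewrite /co ipDl//; exact: L2_bas. Qed.

Lemma coB F H k : L2 F -> L2 H -> co (fun y => F y - H y) k = co F k - co H k.
Proof. by move=> LF LH; rewrite /co ipBl//; exact: L2_bas. Qed.

Lemma coZ c F k : L2 F -> co (fun y => c * F y) k = c * co F k.
Proof. by move=> LF; rewrite /co ipZl//; exact: L2_bas. Qed.

Lemma co_ae F H k : L2 F -> L2 H -> {ae leb3, forall y, F y = H y} -> co F k = co H k.
Proof.
move=> [mF _] [mH _] FH; apply: Rintegral_ae_eq => //.
- by apply/measurable_funTS/measurable_funM => //; exact: measurable_bas.
- by apply/measurable_funTS/measurable_funM => //; exact: measurable_bas.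
- by apply: ae3_impl FH => y ->.
Qed.

(* Both members are integrals of [F] and [G] against the test functions
   [chi * bas k], folded back to the cell. *)
Lemma co_weak_partial F G j k : L2 F -> L2 G -> per F -> per G ->
  (forall psi, test_fun psi ->
    \int[leb3]_y (F y * partial j psi y) = - \int[leb3]_y (G y * psi y)) ->
  co G k = - (freq g k j * co F (- k)).
Proof.
move=> LF LG pF pG FG; have [mF _] := LF; have [mG _] := LG.
have := FG _ (test_chi_mul g_free (sm_bas k)).
rewrite (unfold_partial g_free j mF pF (L2_integrable LF) (sm_bas k) (bas_periodic k)).
rewrite (unfold_chi g_free mG pG (L2_integrable LG) (sm_bas k) (bas_periodic k)).
move=> H; rewrite /co /dotp -[LHS]opprK -H; congr (- _).
under eq_Rintegral do rewrite partial_bas mulrCA.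
rewrite RintegralZl//; apply: L2_mul => //; exact: L2_bas.
Qed.

(** Periodicity is a.e. for each lattice vector separately; countability of the lattice keeps the
    union of the exceptional sets null. *)
Lemma ae_hcell_all F : per F -> ae_eq leb3 hcell F (cst 0) ->
  {ae leb3, forall y, F y = 0}.
Proof.
move=> pF F0.
pose A n : set (mR3 R) := if @pickle_inv K n is Some k
  then [set y : R3 R | hcell (y - lat k) /\ F y != 0] else set0.
have : leb3.-negligible (\bigcup_n A n).
  apply: negligible_bigcup => n; rewrite /A; case: pickle_inv => [k|]; last exact: negligible_set0.
  have h1 := ae3_shift (- lat k) F0.
  have h2 := ae3_shift (- lat k) (pF _ (lattice_lat g k)).
  have [M [mM M0 MP]] := ae3_and h1 h2.
  exists M; split=> // y [hy Fy]; apply: MP => /= -[a1]; rewrite subrK => a2.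
  by move: Fy; rewrite a2 a1 ?eqxx.
move=> [M [mM M0 MP]]; exists M; split=> // y /= Fy; apply: MP.
(* Integer parts of the lattice coordinates give the translate of the cell that contains [y]. *)
pose k : K := [ffun i => Num.floor (sg i y)].
exists (pickle k) => //; rewrite /A pickleK_inv /=; split; last exact/eqP.
move=> i; rewrite sgD sgN sg_lat// ffunE.
have /andP[f1 f2] := floor_itv (sg i y).
by rewrite subr_ge0 f1 /= ltrBlDl -(rmorph1 intr) -intrD.
Qed.

End fourier_coefficients.

(** * Weak gradients *)

Section weak_gradients.
Context {R : realType}.
Implicit Types (y a : R3 R) (f h psi : R3 R -> R) (v : R3 R -> 'rV[R]_3) (G : R3 R -> 'M[R]_3).

Lemma ae3_forall (I : finType) (P : I -> R3 R -> Prop) :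
  (forall i, {ae leb3, forall y, P i y}) -> {ae leb3, forall y, forall i, P i y}.
Proof.
move=> aP.
have : {ae leb3, forall y, forall i, i \in enum I -> P i y}.
  elim: (enum I) => [|i s IH]; first exact/aeW.
  apply: ae3_impl (ae3_and (aP i) IH) => y [Pi Ps] k.
  by rewrite inE => /predU1P[->|/Ps].
by apply: ae3_impl => y h i; apply: h; rewrite mem_enum.
Qed.

Lemma L2locP f : L2loc f <-> forall K : set (R3 R), compact K -> Lsq leb3 K f.
Proof.
split=> [[mf fK] K cK|h]; first by split; [|exact: fK].
have [mf _] := h set0 (@compact0 _).
by split=> // K cK; case: (h K cK).
Qed.

Lemma L2locD f h : L2loc f -> L2loc h -> L2loc (fun y => f y + h y).
Proof.
move=> /L2locP Lf /L2locP Lh; apply/L2locP => K cK.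
exact: (L2D (compact_measurable3 cK) (Lf K cK) (Lh K cK)).
Qed.

Lemma L2locB f h : L2loc f -> L2loc h -> L2loc (fun y => f y - h y).
Proof.
move=> /L2locP Lf /L2locP Lh; apply/L2locP => K cK.
exact: (L2B (compact_measurable3 cK) (Lf K cK) (Lh K cK)).
Qed.

Lemma L2locZ c f : L2loc f -> L2loc (fun y => c * f y).
Proof.
move=> /L2locP Lf; apply/L2locP => K cK.
exact: (L2Z (compact_measurable3 cK) c (Lf K cK)).
Qed.

Lemma L2loc_mul_integrable f psi N B : L2loc f -> measurable_fun [set: mR3 R] psi ->
  (forall y, `|psi y| <= B) -> (forall y, ~ cube N y -> psi y = 0) ->
  leb3.-integrable [set: mR3 R] (EFin \o (fun y => f y * psi y)).
Proof.
move=> /L2locP Lf mpsi psiB psi0; have mc := measurable_cube N.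
have Lp := L2_bounded mc (leb3_cube_lty N) mpsi psiB.
have := L2_mul mc (Lf _ (@compact_cube R N)) Lp.
move=> /(integrable_indicP leb3 _ mc); congr (_.-integrable _ _).
apply/funext => y /=; congr (_%:E); rewrite indicE.
case: (pselect (cube N y)) => [cy|/psi0 ->]; last by rewrite mulr0 mul0r.
by rewrite mem_set// mulr1.
Qed.

Lemma L2loc_test_integrable f psi : L2loc f -> test_fun psi ->
  leb3.-integrable [set: mR3 R] (EFin \o (fun y => f y * psi y)).
Proof.
move=> Lf tp; have [N [_ NP]] := test_fun_cube tp; have [B BP] := test_fun_bounded tp.
by apply: (L2loc_mul_integrable Lf (test_fun_measurable tp) BP) => y /NP[].
Qed.

Lemma L2loc_test_partial_integrable f psi j : L2loc f -> test_fun psi ->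
  leb3.-integrable [set: mR3 R] (EFin \o (fun y => f y * partial j psi y)).
Proof.
move=> Lf tp; have [N [_ NP]] := test_fun_cube tp.
have [B BP] := test_fun_partial_bounded j tp.
by apply: (L2loc_mul_integrable Lf (test_fun_partial_measurable j tp) BP) => y /NP[].
Qed.

Lemma eq_of_test f h : L2loc f -> L2loc h ->
  (forall psi, test_fun psi -> \int[leb3]_y (f y * psi y) = \int[leb3]_y (h y * psi y)) ->
  {ae leb3, forall y, f y = h y}.
Proof.
move=> Lf Lh fh; have := du_bois_reymond (L2locB Lf Lh).
move=> D; suff : {ae leb3, forall y, f y - h y = 0}.
  by apply: ae3_impl => y /eqP; rewrite subr_eq0 => /eqP.
apply: D => psi tp.
under eq_Rintegral do rewrite mulrBl.
by rewrite RintegralB// ?fh ?subrr//; exact: L2loc_test_integrable.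
Qed.

Lemma weak_grad_unique v G1 G2 : is_weak_grad v G1 -> is_weak_grad v G2 ->
  {ae leb3, forall y, G1 y = G2 y}.
Proof.
move=> [L1 e1] [L2 e2].
have : {ae leb3, forall y, forall i j, G1 y i j = G2 y i j}.
  apply: ae3_forall => i; apply: ae3_forall => j.
  by apply: eq_of_test => // psi tp; apply: oppr_inj; rewrite -e1// -e2.
by apply: ae3_impl => y h; apply/matrixP.
Qed.

Lemma test_fun_shift a (psi : R3 R -> R) : test_fun psi ->
  test_fun (fun y => psi (y + a)).
Proof.
move=> tp; have [N [_ NP]] := test_fun_cube tp; have [sp _] := tp.
have E s : partials s (fun y => psi (y + a)) = fun y => partials s psi (y + a).
  elim: s => // j s /= ->; apply/funext => y; exact: partial_shift.
split.
  move=> s; rewrite E; have [cs ds] := sp s; split.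
    move=> y; apply: (@continuous_comp _ _ _ (fun z : R3 R => z + a) (partials s psi)).
      by apply: cvgD; [exact: cvg_id|exact: cvg_cst].
    exact: cs.
  move=> j y; have := ds j (y + a); rewrite /derivable.
  have -> // : partials s psi \o shift (y + a) = (fun x : R3 R => partials s psi (x + a)) \o shift y.
  by apply/funext => x /=; rewrite addrA.
pose M := `|N| + (`|a.1.1| + `|a.1.2| + `|a.2|).
have cN := @compact_cube R M.
have clN : closed (cube M : set (R3 R)) by apply: compact_closed => //; exact: norm_hausdorff.
apply: (subclosed_compact _ cN); first exact: closed_closure.
rewrite [X in _ `<=` X](proj1 (closure_id _) clN); apply: closureS => y /= py.
have [/= h1 h2 h3] : cube N (y + a).
  by apply: contrapT => /NP[p0]; rewrite p0 eqxx in py.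
have k (u b s : R) : `|u + b| <= N -> `|b| <= s -> `|u| <= `|N| + s.
  move=> hu hb; rewrite -[u](addrK b); apply: le_trans (ler_normB _ _) _.
  by apply: lerD => //; apply: le_trans hu (ler_norm N).
have n1 := normr_ge0 a.1.1; have n2 := normr_ge0 a.1.2; have n3 := normr_ge0 a.2.
by split; [apply: k h1 _|apply: k h2 _|apply: k h3 _]; lra.
Qed.

Context (g : 'I_3 -> R3 R).
Local Notation per := (Pilot.Defs.periodic g).

Lemma periodic_mx G : (forall i j, per (fun y => G y i j)) -> per G.
Proof.
move=> pG a La.
have : {ae leb3, forall y, forall i j, G (y + a) i j = G y i j}.
  by apply: ae3_forall => i; apply: ae3_forall => j; exact: pG.
by apply: ae3_impl => y h; apply/matrixP.
Qed.

Lemma L2loc_shift a f : L2loc f -> L2loc (fun y => f (y + a)).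
Proof.
move=> [mf fK]; split; first exact: (measurableT_comp mf (measurable_shift3 a)).
move=> K cK; have [N NP] := compact_sub_cube cK.
pose M := `|N| + (`|a.1.1| + `|a.1.2| + `|a.2|).
have mK := compact_measurable3 cK; have mM := @measurable_cube R M.
have := fK _ (@compact_cube R M).
move=> /(integrable_indicP leb3 (fun y => f y ^+ 2) mM) /(integrable3_shift a) h.
apply/(integrable_indicP leb3 (fun y => f (y + a) ^+ 2) mK).
apply: (@integrable_le _ _ R leb3 _ measurableT _
  ((fun y => f y ^+ 2 * \1_(cube M) y) \o shift3 a)) => //.
  apply: measurable_funM; last exact: measurable_indic.
  by apply: measurable_funX; exact: (measurableT_comp mf (measurable_shift3 a)).
move=> y _; rewrite ger0_norm; last by apply: mulr_ge0; [exact: sqr_ge0|rewrite indicE].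
rewrite /= /shift3 ler_wpM2l ?sqr_ge0// !indicE.
case: (boolP (y \in K)) => [/set_mem Ky|_]; last by [].
rewrite mem_set//; have [h1 h2 h3] := NP _ Ky.
have k (u b s : R) : `|u| <= N -> `|b| <= s -> `|u + b| <= `|N| + s.
  move=> hu hb; apply: le_trans (ler_normD _ _) _.
  by apply: lerD => //; apply: le_trans hu (ler_norm N).
have n1 := normr_ge0 a.1.1; have n2 := normr_ge0 a.1.2; have n3 := normr_ge0 a.2.
by split; [apply: k h1 _|apply: k h2 _|apply: k h3 _]; lra.
Qed.

(** Testing a translate of [G] amounts to testing [G] with a translated [psi], hence to testing [v],
    whose periodicity moves the translation back. *)
Lemma weak_grad_periodic v G : (forall i, L2loc (fun y => v y 0 i)) ->
  is_weak_grad v G -> per v -> per G.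
Proof.
move=> Lv [LG vG] pv; apply: periodic_mx => i j a La.
apply: eq_of_test => // [|psi tp]; first exact: (L2loc_shift a (LG i j)).
have tp' := test_fun_shift (- a) tp.
have mG : measurable_fun [set: mR3 R] (fun y : R3 R => G y i j) by case: (LG i j).
have mv : measurable_fun [set: mR3 R] (fun y : R3 R => v y 0 i) by case: (Lv i).
have mp := test_fun_measurable tp'; have mdp := test_fun_partial_measurable j tp'.
transitivity (\int[leb3]_y (G y i j * psi (y - a))).
  rewrite -(Rintegral3_shift a (measurable_funM mG mp)).
  by apply: eq_Rintegral => y _; rewrite /shift3 /= addrK.
apply: oppr_inj; rewrite -(vG i j _ tp') -(vG i j _ tp).
rewrite -(Rintegral3_shift a (measurable_funM mv mdp)).
apply: Rintegral_ae_eq => //.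
- exact: (measurableT_comp (measurable_funM mv mdp) (measurable_shift3 a)).
- by apply: measurable_funM => //; exact: test_fun_partial_measurable.
- apply: ae3_impl (pv a La) => y e; rewrite /shift3 /= e; congr (_ * _).
  by rewrite partial_shift addrK.
Qed.

Lemma weak_gradP v : H1loc v -> is_weak_grad v (weak_grad v).
Proof. by move=> [_ [G vG]]; rewrite /weak_grad; apply: xgetPex; exists G. Qed.

End weak_gradients.

(** * Fourier coefficients of strains *)

Section symmetric_rank_one.
Context {R : realType}.
Implicit Types (kap a : 'I_3 -> R) (E M : 'M[R]_3).

Definition sqnorm kap : R := \sum_j kap j ^+ 2.

(* Where [sqnorm kap = 0] this is [0], division by zero being zero. *)
Definition polar kap E (i : 'I_3) : R :=
  (2 * (\sum_j E i j * kap j) -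
   kap i * (\sum_l (\sum_j E l j * kap j) * kap l) / sqnorm kap) / sqnorm kap.

Lemma sqnorm_eq0 kap : sqnorm kap = 0 -> forall j, kap j = 0.
Proof.
move=> q0 j; apply/eqP; rewrite -sqrf_eq0.
move/eqP : q0; rewrite /sqnorm psumr_eq0; last by move=> i _; exact: sqr_ge0.
by move=> /allP /(_ j); rewrite mem_index_enum => /(_ isT).
Qed.

(** Applying the symmetric product of [kap] and [a] to [kap], and solving for [a] the requirement
    that the result be [E kap], gives [polar]. The remainder [M] then kills [kap], so it is
    orthogonal to [E] by hypothesis and to all symmetric products with [kap], hence to itself. For
    [kap = 0] the remainder is [E]. *)
Lemma polarE kap E : sym_mx E ->
  (forall M, sym_mx M -> (forall i, \sum_j M i j * kap j = 0) -> frob E M = 0) ->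
  forall i j, E i j = (kap i * polar kap E j + kap j * polar kap E i) / 2.
Proof.
move=> sE orth; set a := polar kap E.
pose M : 'M[R]_3 := \matrix_(i, j) (E i j - (kap i * a j + kap j * a i) / 2).
have sM : sym_mx M.
  apply/matrixP => i j; rewrite !mxE -{1}sE mxE; congr (_ - _ / _); exact: addrC.
have Mk i : \sum_j M i j * kap j = 0.
  have [q0|q0] := eqVneq (sqnorm kap) 0.
    by rewrite big1// => j _; rewrite (sqnorm_eq0 q0) mulr0.
  set b := fun i => \sum_j E i j * kap j.
  set s := \sum_l b l * kap l.
  have ak : \sum_j a j * kap j = s / sqnorm kap.
    have -> : \sum_j a j * kap j =
        (2 * s - (\sum_j kap j ^+ 2) * s / sqnorm kap) / sqnorm kap.
      rewrite mulrBl mulr_sumr !mulr_suml -sumrB; apply: eq_bigr => j _.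
      by rewrite /a /polar -/(b j) -/s; field.
    by rewrite -/(sqnorm kap); field.
  have -> : \sum_j M i j * kap j =
      b i - (kap i * (\sum_j a j * kap j) + a i * \sum_j kap j ^+ 2) / 2.
    rewrite !mulr_sumr -big_split mulr_suml -sumrB; apply: eq_bigr => j _.
    by rewrite mxE /=; field.
  by rewrite ak -/(sqnorm kap) /a /polar -/(b i) -/s; field.
have EM := orth M sM Mk.
have MM : frob M M = 0.
  have -> : frob M M = frob E M - \sum_j a j * \sum_i M j i * kap i.
    have -> : \sum_j a j * (\sum_i M j i * kap i) =
        2^-1 * (\sum_i \sum_j M i j * (kap i * a j)) +
        2^-1 * (\sum_i \sum_j M i j * (kap j * a i)).
      rewrite -mulrDr.
      have e1 : \sum_i \sum_j M i j * (kap i * a j) = \sum_j a j * \sum_i M j i * kap i.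
        rewrite exchange_big; apply: eq_bigr => j _; rewrite mulr_sumr.
        by apply: eq_bigr => i _; rewrite -{1}sM mxE; ring.
      have e2 : \sum_i \sum_j M i j * (kap j * a i) = \sum_j a j * \sum_i M j i * kap i.
        by apply: eq_bigr => i _; rewrite mulr_sumr; apply: eq_bigr => j _; ring.
      by rewrite e1 e2; field.
    rewrite !mulr_sumr -big_split -sumrB; apply: eq_bigr => i _.
    rewrite !mulr_sumr -big_split -sumrB; apply: eq_bigr => j _ /=.
    by rewrite [in LHS]mxE !mxE; field.
  by rewrite EM big1 ?subr0// => j _; rewrite Mk mulr0.
move=> i j; apply/eqP; rewrite -subr_eq0.
have : M i j ^+ 2 = 0.
  have MM0 (l m : 'I_3) : 0 <= M l m * M l m by rewrite -expr2 sqr_ge0.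
  move/eqP : MM; rewrite /frob psumr_eq0; last by move=> l _; exact: sumr_ge0.
  move=> /allP /(_ i); rewrite mem_index_enum => /(_ isT) /=.
  rewrite psumr_eq0// => /allP /(_ j); rewrite mem_index_enum => /(_ isT) /=.
  by rewrite -expr2 => /eqP.
by move/eqP; rewrite sqrf_eq0 mxE.
Qed.

(** Korn's inequality for a single mode, from the identity
    [2 |E|^2 = |kap|^2 |a|^2 + (kap . a)^2]. *)
Lemma rank_one_bound kap a E :
  (forall i j, E i j = (kap i * a j + kap j * a i) / 2) ->
  forall i j, (kap j * a i) ^+ 2 <= 2 * frob E E.
Proof.
move=> EE i j.
apply: (@le_trans _ _ (\sum_l \sum_m (kap l * a m) ^+ 2)).
  rewrite (bigD1 j)//= (bigD1 i)//= -!addrA lerDl addr_ge0//.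
    by apply: sumr_ge0 => *; exact: sqr_ge0.
  by apply: sumr_ge0 => *; apply: sumr_ge0 => *; exact: sqr_ge0.
rewrite -subr_ge0.
have -> : 2 * frob E E - \sum_l \sum_m (kap l * a m) ^+ 2 = (\sum_l kap l * a l) ^+ 2.
  by rewrite /frob !big_ord_recl !big_ord0 !EE; field.
exact: sqr_ge0.
Qed.

End symmetric_rank_one.

(** * Strains and divergence-free fields in Fourier space *)

Section coefficients_of_strains.
Context {R : realType} (g : 'I_3 -> R3 R).
Context (g_free : free [tuple g i | i < 3]).
Local Notation K := {ffun 'I_3 -> int}.
Implicit Types (k : K) (y : R3 R) (v : R3 R -> 'rV[R]_3) (e mu : R3 R -> 'M[R]_3).
Local Notation hcell := (hcell g).
Local Notation per := (Pilot.Defs.periodic g).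
Local Notation co := (co g).
Let mh : measurable hcell := measurable_hcell g.

(** If [k_i != 0], the phase [2 pi k_i] at [g i] has absolute value at least 1. Cauchy-Schwarz, in
    the form of Lagrange's identity, bounds its square by [|g i|^2 |freq k|^2]; [C] is the sum of
    the [|g i|^2]. *)
Lemma freq_bound : exists C : R, 0 <= C /\
  forall k, k != 0 -> 1 <= C * sqnorm (freq g k).
Proof.
pose n i := (g i).1.1 ^+ 2 + (g i).1.2 ^+ 2 + (g i).2 ^+ 2.
have n0 i : 0 <= n i by rewrite /n !addr_ge0// sqr_ge0.
exists (\sum_i n i); split; first exact: sumr_ge0.
move=> k k0; have [i ki] : exists i, k i != 0.
  apply: contrapT => /forallNP h; case/eqP: k0; apply/ffunP => i; rewrite ffunE.
  by apply/eqP; apply: contrapT => /negP; exact: h.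
have q0 : 0 <= sqnorm (freq g k) by apply: sumr_ge0 => j _; exact: sqr_ge0.
apply: (@le_trans _ _ (n i * sqnorm (freq g k))); last first.
  by rewrite ler_wpM2r// (bigD1 i)//= lerDl sumr_ge0.
have ph : dot3 (wavevec g k) (g i) = 2 * pi * (k i)%:~R.
  rewrite phaseE// (bigD1 i)//= big1 ?addr0 => [|j ji].
    by rewrite sg_g// eqxx mulr1.
  by rewrite sg_g// (negbTE ji) mulr0.
have k1 : 1 <= ((k i)%:~R : R) ^+ 2.
  rewrite -(real_normK (num_real _)) -intr_norm exprn_ege1// ler1z.
  by rewrite -gtz0_ge1 normr_gt0.
have pi1 : 1 <= (2 * pi : R) ^+ 2.
  by rewrite exprn_ege1//; have := pi_ge2 R; lra.
have : 1 <= dot3 (wavevec g k) (g i) ^+ 2.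
  by rewrite ph exprMn; nra.
move=> /le_trans; apply; rewrite dot3_coord3 /sqnorm !big_ord_recl big_ord0 addr0.
rewrite -![coord3 _ _]/(freq _ _ _).
rewrite (_ : lift ord0 ord0 = 1); last exact/val_inj.
rewrite (_ : lift ord0 (lift ord0 ord0) = ord_max); last exact/val_inj.
rewrite /n; move: (freq g k ord0) (freq g k 1) (freq g k ord_max) => x y z.
move: (g i).1.1 (g i).1.2 (g i).2 => u v w; rewrite -subr_ge0.
have -> : (u ^+ 2 + v ^+ 2 + w ^+ 2) * (x ^+ 2 + (y ^+ 2 + z ^+ 2)) - (x * u + y * v + z * w) ^+ 2
  = (u * y - v * x) ^+ 2 + (u * z - w * x) ^+ 2 + (v * z - w * y) ^+ 2 by ring.
by rewrite !addr_ge0// sqr_ge0.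
Qed.

Lemma co_weak_grad v G i j k : H1per g v -> is_weak_grad v G ->
  co (fun y => G y i j) k = - (freq g k j * co (fun y => v y 0 i) (- k)).
Proof.
move=> [[Lv _] pv] [LG vG].
have pG := weak_grad_periodic Lv (conj LG vG) pv.
apply: (co_weak_partial g_free).
- exact: (Lsq_of_L2loc g_free (Lv i)).
- exact: (Lsq_of_L2loc g_free (LG i j)).
- exact: (periodic_comp (fun r : 'rV[R]_3 => r 0 i) pv).
- exact: (periodic_comp (fun r : 'M[R]_3 => r i j) pG).
- by move=> psi tp; exact: vG.
Qed.

Lemma lat_periodic_per (u : R3 R -> R) : lat_periodic g u -> per u.
Proof. by move=> pu _ [n _ <-]; apply/aeW => y; exact: pu. Qed.

Lemma L2loc_bas k : L2loc (bas g k).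
Proof.
apply: (L2loc_of_Lsq g_free (lat_periodic_per (bas_periodic g_free k))).
exact: (L2_bas g_free k).
Qed.

(** Integration by parts moves the derivative to [bas k], which brings out the factor
    [M *m freq k]. *)
Lemma Tspace_bas k M : sym_mx M -> (forall i, \sum_j M i j * freq g k j = 0) ->
  Tspace g (fun y => bas g k y *: M).
Proof.
move=> sM Mk; split.
  split.
  - move=> i j; under eq_fun do rewrite mxE mulrC.
    exact: (L2locZ (M i j) (L2loc_bas k)).
  - by apply/aeW => y; rewrite /sym_mx linearZ /= sM.
  - exact: (periodic_comp (fun c => c *: M) (lat_periodic_per (bas_periodic g_free k))).
move=> i psi tp; rewrite /distr_div.
transitivity ((\sum_j M i j * freq g k j) * \int[leb3]_y (psi y * bas g (- k) y)).
  rewrite -sumrN mulr_suml; apply: eq_bigr => j _.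
  transitivity (- (M i j * \int[leb3]_y (partial j psi y * bas g k y))).
    rewrite -RintegralZl//; last first.
      apply: eq_integrable (L2loc_test_partial_integrable j (L2loc_bas k) tp) => //.
      by move=> y _ /=; rewrite mulrC.
    by congr (- _); apply: eq_Rintegral => y _; rewrite mxE; ring.
  rewrite (integration_by_parts_test j tp (sm_bas g k)) mulrN opprK -mulrA; congr (_ * _).
  rewrite -RintegralZl//; last first.
    apply: eq_integrable (L2loc_test_integrable (L2loc_bas (- k)) tp) => //.
    by move=> y _ /=; rewrite mulrC.
  by apply: eq_Rintegral => y _; rewrite partial_bas; ring.
by rewrite Mk mul0r.
Qed.

Lemma Lsq_cell (F : R3 R -> R) : L2loc F -> Lsq leb3 (cell g) F.
Proof.
move=> /L2locP LF; have [N NP] : exists N, cell g `<=` cube N.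
  have [N NP] := cube_sg g_free 1; exists N => y.
  rewrite cellE// => hy; apply: NP => i; have /andP[y0 y1] := hy i.
  by rewrite ger0_norm.
have [mF iF] := LF _ (@compact_cube R N); split=> //.
exact: (integrableS (measurable_cube N) (measurable_cell g_free) NP iF).
Qed.

Lemma Rintegral_cell_frob e mu :
  (forall i j, L2loc (fun y => e y i j)) -> (forall i j, L2loc (fun y => mu y i j)) ->
  \int[leb3]_(y in cell g) frob (e y) (mu y) =
  \sum_i \sum_j dotp leb3 hcell (fun y => e y i j) (fun y => mu y i j).
Proof.
move=> Le Lm; have mc := measurable_cell g_free.
have ic (D : set (mR3 R)) (LD : forall F, L2loc F -> Lsq leb3 D F) (mD : measurable D) i j :
    leb3.-integrable D (EFin \o (fun y => e y i j * mu y i j)).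
  exact: (L2_mul mD (LD _ (Le i j)) (LD _ (Lm i j))).
have isum (D : set (mR3 R)) (LD : forall F, L2loc F -> Lsq leb3 D F) (mD : measurable D) i :
    leb3.-integrable D (EFin \o (fun y => \sum_j e y i j * mu y i j)).
  by apply: integrable_sum_fun => // j; exact: ic.
rewrite Rintegral_cell//; last by apply: integrable_sum_fun => // i; exact: (isum _ Lsq_cell).
have Lh := Lsq_of_L2loc g_free.
rewrite /frob Rintegral_sum// => [|i]; last exact: (isum _ Lh).
by apply: eq_bigr => i _; rewrite Rintegral_sum// => j; exact: (ic _ Lh).
Qed.

Definition comx e k : 'M[R]_3 := \matrix_(i, j) co (fun y => e y i j) k.

Lemma comx_sym e k : (forall i j, L2loc (fun y => e y i j)) ->
  {ae leb3, forall y, sym_mx (e y)} -> sym_mx (comx e k).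
Proof.
move=> Le se; apply/matrixP => i j; rewrite !mxE.
apply: co_ae => //; [exact: Lsq_of_L2loc|exact: Lsq_of_L2loc|].
by apply: ae3_impl se => y s; rewrite -{1}s mxE.
Qed.

Lemma comx_Tperp e k M : Tperp g e -> sym_mx M ->
  (forall i, \sum_j M i j * freq g k j = 0) -> frob (comx e k) M = 0.
Proof.
move=> [[Le _ _] eT] sM Mk; have TM := Tspace_bas sM Mk.
rewrite -[RHS](eT _ TM) Rintegral_cell_frob//; last by case: TM => -[].
apply: eq_bigr => i _; apply: eq_bigr => j _; rewrite mxE mulrC.
have Lij := Lsq_of_L2loc g_free (Le i j).
rewrite /co -(ipZl mh (M i j) Lij (L2_bas g_free k)); apply: eq_Rintegral => y _.
by rewrite mxE; ring.
Qed.

(** The test function is built on [bas (- k)], because differentiation sends it to a multiple of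
    [bas k]. *)
Lemma comx_Tspace mu k : Tspace g mu ->
  forall i, \sum_j comx mu k i j * freq g k j = 0.
Proof.
move=> [[Lm _ pm] dm] i.
rewrite -[RHS](dm i _ (test_chi_mul g_free (sm_bas g (- k)))) /distr_div -sumrN.
apply: eq_bigr => j _; rewrite mxE.
have Lij := Lsq_of_L2loc g_free (Lm i j); have [mij _] := Lij.
have pij := periodic_comp (fun A : 'M[R]_3 => A i j) pm.
rewrite (unfold_partial g_free j mij pij (L2_integrable g_free Lij) (sm_bas g _)
  (bas_periodic g_free _)).
transitivity (- (freq g (- k) j * co (fun y => mu y i j) k)).
  by rewrite freqN// mulNr opprK mulrC.
congr (- _); rewrite -RintegralZl//; last exact: (L2_mul mh Lij (L2_bas g_free k)).
by apply: eq_Rintegral => y _; rewrite partial_bas opprK; ring.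
Qed.

End coefficients_of_strains.

(** * Synthesis of periodic functions from their coefficients *)

Section fourier_synthesis.
Context {R : realType} (g : 'I_3 -> R3 R).
Context (g_free : free [tuple g i | i < 3]).
Local Notation K := {ffun 'I_3 -> int}.
Implicit Types (k : K) (y : R3 R) (F H f h psi : R3 R -> R).
Local Notation sg := (sg g).
Local Notation lat := (lat g).
Local Notation hcell := (hcell g).
Local Notation L2 := (Lsq leb3 hcell).
Local Notation ip := (dotp leb3 hcell).
Local Notation per := (Pilot.Defs.periodic g).
Local Notation co := (co g).
Let mh : measurable hcell := measurable_hcell g.
Let hoo : (leb3 hcell < +oo)%E := leb3_hcell_lty g_free.

Definition kseq (c : K -> R) (n : nat) : R :=
  if pickle_inv n is Some k then c k else 0.

(** [s] will be [id] or [-%R]: listing a displacement along [- k] makes its termwise derivative a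
    series along [k]. *)
Lemma fourier_series s c B : injective s ->
  (forall n, \sum_(0 <= m < n) kseq c m ^+ 2 <= B) ->
  exists f, [/\ L2 f, L2cvg leb3 hcell (psum (bseq g s) (kseq c)) f,
    forall k, co f (s k) = c k & lat_periodic g f].
Proof.
move=> injs cB.
have [f [Lf cf ff pf]] := riesz_fischer mh hoo (L2_bseq g_free s)
  (bseq_orth g_free injs) (bseq_norm g_free s) cB.
exists f; split=> // [k|y n].
  have := ff (pickle k); rewrite bseq_pickle /kseq pickleK_inv /co => ->.
  by rewrite (ip_bas g_free) eqxx mulr1.
apply: pf => m; rewrite /bseq; case: pickle_inv => // k.
exact: (bas_periodic g_free).
Qed.

(** Folding represents the pairing with [psi] over space by the cell inner product with one L^2
    function, so that L^2 limits on the cell pass through it. *)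
Lemma fold_test psi N B : measurable_fun [set: mR3 R] psi ->
  (forall y, `|psi y| <= B) -> (forall y, ~ cube N y -> psi y = 0) ->
  exists2 H, L2 H & forall F, L2 F -> per F -> \int[leb3]_y (F y * psi y) = ip F H.
Proof.
move=> mpsi psiB psi0; have [M MP] := sg_bounded g N.
have psiM y : psi y != 0 -> forall i, - M%:R <= sg i y < M%:R.
  move=> py i; have cy : cube N y by apply: contrapT => /psi0 p0; rewrite p0 eqxx in py.
  have := MP y i cy; rewrite ltr_norml => /andP[m1 ->]; by rewrite ltW.
exists (fun y => \sum_(f : {ffun 'I_3 -> 'I_(M + M)}) psi (y + lat (window f) : R3 R)).
  apply: (L2_sum mh) => f; apply: (@L2_bounded _ _ _ _ _ mh _ B) => //.
  exact: (measurableT_comp mpsi (measurable_shift3 _)).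
move=> F LF pF; have [mF _] := LF.
by have [_ ->] := unfold g_free mF pF (L2_integrable g_free LF) mpsi psiB psiM.
Qed.

(** The weak derivative is a closed operator: smooth approximants satisfy the identity by classical
    integration by parts, and both sides pass to the limit. *)
Lemma L2cvg_weak_partial (u : nat -> R3 R -> R) f h j :
  (forall n, sm (u n)) -> (forall n, lat_periodic g (u n)) ->
  (forall n, L2 (u n)) -> (forall n, L2 (partial j (u n))) -> L2 f -> L2 h -> per f -> per h ->
  L2cvg leb3 hcell u f -> L2cvg leb3 hcell (fun n => partial j (u n)) h ->
  forall psi, test_fun psi ->
    \int[leb3]_y (f y * partial j psi y) = - \int[leb3]_y (h y * psi y).
Proof.
move=> su pu Lu Lpu Lf Lh pf ph uf uh psi tp.
have [N [_ NP]] := test_fun_cube tp.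
have [B BP] := test_fun_bounded tp; have [B' BP'] := test_fun_partial_bounded j tp.
have [H LH HP] := fold_test (test_fun_measurable tp) BP (fun y hy => (NP y hy).1).
have [H' LH' HP'] := fold_test (test_fun_partial_measurable j tp) BP'
  (fun y hy => proj2 (NP y hy) j).
rewrite HP'// HP//.
have c1 := L2cvg_ip mh Lu Lf LH' uf; have c2 := L2cvg_ip mh Lpu Lh LH uh.
have e n : ip (u n) H' = - ip (partial j (u n)) H.
  have <- := HP' _ (Lu n) (lat_periodic_per (pu n)).
  have <- := HP _ (Lpu n) (lat_periodic_per (lat_periodic_partial j (pu n))).
  under eq_Rintegral do rewrite mulrC.
  rewrite (integration_by_parts_test j tp (su n)); congr (- _).
  by apply: eq_Rintegral => y _; rewrite mulrC.
have c3 : (fun n => ip (u n) H') @ \oo --> - ip h H.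
  by rewrite (_ : (fun n => _) = fun n => - ip (partial j (u n)) H);
    [exact: cvgN|apply/funext].
exact: cvg_unique _ c1 c3.
Qed.

Lemma L2cvg_ext (u u' : nat -> R3 R -> R) f : (forall n, u n = u' n) ->
  L2cvg leb3 hcell u f -> L2cvg leb3 hcell u' f.
Proof. by move=> uu; rewrite (_ : u = u')//; apply/funext. Qed.

Lemma sm_psum s c n : sm (psum (bseq g s) (kseq c) n).
Proof.
rewrite /psum; elim: (index_iota 0 n) => [|m r IH].
  by under eq_fun do rewrite big_nil; exact: sm_cst.
under eq_fun do rewrite big_cons; apply: sm_addf => //; apply: sm_mulf; first exact: sm_cst.
by rewrite /bseq; case: pickle_inv => [k|]; [exact: sm_bas|exact: sm_cst].
Qed.

Lemma lat_periodic_psum s c n : lat_periodic g (psum (bseq g s) (kseq c) n).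
Proof.
move=> y m; apply: eq_bigr => i _; rewrite /bseq; case: pickle_inv => [k|] //.
by rewrite (bas_periodic g_free).
Qed.

Lemma partial_psum c j n : partial j (psum (bseq g -%R) (kseq c) n) =
  psum (bseq g id) (kseq (fun k => - (freq g k j * c k))) n.
Proof.
apply/funext => y; rewrite /psum partial_sum => [|i z].
  apply: eq_bigr => i _; rewrite /kseq /bseq; case: pickle_inv => [k|].
    rewrite /partial (_ : (fun z => c k * bas g (- k) z) = cst (c k) * bas g (- k))//.
    rewrite deriveM; [|exact: derivable_cst|exact: (sm_partial (sm_bas g (- k))).1].
    rewrite derive_cst scaler0 addr0 -[X in _ *: X = _]/(partial j (bas g (- k)) y).
    by rewrite partial_bas opprK freqN// /GRing.scale /=; ring.
  rewrite /partial (_ : (fun z => 0 * 0) = cst 0); last by apply/funext => z; rewrite mulr0.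
  by rewrite derive_cst mulr0.
have sF : sm (fun z => kseq c i * bseq g -%R i z).
  apply: sm_mulf; first exact: sm_cst.
  by rewrite /bseq; case: pickle_inv => [k|]; [exact: sm_bas|exact: sm_cst].
exact: (sm_partial sF).1.
Qed.

Lemma eq_of_co F H : L2loc F -> L2loc H -> per F -> per H ->
  (forall k, co F k = co H k) -> {ae leb3, forall y, F y = H y}.
Proof.
move=> LF LH pF pH FH.
have LF' := Lsq_of_L2loc g_free LF; have LH' := Lsq_of_L2loc g_free LH.
suff : {ae leb3, forall y, F y - H y = 0}.
  by apply: ae3_impl => y /eqP; rewrite subr_eq0 => /eqP.
apply: (ae_hcell_all g_free).
  move=> a La; apply: ae3_impl (ae3_and (pF a La) (pH a La)) => y [e1 e2].
  by rewrite e1 e2.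
apply: (bas_complete g_free); first exact: (L2B mh LF' LH').
by move=> k; rewrite (coB g_free)// FH subrr.
Qed.

(** [bas 0] is a nonzero constant, so having mean zero is a condition on one coefficient. *)
Lemma Rintegral_cell_co0 F : L2loc F ->
  (\int[leb3]_(y in cell g) F y = 0) <-> co F 0 = 0.
Proof.
move=> LF; have mc := measurable_cell g_free.
have coo : (leb3 (cell g) < +oo)%E by rewrite leb3_cell.
have L1 : Lsq leb3 (cell g) (fun=> 1).
  by apply: (@L2_bounded _ _ _ _ _ mc _ 1) => // y; rewrite normr1.
have iF : leb3.-integrable (cell g) (EFin \o F).
  have := L2_mul mc (Lsq_cell g_free LF) L1; congr (_.-integrable _ _).
  by apply/funext => y /=; rewrite mulr1.
rewrite Rintegral_cell//.
have V0 : 0 < fine (leb3 hcell) by rewrite fine_gt0// leb3_hcell_gt0.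
set c := (Num.sqrt (fine (leb3 hcell)))^-1.
have c0 : c != 0 by rewrite invr_eq0 gt_eqF// sqrtr_gt0.
have -> : co F 0 = c * \int[leb3]_(y in hcell) F y.
  rewrite -RintegralZl//; last exact: (L2_integrable g_free (Lsq_of_L2loc g_free LF)).
  by apply: eq_Rintegral => y _; rewrite bas0 mulrC.
by split=> [->|/eqP]; [rewrite mulr0|rewrite mulf_eq0 (negbTE c0) => /eqP].
Qed.

End fourier_synthesis.

(** * Strains are exactly the elements of T^perp *)

Section potentials.
Context {R : realType} (g : 'I_3 -> R3 R).
Context (g_free : free [tuple g i | i < 3]).
Local Notation K := {ffun 'I_3 -> int}.
Implicit Types (k : K) (y : R3 R) (v phi : R3 R -> 'rV[R]_3) (e mu : R3 R -> 'M[R]_3).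
Local Notation hcell := (hcell g).
Local Notation L2 := (Lsq leb3 hcell).
Local Notation ip := (dotp leb3 hcell).
Local Notation co := (co g).
Local Notation comx := (comx g).
Let mh : measurable hcell := measurable_hcell g.

(** Bessel's inequality for each entry of [e] makes coefficients dominated by those of [e] square
    summable. *)
Lemma kseq_bound e (c : K -> R) D : (forall i j, L2loc (fun y => e y i j)) -> 0 <= D ->
  (forall k, c k ^+ 2 <= D * frob (comx e k) (comx e k)) ->
  exists B, forall n, \sum_(0 <= m < n) kseq c m ^+ 2 <= B.
Proof.
move=> Le D0 cD; pose eij i j := fun y : R3 R => e y i j.
have Lij i j : L2 (eij i j) by exact: (Lsq_of_L2loc g_free (Le i j)).
exists (D * \sum_i \sum_j ip (eij i j) (eij i j)) => n.
apply: (@le_trans _ _ (\sum_(0 <= m < n) D * \sum_i \sum_j ip (eij i j) (bseq g id m) ^+ 2)).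
  apply: ler_sum => m _; rewrite /kseq /bseq; case: pickle_inv => [k|].
    apply: le_trans (cD k) _; rewrite ler_wpM2l// /frob.
    by apply: ler_sum => i _; apply: ler_sum => j _; rewrite mxE expr2.
  rewrite expr0n mulr_ge0//; apply: sumr_ge0 => i _; apply: sumr_ge0 => j _; exact: sqr_ge0.
rewrite -mulr_sumr ler_wpM2l// exchange_big; apply: ler_sum => i _.
rewrite exchange_big; apply: ler_sum => j _.
exact: (bessel mh (L2_bseq g_free id) (bseq_orth g_free (@inj_id K)) (bseq_norm g_free id) n (Lij i j)).
Qed.

Lemma strainE v G : H1loc v -> is_weak_grad v G ->
  {ae leb3, forall y, strain v y = 2^-1 *: (G y + (G y)^T)}.
Proof.
move=> Hv vG; apply: ae3_impl (weak_grad_unique (weak_gradP Hv) vG) => y e.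
by rewrite /strain e.
Qed.

(** Since [d_j (bas (- k)) = - freq k j * bas k], the coefficient [- a_k] is placed at the index
    [- k]: the gradient then has coefficient [freq k j * a k i] at [k], whose symmetrisation is that
    of [e]. Korn's bound makes the gradient series converge, and the lower bound on frequencies the
    displacement series. *)
Lemma Tperp_potential e : Tperp g e ->
  exists2 phi, H1per0 g phi & {ae leb3, forall y, strain phi y = e y}.
Proof.
move=> Te; have [[Le se pe] _] := Te.
pose a k := polar (freq g k) (comx e k).
have aE k := polarE (comx_sym g_free k Le se) (fun M => @comx_Tperp _ _ g_free e k M Te).
have aE' k i j : comx e k i j = (freq g k i * a k j + freq g k j * a k i) / 2.
  exact: aE.
have rb k := rank_one_bound (aE' k).
have [C [C0 CP]] := freq_bound g_free.
have f0 j : freq g 0 j = 0.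
  by have := freqN g 0 j; rewrite oppr0; lra.
(* The convention on division by zero cancels the zero mode of the displacement, which is the
   mean-zero condition. *)
have a0 i : a 0 i = 0.
  rewrite /a /polar (_ : sqnorm _ = 0) ?invr0 ?mulr0//.
  by apply: big1 => j _; rewrite f0 expr0n.
(* [C] pays for inserting the squared frequency; Korn's constant 2, summed over three directions,
   gives the factor 6. *)
have aB i k : (- a k i) ^+ 2 <= (6 * C) * frob (comx e k) (comx e k).
  rewrite sqrrN; have [->|k0] := eqVneq k 0.
    rewrite a0 expr0n mulr_ge0 ?mulr_ge0//.
    by apply: sumr_ge0 => l _; apply: sumr_ge0 => m _; rewrite -expr2 sqr_ge0.
  apply: (@le_trans _ _ (C * \sum_j (freq g k j * a k i) ^+ 2)).
    have -> : \sum_j (freq g k j * a k i) ^+ 2 = sqnorm (freq g k) * a k i ^+ 2.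
      by rewrite mulr_suml; apply: eq_bigr => j _; rewrite exprMn.
    by rewrite mulrA ler_peMl ?sqr_ge0// CP.
  rewrite [6 * C]mulrC -mulrA ler_wpM2l//.
  apply: (le_trans (ler_sum _ (fun j _ => rb k i j))).
  by rewrite !big_ord_recl big_ord0; lra.
have series_phi i : exists f, [/\ L2 f,
    L2cvg leb3 hcell (psum (bseq g -%R) (kseq (fun k => - a k i))) f,
    forall k, co f (- k) = - a k i & lat_periodic g f].
  have [B cB] := kseq_bound Le (mulr_ge0 (ler0n _ _) C0) (aB i).
  exact: (fourier_series g_free (@oppr_inj K) cB).
have series_G i j : exists f, [/\ L2 f,
    L2cvg leb3 hcell (psum (bseq g id) (kseq (fun k => - (freq g k j * - a k i)))) f,
    forall k, co f k = - (freq g k j * - a k i) & lat_periodic g f].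
  have [|B cB] := @kseq_bound e (fun k => - (freq g k j * - a k i)) 2 Le (ler0n _ _) _.
    by move=> k; rewrite mulrN opprK.
  exact: (fourier_series g_free (@inj_id K) cB).
have [f fP] := choice series_phi.
have [h hP] : exists h : 'I_3 -> 'I_3 -> R3 R -> R, forall i j, [/\ L2 (h i j),
    L2cvg leb3 hcell (psum (bseq g id) (kseq (fun k => - (freq g k j * - a k i)))) (h i j),
    forall k, co (h i j) k = - (freq g k j * - a k i) & lat_periodic g (h i j)].
  have [H HP] := choice (fun p : 'I_3 * 'I_3 => series_G p.1 p.2).
  by exists (fun i j => H (i, j)) => i j; exact: (HP (i, j)).
pose phi y : 'rV[R]_3 := \row_i f i y.
pose G y : 'M[R]_3 := \matrix_(i, j) h i j y.
have phiE i : (fun y => phi y 0 i) = f i by apply/funext => y; rewrite mxE.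
have GE i j : (fun y => G y i j) = h i j by apply/funext => y; rewrite mxE.
have Lf i : L2loc (f i).
  by have [Lf _ _ pf] := fP i; exact: (L2loc_of_Lsq g_free (lat_periodic_per pf)).
have Lh i j : L2loc (h i j).
  by have [Lh _ _ ph] := hP i j; exact: (L2loc_of_Lsq g_free (lat_periodic_per ph)).
have phiG : is_weak_grad phi G.
  split=> [i j|i j psi tp]; first by rewrite GE.
  have [Lfi cf _ pf] := fP i; have [Lhi ch _ ph] := hP i j.
  under eq_Rintegral do rewrite mxE.
  under [in RHS]eq_Rintegral do rewrite mxE.
  apply: (L2cvg_weak_partial g_free _ _ _ _ Lfi Lhi (lat_periodic_per pf)
    (lat_periodic_per ph) cf _ tp) => [n|n|n|n|].
  - exact: sm_psum.
  - exact: (lat_periodic_psum g_free).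
  - by apply: L2_psum => // m; exact: (L2_bseq g_free).
  - by rewrite partial_psum//; apply: L2_psum => // m; exact: (L2_bseq g_free).
  - by apply: L2cvg_ext ch => n; rewrite partial_psum.
have Hphi : H1loc phi by split; [move=> i; rewrite phiE|exists G].
exists phi.
  split; first split=> //.
    move=> _ [n _ <-]; apply/aeW => y; apply/rowP => i; rewrite !mxE.
    by have [_ _ _] := fP i; exact.
  move=> i; rewrite phiE; apply/(Rintegral_cell_co0 g_free (Lf i)).
  by have [_ _ cf _] := fP i; rewrite -oppr0 cf a0 oppr0.
have eG : {ae leb3, forall y, forall i j, 2^-1 * (h i j y + h j i y) = e y i j}.
  apply: ae3_forall => i; apply: ae3_forall => j.
  have [Lhi _ ci pi] := hP i j; have [Lhj _ cj pj] := hP j i.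
  apply: (eq_of_co g_free) => //.
  - by apply: L2locZ; exact: L2locD.
  - by apply: lat_periodic_per => y n; rewrite pi pj.
  - exact: (periodic_comp (fun A : 'M[R]_3 => A i j) pe).
  move=> k; rewrite (coZ g_free)//; last exact: L2D.
  rewrite (coD g_free)// ci cj.
  by have := aE' k i j; rewrite mxE => ->; field.
apply: ae3_impl (ae3_and (strainE Hphi phiG) eG) => y [-> eij].
by apply/matrixP => i j; rewrite -eij !mxE.
Qed.

Lemma strain_coef v k i j : H1per g v ->
  comx (strain v) k i j =
  - ((freq g k j * co (fun y => v y 0 i) (- k) + freq g k i * co (fun y => v y 0 j) (- k)) / 2).
Proof.
move=> Hv; have [Hl _] := Hv; have [LG _] := weak_gradP Hl.
rewrite mxE /strain.
have LG' l m := Lsq_of_L2loc g_free (LG l m).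
under eq_fun do rewrite !mxE.
rewrite (coZ g_free)//; last exact: L2D.
rewrite (coD g_free)// !(co_weak_grad g_free _ _ _ Hv (weak_gradP Hl)).
by field.
Qed.

Lemma L2pers_strain v : H1per g v -> L2pers g (strain v).
Proof.
move=> [Hl pv]; have vG := weak_gradP Hl; have [LG _] := vG; have [Lv _] := Hl.
split.
- move=> i j; rewrite /strain; under eq_fun do rewrite !mxE.
  by apply: L2locZ; exact: L2locD.
- by apply/aeW => y; rewrite /sym_mx /strain linearZ /= linearD /= trmxK addrC.
- exact: (periodic_comp (fun A : 'M[R]_3 => 2^-1 *: (A + A^T)) (weak_grad_periodic Lv vG pv)).
Qed.

(** At each frequency the symmetry of [comx mu k] reduces the product of coefficients to entries of
    [comx mu k *m freq k], which vanish. Working on coefficients avoids testing [div mu] with [v],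
    which is not a test function. *)
Lemma Tperp_strain v : H1per g v -> Tperp g (strain v).
Proof.
move=> Hv; have Ls := L2pers_strain Hv; split=> // mu Tm.
have [Le _ _] := Ls; have [[Lm sm _] _] := Tm.
rewrite Rintegral_cell_frob// pair_big /=.
apply: (parseval_sum0 g_free (F := fun p y => strain v y p.1 p.2) (H := fun p y => mu y p.1 p.2)).
- by move=> p; exact: Lsq_of_L2loc.
- by move=> p; exact: Lsq_of_L2loc.
move=> k; transitivity (\sum_i \sum_j comx (strain v) k i j * comx mu k i j).
  by rewrite pair_big /=; apply: eq_bigr => p _; rewrite !mxE.
have sM := comx_sym g_free k Lm sm; have Mk := comx_Tspace g_free k Tm.
set c := fun i => co (fun y => v y 0 i) (- k).
have e1 : \sum_i \sum_j (freq g k j * c i) * comx mu k i j = 0.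
  apply: big1 => i _; transitivity (c i * \sum_j comx mu k i j * freq g k j).
    rewrite mulr_sumr; apply: eq_bigr => j _; ring.
  by rewrite Mk mulr0.
have e2 : \sum_i \sum_j (freq g k i * c j) * comx mu k i j = 0.
  apply: etrans e1; rewrite exchange_big; apply: eq_bigr => i _; apply: eq_bigr => j _.
  by rewrite -{1}sM mxE.
transitivity (- ((\sum_i \sum_j (freq g k j * c i) * comx mu k i j +
    \sum_i \sum_j (freq g k i * c j) * comx mu k i j) / 2)); last first.
  by rewrite e1 e2 addr0 mul0r oppr0.
rewrite -big_split mulr_suml -sumrN; apply: eq_bigr => i _.
rewrite -big_split mulr_suml -sumrN; apply: eq_bigr => j _.
by rewrite (strain_coef k i j Hv) /c /=; field.
Qed.

(** Infinitesimal rotations are not periodic: at [k != 0] the difference [d] of the coefficients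
    satisfies [f_m d_l + f_l d_m = 0] for all [l], [m], which forces [d = 0]. The mean-zero
    condition settles the zero mode. *)
Lemma strain_inj v w : H1per0 g v -> H1per0 g w ->
  {ae leb3, forall y, strain v y = strain w y} -> {ae leb3, forall y, v y = w y}.
Proof.
move=> [Hv v0] [Hw w0] vw.
have [Lv _ _] := L2pers_strain Hv; have [Lw _ _] := L2pers_strain Hw.
have [[Lvi _] pv] := Hv; have [[Lwi _] pw] := Hw.
suff h : {ae leb3, forall y, forall i, v y 0 i = w y 0 i}.
  by apply: ae3_impl h => y h; apply/rowP.
apply: ae3_forall => i; apply: (eq_of_co g_free) => // [||k].
- exact: (periodic_comp (fun r : 'rV[R]_3 => r 0 i) pv).
- exact: (periodic_comp (fun r : 'rV[R]_3 => r 0 i) pw).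
have [->|k0] := eqVneq k 0.
  by rewrite (proj1 (Rintegral_cell_co0 g_free (Lvi i)) (v0 i))
    (proj1 (Rintegral_cell_co0 g_free (Lwi i)) (w0 i)).
pose d j := co (fun y => v y 0 j) k - co (fun y => w y 0 j) k.
pose f := freq g k.
have alg (p q x z t u : R) : - ((- p * x + - q * z) / 2) = - ((- p * t + - q * u) / 2) ->
    p * (x - t) + q * (z - u) = 0 by lra.
have D l m : f m * d l + f l * d m = 0.
  have h : comx (strain v) (- k) l m = comx (strain w) (- k) l m.
    rewrite [LHS]mxE [RHS]mxE.
    apply: co_ae; [exact: (Lsq_of_L2loc g_free (Lv l m))|exact: (Lsq_of_L2loc g_free (Lw l m))|].
    by apply: ae3_impl vw => y ->.
  have := etrans (esym (strain_coef (- k) l m Hv)) (etrans h (strain_coef (- k) l m Hw)).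
  rewrite (opprK k) !freqN => E; apply: (alg _ _ _ _ _ _ E).
apply/eqP; rewrite -subr_eq0 -/(d i).
have q0 : sqnorm f != 0.
  apply/eqP => /sqnorm_eq0 fk; case/eqP: k0; exact: (freq_eq0 g_free fk).
(* The diagonal relations give [f . d = 0]; contracting the others with [f] then leaves
   [|f|^2 d_i = 0]. *)
have fd : \sum_j f j * d j = 0.
  by apply: big1 => j _; have := D j j; lra.
have : sqnorm f * d i = 0.
  transitivity (sqnorm f * d i + f i * \sum_j f j * d j).
    by rewrite fd mulr0 addr0.
  rewrite mulr_sumr mulr_suml -big_split big1// => j _ /=.
  transitivity (f j * (f j * d i + f i * d j)); first by ring.
  by rewrite D mulr0.
by move/eqP; rewrite mulf_eq0 (negbTE q0).
Qed.

End potentials.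

(** * Invariance of the energy integrals under a.e. equality *)

Section energy_integrals.
Context {R : realType} (g : 'I_3 -> R3 R).
Context (g_free : free [tuple g i | i < 3]).
Context (C : R3 R -> @tensor4 R).
Context (mC : forall i j k l, measurable_fun [set: mR3 R] (fun y => C y i j k l)).
Implicit Types (A : 'M[R]_3) (e mu : R3 R -> 'M[R]_3).

Let mx_measurable e := forall i j, measurable_fun [set: mR3 R] (fun y => e y i j).

Lemma L2pers_measurable e : L2pers g e -> mx_measurable e.
Proof. by move=> [Le _ _] i j; case: (Le i j). Qed.

Lemma measurable_tapp e : mx_measurable e -> mx_measurable (fun y => tapp (C y) (e y)).
Proof.
move=> me i j; under eq_fun do rewrite mxE.
apply: measurable_sum => k; apply: measurable_sum => l; exact: measurable_funM.
Qed.

Lemma measurable_frob e mu : mx_measurable e -> mx_measurable mu ->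
  measurable_fun [set: mR3 R] (fun y : mR3 R => frob (e y) (mu y)).
Proof.
move=> me mm; apply: measurable_sum => k; apply: measurable_sum => l.
exact: measurable_funM.
Qed.

(** Potentials reproduce a given field of T^perp only a.e., so the equations have to be carried
    across a.e. equality of their arguments. *)
Lemma energy_ae_eq e e' mu mu' : mx_measurable e -> mx_measurable e' ->
  mx_measurable mu -> mx_measurable mu' ->
  {ae leb3, forall y, e y = e' y} -> {ae leb3, forall y, mu y = mu' y} ->
  \int[leb3]_(y in cell g) frob (tapp (C y) (e y)) (mu y) =
  \int[leb3]_(y in cell g) frob (tapp (C y) (e' y)) (mu' y).
Proof.
move=> me me' mm mm' ee mumu; apply: Rintegral_ae_eq.
- exact: measurable_cell.
- by apply: measurable_funTS; apply: measurable_frob => //; exact: measurable_tapp.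
- by apply: measurable_funTS; apply: measurable_frob => //; exact: measurable_tapp.
- by apply: ae3_impl (ae3_and ee mumu) => y [-> ->].
Qed.

Lemma mx_integral_ae_eq mu mu' : mx_measurable mu -> mx_measurable mu' ->
  {ae leb3, forall y, mu y = mu' y} ->
  mx_integral (cell g) (fun y => tapp (C y) (mu y)) =
  mx_integral (cell g) (fun y => tapp (C y) (mu' y)).
Proof.
move=> mm mm' mumu; apply/matrixP => i j; rewrite !mxE; apply: Rintegral_ae_eq.
- exact: measurable_cell.
- by apply: measurable_funTS; exact: measurable_tapp.
- by apply: measurable_funTS; exact: measurable_tapp.
- by apply: ae3_impl mumu => y ->.
Qed.

Lemma frobZr c A B : frob A (c *: B) = c * frob A B.
Proof.
rewrite /frob mulr_sumr; apply: eq_bigr => i _; rewrite mulr_sumr.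
by apply: eq_bigr => j _; rewrite mxE mulrCA.
Qed.

End energy_integrals.

Theorem proposition15 (R : realType) (g : 'I_3 -> R3 R)
    (g_free : free [tuple g i | i < 3])
    (C : R3 R -> @tensor4 R) (C_rigid : rigidity_tensor g C)
    (A : 'M[R]_3) (A_sym : sym_mx A) :
  (forall phi, solves_displacement g C A phi ->
     solves_strain g C A (strain phi)) /\
  (forall e, solves_strain g C A e ->
     exists phi, [/\ H1per0 g phi,
       ae_eq3 (strain phi) e,
       forall psi, H1per0 g psi -> ae_eq3 (strain psi) e -> ae_eq3 psi phi &
       solves_displacement g C A phi]).
Proof.
have [_ mC _ _ _] := C_rigid.
have V0 : cell_volume g != 0 by rewrite gt_eqF// cell_volume_gt0.
have mT e (Te : Tperp g e) := L2pers_measurable (proj1 Te).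
split=> [phi [Hphi phi_sol]|e [Te e_sol]].
  have Ts := Tperp_strain g_free (proj1 Hphi); split=> // mu Tmu.
  (* Every test field of the strain formulation is a.e. the strain of an admissible displacement, so
     the displacement equation reaches all of T^perp. *)
  have [v Hv vmu] := Tperp_potential g_free Tmu.
  have Tv := Tperp_strain g_free (proj1 Hv).
  have ss : {ae leb3, forall y, strain phi y = strain phi y} by exact/aeW.
  rewrite -(energy_ae_eq g_free mC (mT _ Ts) (mT _ Ts) (mT _ Tv) (mT _ Tmu) ss vmu).
  rewrite -(mx_integral_ae_eq g_free mC (mT _ Tv) (mT _ Tmu) vmu).
  by rewrite phi_sol// frobZr mulrN.
have [phi Hphi phie] := Tperp_potential g_free Te; exists phi.
have Ts := Tperp_strain g_free (proj1 Hphi).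
split=> //.
  move=> psi Hpsi psie; apply: (strain_inj g_free Hpsi Hphi).
  by apply: ae3_impl (ae3_and psie phie) => y [-> ->].
split=> // v Hv; have Tv := Tperp_strain g_free (proj1 Hv).
have ss : {ae leb3, forall y, strain v y = strain v y} by exact/aeW.
rewrite (energy_ae_eq g_free mC (mT _ Ts) (mT _ Te) (mT _ Tv) (mT _ Tv) phie ss).
(* The displacement equation carries no averaging factor: both members are multiplied by the nonzero
   [1 / |Y|] to meet the strain equation. *)
by apply: (mulfI (invr_neq0 V0)); rewrite e_sol// frobZr mulrN.
Qed.
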